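(* Let $p=\big((x_1,y_1),(x_2,y_2)\big)$ be a pair of points of $(0,1)^2$ with $x_1<x_2$ and $y_2<y_1$, and let $T=Z_p$ be the zipper map of parameter $p$. Assume that $T$ is hypersensitive, i.e. $\min\big(\frac{y_1}{x_1},\frac{y_1-y_2}{x_2-x_1},\frac{1-y_2}{1-x_2}\big)>1$. Then there exists a $T$-invariant Borel probability measure $\mu$ on $[0,1]$ with positive Kolmogorov-Sinai mean dimension: $\operatorname{mdim}_{KS}(T,\mu)>0$.
   Context: Zipper maps. Let $\mathscr{C}^0_0$ be the set of continuous maps $f:[0,1]\to[0,1]$ with $f(0)=0$ and $f(1)=1$, with the uniform distance. For $p=\big((x_1,y_1),(x_2,y_2)\big)$ with both points in $(0,1)^2$, $x_1<x_2$, $y_2<y_1$, let $\Phi_p:\mathscr{C}^0_0\to\mathscr{C}^0_0$ be defined by: $\Phi_pf(x)=y_1 f\big(\frac{x}{x_1}\big)$ if $x\in[0,x_1]$; $\Phi_pf(x)=y_1-(y_1-y_2)f\big(\frac{x-x_1}{x_2-x_1}\big)$ if $x\in[x_1,x_2]$; $\Phi_pf(x)=y_2+(1-y_2)f\big(\frac{x-x_2}{1-x_2}\big)$ if $x\in[x_2,1]$. The map $\Phi_p$ is a contraction in the uniform norm; the zipper map $Z_p\in\mathscr{C}^0_0$ of parameter $p$ is its unique fixed point. Kolmogorov-Sinai mean dimension. Let $T:\Omega\to\Omega$ be a Borel measurable map of a compact metric space and $\mu$ a $T$-invariant Borel probability measure. For a finite measurable partition $\xi=(B_1,\dots,B_k)$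 of $\Omega$, let $H(\mu;\xi)=-\sum_{i}\mu(B_i)\log\mu(B_i)$ (with $0\log0=0$), and $h(T,\mu,\xi)=\lim_{n\to\infty}\frac1n H(\mu;\xi_n)$, where $\xi_n$ is the common refinement of the partitions $T^{-j}(\xi)$, $0\le j\le n-1$. Let $\mathcal{P}_k$ be the set of measurable partitions of $\Omega$ into at most $k$ subsets. Then \[\operatorname{mdim}_{KS}(T,\mu)=\liminf_{k\to\infty}\ \sup_{\xi\in\mathcal{P}_k}\frac{h(T,\mu,\xi)}{\log k}.\] *)

(* Defs.v *)
From HB Require Import structures.
From mathcomp Require Import all_boot all_order all_algebra.
From mathcomp Require Import all_classical all_reals all_analysis ring.

Set Implicit Arguments.
Unset Strict Implicit.
Unset Printing Implicit Defensive.

Import Order.TTheory GRing.Theory Num.Theory.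
Import numFieldNormedType.Exports.

Local Open Scope classical_set_scope.
Local Open Scope ring_scope.

(* [0,1] as a subtype of R, with the induced metric and topology; its
   sigma-algebra is the Borel one, generated by its own open sets. *)
Definition I01 (R : realType) : Type := `[0 : R, 1 : R]%classic.

Section unit_interval.
Context {R : realType}.

Lemma zero_in_I01 : (0 : R) \in `[0 : R, 1 : R]%classic.
Proof. by rewrite inE /= in_itv /= lexx ler01. Qed.

Lemma one_in_I01 : (1 : R) \in `[0 : R, 1 : R]%classic.
Proof. by rewrite inE /= in_itv /= lexx ler01. Qed.

HB.instance Definition _ :=
  PseudoMetric.copy (I01 R) (`[0 : R, 1 : R]%classic : Type).
HB.instance Definition _ :=
  SubChoice.copy (I01 R) {x : R | x \in `[0 : R, 1 : R]%classic}.

Definition I01_0 : I01 R := exist _ 0 zero_in_I01.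
Definition I01_1 : I01 R := exist _ 1 one_in_I01.

HB.instance Definition _ := isPointed.Build (I01 R) I01_0.
HB.instance Definition _ :=
  Measurable.copy (I01 R) (g_sigma_algebraType (@open (I01 R))).

(* The inverse of the inclusion [0,1] -> R, with the junk value 0 outside
   [0,1]. *)
Definition toI01 (r : R) : I01 R := insubd I01_0 r.

Lemma val_toI01 (r : R) : 0 <= r <= 1 -> val (toI01 r) = r.
Proof. by move=> r01; rewrite /toI01 insubdK// inE /= in_itv. Qed.

Lemma val_I01 (x : I01 R) : 0 <= val x <= 1.
Proof. by case: x => x /= /set_mem /=; rewrite in_itv. Qed.

End unit_interval.

Section zipper.
Context {R : realType}.
Implicit Types (p : (R * R) * (R * R)) (f : I01 R -> I01 R).

Definition zipper_param p : Prop :=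
  let: ((x1, y1), (x2, y2)) := p in
  [/\ 0 < x1 < 1, 0 < y1 < 1, 0 < x2 < 1, 0 < y2 < 1 & x1 < x2 /\ y2 < y1].

Definition C00 : set (I01 R -> I01 R) :=
  [set f | [/\ continuous f, f I01_0 = I01_0 & f I01_1 = I01_1]].

(* At x = x1 and at x = x2 the two overlapping formulas agree for f in C00. *)
Definition zipper_value p f (x : R) : R :=
  let: ((x1, y1), (x2, y2)) := p in
  if x <= x1 then y1 * val (f (toI01 (x / x1)))
  else if x <= x2 then
    y1 - (y1 - y2) * val (f (toI01 ((x - x1) / (x2 - x1))))
  else y2 + (1 - y2) * val (f (toI01 ((x - x2) / (1 - x2)))).

Definition zipper_op p f : I01 R -> I01 R :=
  fun x => toI01 (zipper_value p f (val x)).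

(* No use of toI01 in zipper_op falls outside [0,1]. *)
Lemma zipper_opE x1 y1 x2 y2 f (x : I01 R) :
  zipper_param ((x1, y1), (x2, y2)) ->
  val (zipper_op ((x1, y1), (x2, y2)) f x) =
    zipper_value ((x1, y1), (x2, y2)) f (val x) /\
  (val x <= x1 -> val (toI01 (val x / x1)) = val x / x1) /\
  (x1 <= val x <= x2 ->
    val (toI01 ((val x - x1) / (x2 - x1))) = (val x - x1) / (x2 - x1)) /\
  (x2 <= val x ->
    val (toI01 ((val x - x2) / (1 - x2))) = (val x - x2) / (1 - x2)).
Proof.
move=> [/andP[a0 a1] /andP[b0 b1] /andP[c0 c1] /andP[d0 d1] [ac db]].
have /andP[x0 x1'] := val_I01 x.
have ca : 0 < x2 - x1 by rewrite subr_gt0.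
have c1' : 0 < 1 - x2 by rewrite subr_gt0.
split; last first.
  split=> [xa|]; last split=> [/andP[ax xc]|cx]; apply: val_toI01.
  - by rewrite divr_ge0 ?(ltW a0)//= ler_pdivrMr// mul1r.
  - by rewrite divr_ge0 ?subr_ge0 ?(ltW ac)//= ler_pdivrMr// mul1r lerD2r.
  - by rewrite divr_ge0 ?subr_ge0 ?(ltW c1)//= ler_pdivrMr// mul1r lerD2r.
have conv (u v : R) (t : I01 R) : 0 <= u <= 1 -> 0 <= v <= 1 ->
    0 <= u + (v - u) * val t <= 1.
  move=> /andP[u0 u1] /andP[v0 v1]; have /andP[t0 t1] := val_I01 t.
  have -> : u + (v - u) * val t = (1 - val t) * u + val t * v.
    by ring.
  have s0 : 0 <= 1 - val t by rewrite subr_ge0.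
  rewrite addr_ge0 ?mulr_ge0//=.
  rewrite (le_trans (lerD (ler_piMr s0 u1) (ler_piMr t0 v1)))//.
  by rewrite subrK.
rewrite val_toI01//= /zipper_value; case: ifP => _; last case: ifP => _.
- by have := conv 0 y1 (f (toI01 (val x / x1))); rewrite add0r subr0; apply;
    rewrite ?lexx ?ler01 ?(ltW b0) ?(ltW b1).
- by rewrite -mulNr opprB; apply: conv; rewrite ?(ltW b0) ?(ltW b1) ?(ltW d0) ?(ltW d1).
- by apply: conv; rewrite ?lexx ?ler01 ?(ltW d0) ?(ltW d1).
Qed.

(* For p satisfying zipper_param, zipper_op p is a contraction of C00 for the
   uniform distance, so this is its unique fixed point there; the identity is
   only a default value for choice, not a fixed point of zipper_op p. *)
Definition zipper_map p : I01 R -> I01 R :=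
  xget (fun x => x : I01 R) [set f | C00 f /\ zipper_op p f = f].

End zipper.

Section kolmogorov_sinai.
Context {d : measure_display} {Omega : measurableType d} {R : realType}.
Implicit Types (T : Omega -> Omega) (mu : probability Omega R).

Definition invariant_measure T mu : Prop :=
  forall A, measurable A -> mu (T @^-1` A) = mu A.

(* A member may be empty: these are the partitions into at most k subsets. *)
Definition partitions (k : nat) : set ('I_k -> set Omega) :=
  [set xi | [/\ forall i, measurable (xi i),
                trivIset setT xi &
                \bigcup_(i : 'I_k) xi i = setT]].
Arguments partitions : clear implicits.

(* ln 0 = 0, so 0 log 0 = 0. *)
Definition partition_entropy mu (J : finType) (xi : J -> set Omega) : R :=
  - \sum_(j : J) fine (mu (xi j)) * ln (fine (mu (xi j))).

(* The common refinement of the T^-j(xi), j < n, indexed by the itineraries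
   w; itineraries that are not realized index the empty set. *)
Definition refinement T (k : nat) (xi : 'I_k -> set Omega) (n : nat) :
    {ffun 'I_n -> 'I_k} -> set Omega :=
  fun w => \bigcap_(j : 'I_n) (iter j T @^-1` xi (w j)).

Definition ks_entropy T mu (k : nat) (xi : 'I_k -> set Omega) : R :=
  limn (fun n => partition_entropy mu (refinement T xi (n := n)) / n%:R).

Definition mdim_KS T mu : \bar R :=
  limn_einf (fun k : nat =>
    ereal_sup [set (ks_entropy T mu xi / ln k%:R)%:E
              | xi in partitions k]).

End kolmogorov_sinai.

(* Main.v *)
Require Import Defs.
From mathcomp Require Import all_boot all_order all_algebra.
From mathcomp Require Import all_classical all_reals all_analysis.
From mathcomp Require Import measurable_realfun.
From mathcomp Require Import ring lra zify.

Set Implicit Arguments.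
Unset Strict Implicit.
Unset Printing Implicit Defensive.

Import Order.TTheory GRing.Theory Num.Theory.
Import numFieldNormedType.Exports.

Local Open Scope classical_set_scope.
Local Open Scope ring_scope.

(* T is an affine copy of itself on every cylinder, and hypersensitivity makes it
   expand heights: an interval of length at most rho^n contains a subinterval on which
   T rises by at least c lam^n times that length, with lam > 1 > rho.  Hence a fixed
   interval Q contains exponentially many disjoint subintervals that can all be followed
   by the same way back to a base interval K.  Pulling back by first passage points
   (inf {x : y <= T x}) makes these returns order preserving, so that they converge along
   every infinite sequence of choices.  Moreover first passage points are records of T;
   as T is nowhere monotone, the interval Q_m where the choices of level m are made can
   be taken off the orbits of all blocks of lower level.  Blocks of random independent
   levels give a Bernoulli process, coded into [0,1]; the stationary measure is the law
   of its suspension.  A choice of level m is a long word over an alphabet of size 2^m,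
   and the partition of level m shows at a point x the digit of the choice made at the
   next visit to Q_m, in the position given by the time left until this visit.  Thus each
   of the steps preceding the visit reveals a new uniform letter, and these steps have
   frequency bounded below: the entropy is at least (1/8) log (2^m).  It is read off the
   backward conditional entropies H(xi | T^-1 xi_n), which are nonincreasing in n. *)

(** A single measure has to serve all [k] at once, and this fixes the parameters. Blocks of level
    [m > 0] must be rare, of frequency about [1 / lv_period f m], to keep the mean duration of a
    block finite; still they have to supply letters of an alphabet of size [2 ^ m] during a fixed
    fraction of the time. So one choice must fill with digits the whole wait before it, about
    [lv_period f m] blocks of lower level. This is circular: more digits need more branches, hence
    shorter intervals, a longer way back, a larger period, and again more digits. Hypersensitivity
    breaks the circle: short intervals are stretched by unbounded factors in one step, so the way
    back takes at most [n / D + C] steps with [D] arbitrary, while the number of branches grows like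
    [lam ^+ n]. Independence has two sources: [T] forgets the choice after one step, as all branches
    of a fan are followed by the same way back; and the digits are read from high to low index, so
    that the current one is still uniform given the later ones. *)

(** * Entropy of finite laws *)

Section finite_entropy.
Context {R : realType}.
Implicit Types x y F : R.

Lemma ler_lnB1 (x : R) : 0 < x -> ln x <= x - 1.
Proof.
by move=> x0; have := @le_ln1Dx R (x - 1); rewrite addrCA subrr addr0; apply; lra.
Qed.

Lemma mulr_ln_div_ge (x y : R) : 0 <= x -> 0 < y -> x - y <= x * (ln x - ln y).
Proof.
rewrite le_eqVlt => /predU1P[<-|x0] y0; first by rewrite mul0r; lra.
have := ler_lnB1 (divr_gt0 y0 x0).
rewrite ln_div ?posrE// => /(ler_wpM2l (ltW x0)).
by rewrite mulrBr mulrBr mulrCA divff ?gt_eqF// !mulr1; lra.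
Qed.

(* Splitting [x = F + (x - F)], this is the log-sum inequality for the mixture
   of the uniform law of total mass [k * F] and a remainder. *)
Lemma mulr_ln_mixture (k : nat) F x y : (0 < k)%N -> 0 <= F -> F <= x ->
  k%:R * F + (x - F) <= y -> F * ln k%:R <= x * (ln y - ln x).
Proof.
move=> k0 F0 Fx kFy; have k1 : 0 < k%:R :> R by rewrite ltr0n.
have k1' : 1 <= k%:R :> R by rewrite ler1n.
have x0 : 0 <= x by lra.
have [xE|xN0] := eqVneq x 0.
  have -> : F = 0 by apply/eqP; rewrite eq_le F0 -xE Fx.
  by rewrite xE !mul0r.
have {}x0 : 0 < x by rewrite lt_neqAle eq_sym xN0.
have y0 : 0 < y.
  by have : F <= k%:R * F; [exact: ler_peMl | lra].
have h1 := mulr_ln_div_ge (ltW y0) (mulr_gt0 k1 x0).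
have h2 := mulr_ln_div_ge (ltW y0) x0.
rewrite lnM ?posrE// in h1.
have e1 : ln x + ln k%:R - ln y <= k%:R * x / y - 1.
  have := ler_lnB1 (divr_gt0 (mulr_gt0 k1 x0) y0).
  by rewrite ln_div ?posrE ?mulr_gt0// lnM ?posrE//; lra.
have e2 : ln x - ln y <= x / y - 1.
  by have := ler_lnB1 (divr_gt0 x0 y0); rewrite ln_div ?posrE.
have e3 : F * (k%:R * x / y) + (x - F) * (x / y) <= x.
  have -> : F * (k%:R * x / y) + (x - F) * (x / y) =
     x * ((k%:R * F + (x - F)) / y) by field; rewrite gt_eqF.
  by apply: ler_piMr; [exact: ltW | rewrite ler_pdivrMr// mul1r].
have : F * (ln x + ln k%:R - ln y) + (x - F) * (ln x - ln y) <= 0.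
  have g1 := ler_wpM2l F0 e1.
  have xF : 0 <= x - F by lra.
  have g2 := ler_wpM2l xF e2.
  lra.
lra.
Qed.

Lemma sum_prod (L W : finType) (f : L * W -> R) :
  \sum_x f x = \sum_l \sum_w f (l, w).
Proof. by rewrite pair_bigA; apply: eq_bigr => -[]. Qed.

Definition entropy (J : finType) (p : J -> R) : R := - \sum_j p j * ln (p j).

Lemma entropy_marginal (L W : finType) (p : L * W -> R) :
  entropy p - entropy (fun w => \sum_l p (l, w)) =
  \sum_w \sum_l p (l, w) * (ln (\sum_l' p (l', w)) - ln (p (l, w))).
Proof.
rewrite /entropy opprK addrC sum_prod exchange_big/= -sumrB; apply: eq_bigr => w _.
by rewrite mulr_suml -sumrB; apply: eq_bigr => l _; rewrite mulrBr.
Qed.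

(** Given [w], the letters of [S] share a uniform part of mass [#|S| * F w], which contributes its
    full [ln #|S|]; the remainder and the letters outside [S] can only add to the conditional
    entropy. *)
Lemma entropy_marginal_ge (L W : finType) (S : {set L}) (p : L * W -> R)
    (F : W -> R) :
  (0 < #|S|)%N -> (forall lw, 0 <= p lw) -> (forall w, 0 <= F w) ->
  (forall l w, l \in S -> F w <= p (l, w)) ->
  #|S|%:R * (\sum_w F w) * ln #|S|%:R <=
  entropy p - entropy (fun w => \sum_l p (l, w)).
Proof.
move=> S0 p0 F0 Fp; rewrite entropy_marginal mulr_sumr mulr_suml.
apply: ler_sum => w _; rewrite -mulrA mulr_natl -sumr_const big_mkcond/=.
apply: ler_sum => l _; case: ifPn => [lS|_].
  apply: mulr_ln_mixture => //; first exact: Fp.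
  rewrite mulr_natl -sumr_const (bigD1 l)//= [leRHS](bigD1 l)//=.
  suff : \sum_(i in S | i != l) F w <= \sum_(i | i != l) p (i, w) by lra.
  rewrite big_mkcondl/=; apply: ler_sum => i _.
  by case: ifPn => // iS; exact: Fp.
have := @mulr_ln_mixture 1 0 (p (l, w)) (\sum_l' p (l', w)) isT (lexx _) (p0 _).
rewrite mul0r; apply; rewrite mulr0 add0r subr0 (bigD1 l)//= lerDl.
exact: sumr_ge0.
Qed.

Lemma entropy_marginal_ge0 (L W : finType) (p : L * W -> R) :
  (forall lw, 0 <= p lw) ->
  0 <= entropy p - entropy (fun w => \sum_l p (l, w)).
Proof.
move=> p0; rewrite entropy_marginal.
apply: sumr_ge0 => w _; apply: sumr_ge0 => l _.
have := @mulr_ln_mixture 1 0 (p (l, w)) (\sum_l' p (l', w)) isT (lexx _) (p0 _).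
rewrite mul0r; apply; rewrite mulr0 add0r subr0 (bigD1 l)//= lerDl.
exact: sumr_ge0.
Qed.

(** Gibbs' inequality between [p] and the law that makes [l] and [l'] independent given [w]:
    conditioning [l] on [l'] as well lowers its entropy. *)
Lemma entropy_submodular (L W L' : finType) (p : L * (W * L') -> R) :
  (forall z, 0 <= p z) ->
  entropy p - entropy (fun wl => \sum_l p (l, wl)) <=
  entropy (fun lw : L * W => \sum_l' p (lw.1, (lw.2, l'))) -
  entropy (fun w => \sum_l \sum_l' p (l, (w, l'))).
Proof.
move=> p0.
have := entropy_marginal (fun lw : L * W => \sum_l' p (lw.1, (lw.2, l'))) => /= ->.
have := entropy_marginal p => ->.
rewrite sum_prod.
apply: ler_sum => w _; rewrite exchange_big/= -subr_ge0 -sumrB.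
set P := \sum_l0 \sum_l0' p (l0, (w, l0')).
have P0 : 0 <= P by apply: sumr_ge0 => i _; apply: sumr_ge0.
have p_eq0 l : \sum_l' p (l, (w, l')) = 0 -> forall l', p (l, (w, l')) = 0.
  move=> e l'; apply/eqP; move/eqP: e; rewrite psumr_eq0// => /allP/(_ l').
  by rewrite mem_index_enum => /(_ isT).
have [P00|PN0] := eqVneq P 0.
  apply: sumr_ge0 => l _; rewrite mulr_suml -sumrB; apply: sumr_ge0 => l' _.
  suff -> : p (l, (w, l')) = 0 by rewrite !mul0r subr0.
  apply: p_eq0; apply/eqP.
  move/eqP: P00; rewrite psumr_eq0; last by move=> i _; apply: sumr_ge0.
  by move=> /allP/(_ l); rewrite mem_index_enum => /(_ isT).
have {}P0 : 0 < P by rewrite lt_neqAle eq_sym PN0.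
pose q l l' := (\sum_l0 p (l0, (w, l'))) * (\sum_l'0 p (l, (w, l'0))) / P.
(* [p] and [q] have the same total mass over [(l, l')], so the bound [x - y <= x * (ln x - ln y)]
   sums up to a nonnegative quantity. *)
apply: (@le_trans _ _ (\sum_l \sum_l' (p (l, (w, l')) - q l l'))).
  rewrite exchange_big/=; under eq_bigr do rewrite sumrB.
  rewrite sumrB exchange_big/= -/P.
  suff -> : \sum_l' \sum_l q l l' = P by rewrite subrr.
  under eq_bigr do rewrite -mulr_suml -mulr_sumr -/P -mulrA divff// mulr1.
  by rewrite exchange_big.
apply: ler_sum => l _; rewrite mulr_suml -sumrB; apply: ler_sum => l' _.
have [->|pN0] := eqVneq (p (l, (w, l'))) 0.
  rewrite !mul0r subrr sub0r oppr_le0 /q divr_ge0 ?mulr_ge0 ?(ltW P0)//;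
  exact: sumr_ge0.
have pp : 0 < p (l, (w, l')) by rewrite lt_neqAle eq_sym pN0 p0.
have c1 : 0 < \sum_l0 p (l0, (w, l')).
  by rewrite (bigD1 l)//=; apply: ltr_pwDl => //; exact: sumr_ge0.
have c2 : 0 < \sum_l'0 p (l, (w, l'0)).
  by rewrite (bigD1 l')//=; apply: ltr_pwDl => //; exact: sumr_ge0.
have q0 : 0 < q l l' by rewrite divr_gt0 ?mulr_gt0.
have := mulr_ln_div_ge (ltW pp) q0.
by rewrite /q ln_div ?posrE ?mulr_gt0// lnM ?posrE//; lra.
Qed.

End finite_entropy.

(** * Kolmogorov-Sinai entropy from backward conditional entropies *)

Section itinerary_entropy.
Context {d : measure_display} {Omega : measurableType d} {R : realType}.
Variables (T : Omega -> Omega) (mu : probability Omega R) (k : nat).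
Variable xi : 'I_k -> set Omega.
Hypothesis mT : measurable_fun setT T.
Hypothesis muT : invariant_measure T mu.
Hypothesis xi_part : partitions xi.

Definition ffun_cons n (l : 'I_k) (w : {ffun 'I_n -> 'I_k}) :
    {ffun 'I_n.+1 -> 'I_k} :=
  [ffun i => oapp w l (unlift ord0 i)].

Definition ffun_rcons n (w : {ffun 'I_n -> 'I_k}) (l : 'I_k) :
    {ffun 'I_n.+1 -> 'I_k} :=
  [ffun i => oapp w l (unlift ord_max i)].

Lemma ffun_cons_bij n :
  bijective (fun lw : 'I_k * {ffun 'I_n -> 'I_k} => ffun_cons lw.1 lw.2).
Proof.
exists (fun w : {ffun 'I_n.+1 -> 'I_k} => (w ord0, [ffun i => w (lift ord0 i)])) => [[l w]|w] /=.
  rewrite ffunE unlift_none/=; congr pair; apply/ffunP => i.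
  by rewrite !ffunE liftK.
by apply/ffunP => i; rewrite !ffunE; case: unliftP => [j ->|->]//=; rewrite ffunE.
Qed.

Lemma ffun_rcons_bij n :
  bijective (fun wl : {ffun 'I_n -> 'I_k} * 'I_k => ffun_rcons wl.1 wl.2).
Proof.
exists (fun w : {ffun 'I_n.+1 -> 'I_k} => ([ffun i => w (lift ord_max i)], w ord_max)) => [[w l]|w] /=.
  rewrite ffunE unlift_none/=; congr pair; apply/ffunP => i.
  by rewrite !ffunE liftK.
by apply/ffunP => i; rewrite !ffunE; case: unliftP => [j ->|->]//=; rewrite ffunE.
Qed.

Lemma ffun_cons_rcons n l (w : {ffun 'I_n -> 'I_k}) l' :
  ffun_cons l (ffun_rcons w l') = ffun_rcons (ffun_cons l w) l'.
Proof.
apply/ffunP => i; rewrite !ffunE.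
case: (unliftP ord0 i) => [j ->|->] /=.
  rewrite ffunE; case: (unliftP ord_max j) => [j' ->|->] /=.
    have -> : lift ord0 (lift ord_max j') = lift ord_max (lift ord0 j').
      by apply: val_inj; rewrite /= /bump; have := ltn_ord j'; lia.
    by rewrite liftK /= ffunE liftK.
  have -> : lift ord0 (ord_max : 'I_n.+1) = ord_max by apply: val_inj.
  by rewrite unlift_none.
case: (unliftP ord_max (ord0 : 'I_n.+2)) => [j jE|/(congr1 val)//] /=.
suff -> : j = ord0 by rewrite ffunE unlift_none.
by apply: val_inj; move/(congr1 val): jE; rewrite /= /bump; have := ltn_ord j; lia.
Qed.

Lemma refinement_cons n l (w : {ffun 'I_n -> 'I_k}) :
  refinement T xi (ffun_cons l w) = xi l `&` T @^-1` refinement T xi w.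
Proof.
apply/seteqP; split => x.
  move=> H; split.
    by have := H ord0 I; rewrite /= ffunE unlift_none.
  by move=> j _; have := H (lift ord0 j) I; rewrite /preimage /= ffunE liftK /= -iterSr.
move=> [xl H] i _; rewrite /preimage/= ffunE.
case: (unliftP ord0 i) => [j ->|->]//=.
by have := H j I; rewrite /preimage/= -iterSr.
Qed.

Lemma refinement_rcons n (w : {ffun 'I_n -> 'I_k}) l :
  refinement T xi (ffun_rcons w l) =
  refinement T xi w `&` iter n T @^-1` xi l.
Proof.
apply/seteqP; split => x.
  move=> H; split.
    move=> j _; have := H (lift ord_max j) I.
    by rewrite /preimage ffunE liftK /= /bump leqNgt ltn_ord.
  by have := H ord_max I; rewrite /= ffunE unlift_none.
move=> [H xl] i _; rewrite /preimage/= ffunE.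
case: (unliftP ord_max i) => [j ->|->]//=.
by have := H j I; rewrite /preimage/= /bump leqNgt ltn_ord.
Qed.

Lemma measurable_iter (f : Omega -> Omega) n :
  measurable_fun setT f -> measurable_fun setT (iter n f).
Proof.
move=> mf; elim: n => [|n IH]; first exact: measurable_id.
by rewrite iterfS; exact: measurableT_comp.
Qed.

Lemma measurable_refinement n (w : {ffun 'I_n -> 'I_k}) :
  measurable (refinement T xi w).
Proof.
apply: fin_bigcap_measurable => // j _.
rewrite -[X in measurable X]setTI; apply: measurable_iter => //.
by case: xi_part.
Qed.

Lemma sum_partition (I : finType) (F : I -> set Omega) A :
  (forall i, measurable (F i)) -> trivIset setT F ->
  \bigcup_i F i = setT -> measurable A ->
  \sum_i fine (mu (F i `&` A)) = fine (mu A).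
Proof.
move=> mF tF cF mA.
have mFA i : measurable (F i `&` A) by exact: measurableI.
rewrite sum_fine; last by move=> i _; exact: fin_num_measure.
congr fine; rewrite [RHS](_ : _ = mu (\bigcup_(i in [set` index_enum I]) (F i `&` A))).
  rewrite measure_fin_bigcup//; last first.
    apply/trivIsetP => i j _ _ ij; rewrite setIACA.
    by move/trivIsetP: tF => ->//; rewrite set0I.
  by rewrite -fsbig_seq// index_enum_uniq.
congr (mu _); apply/seteqP; split => [x Ax|x [i _ []//]].
have : setT x by []; rewrite -cF => -[i _ Fix].
by exists i => //=; rewrite mem_index_enum.
Qed.

Definition word_prob n (w : {ffun 'I_n -> 'I_k}) : R :=
  fine (mu (refinement T xi w)).

Lemma word_prob_ge0 n (w : {ffun 'I_n -> 'I_k}) : 0 <= word_prob w.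
Proof. by rewrite /word_prob fine_ge0. Qed.

Lemma sum_word_prob_cons n (w : {ffun 'I_n -> 'I_k}) :
  \sum_l word_prob (ffun_cons l w) = word_prob w.
Proof.
case: xi_part => mxi txi cxi; have mw := measurable_refinement w.
rewrite /word_prob -[in RHS](muT mw).
under eq_bigr do rewrite refinement_cons.
apply: sum_partition => //.
by rewrite -[X in measurable X]setTI; exact: mT.
Qed.

Lemma sum_word_prob_rcons n (w : {ffun 'I_n -> 'I_k}) :
  \sum_l word_prob (ffun_rcons w l) = word_prob w.
Proof.
case: xi_part => mxi txi cxi; have mw := measurable_refinement w.
rewrite /word_prob; under eq_bigr do rewrite refinement_rcons setIC.
apply: sum_partition => //.
- move=> i; rewrite -[X in measurable X]setTI.
  by apply: measurable_iter.
- by apply/trivIsetP => i j _ _ ij; rewrite -preimage_setI;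
    move/trivIsetP: txi => ->//; rewrite preimage_set0.
- by rewrite -preimage_bigcup cxi preimage_setT.
Qed.

Let H n : R := partition_entropy mu (refinement T xi (n := n)).

Lemma partition_entropyE n : H n = entropy (@word_prob n).
Proof. by []. Qed.

Lemma entropy_consE n : H n.+1 =
  entropy (fun lw : 'I_k * {ffun 'I_n -> 'I_k} => word_prob (ffun_cons lw.1 lw.2)).
Proof.
by rewrite partition_entropyE /entropy (reindex _ (onW_bij _ (@ffun_cons_bij n))).
Qed.

Lemma entropy_ext (J : finType) (p q : J -> R) : p =1 q -> entropy p = entropy q.
Proof. by move=> pq; rewrite /entropy; congr (- _); apply: eq_bigr => j _; rewrite pq. Qed.

(** By invariance, the conditional entropy of the letter at time [0] given the letters at the times
    [1] to [n]. *)
Definition entropy_gain n : R := H n.+1 - H n.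

Lemma entropy_gainE n : entropy_gain n =
  entropy (fun lw : 'I_k * {ffun 'I_n -> 'I_k} => word_prob (ffun_cons lw.1 lw.2))
  - entropy (fun w : {ffun 'I_n -> 'I_k} => \sum_l word_prob (ffun_cons l w)).
Proof.
rewrite /entropy_gain entropy_consE; congr (_ - _).
by apply: entropy_ext => w; rewrite sum_word_prob_cons.
Qed.

Lemma entropy_gain_ge0 n : 0 <= entropy_gain n.
Proof.
rewrite entropy_gainE; apply: entropy_marginal_ge0 => lw; exact: word_prob_ge0.
Qed.

(** This is [entropy_submodular] with [l] the letter at time [0], [w] the next [n] letters and [l']
    the last one: a longer future conditions more. *)
Lemma entropy_gain_nonincr n : entropy_gain n.+1 <= entropy_gain n.
Proof.
pose p (x : 'I_k * ({ffun 'I_n -> 'I_k} * 'I_k)) :=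
  word_prob (ffun_cons x.1 (ffun_rcons x.2.1 x.2.2)).
have := @entropy_submodular R 'I_k _ _ p (fun _ => word_prob_ge0 _).
rewrite /p/= => h.
rewrite entropy_gainE [entropy_gain n]entropy_gainE.
have -> : entropy (fun w : {ffun 'I_n -> 'I_k} => \sum_l word_prob (ffun_cons l w)) =
    entropy (fun w : {ffun 'I_n -> 'I_k} =>
      \sum_l \sum_l' word_prob (ffun_cons l (ffun_rcons w l'))).
  apply: entropy_ext => w; apply: eq_bigr => l _.
  by under [RHS]eq_bigr do rewrite ffun_cons_rcons; rewrite sum_word_prob_rcons.
have -> : entropy (fun lw : 'I_k * {ffun 'I_n -> 'I_k} =>
      word_prob (ffun_cons lw.1 lw.2)) =
    entropy (fun lw : 'I_k * {ffun 'I_n -> 'I_k} =>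
      \sum_l' word_prob (ffun_cons lw.1 (ffun_rcons lw.2 l'))).
  apply: entropy_ext => -[l w] /=.
  by under [RHS]eq_bigr do rewrite ffun_cons_rcons; rewrite sum_word_prob_rcons.
apply: le_trans h; rewrite le_eqVlt; apply/orP; left; apply/eqP; congr (_ - _).
  rewrite /entropy; congr (- _); rewrite !sum_prod; apply: eq_bigr => l _.
  by rewrite (reindex _ (onW_bij _ (@ffun_rcons_bij n))).
by rewrite /entropy; congr (- _); rewrite (reindex _ (onW_bij _ (@ffun_rcons_bij n))).
Qed.

Lemma partition_entropy0 : H 0 = 0.
Proof.
rewrite partition_entropyE /entropy big1 ?oppr0// => w _.
suff -> : word_prob w = 1 by rewrite ln1 mulr0.
rewrite /word_prob (_ : refinement T xi w = setT) ?probability_setT//.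
by apply/seteqP; split => // x _ [].
Qed.

(** The gains are nonincreasing and nonnegative, hence converge, and [H n / n] is their Cesaro mean;
    so the [limn] in [ks_entropy] is a true limit. *)
Lemma ks_entropy_ge (c : R) : (forall n, c <= entropy_gain n) ->
  c <= ks_entropy T mu xi.
Proof.
move=> cgain.
have nincr : {homo entropy_gain : n m / (n <= m)%N >-> m <= n}.
  by apply/nonincreasing_seqP => n; exact: entropy_gain_nonincr.
have gcvg : cvgn entropy_gain.
  apply: nonincreasing_is_cvgn => //.
  by exists 0 => _ [n _ <-]; exact: entropy_gain_ge0.
have Hseries n : H n = series entropy_gain n.
  rewrite seriesEnat /= telescope_sumr// partition_entropy0 subr0//.
have cH : (fun n => H n / n%:R) @ \oo --> limn entropy_gain.
  rewrite -(cvg_shiftS (fun n => H n / n%:R)).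
  by under eq_fun do rewrite Hseries mulrC; exact: (cesaro gcvg).
rewrite /ks_entropy (cvg_lim _ cH)//.
by apply: limr_ge => //; exact: nearW.
Qed.

(** [F n w] is a mass common to all letters of [S] before the itinerary [w]. Thus a part of mass at
    least [c] of the joint law has its letter uniform on [S] and independent of the future. *)
Lemma ks_entropy_minorized (S : {set 'I_k}) (c : R)
    (F : forall n, {ffun 'I_n -> 'I_k} -> R) :
  (0 < #|S|)%N -> (forall n (w : {ffun 'I_n -> 'I_k}), 0 <= F n w) ->
  (forall n l (w : {ffun 'I_n -> 'I_k}), l \in S ->
    (F n w)%:E <= mu (xi l `&` T @^-1` refinement T xi w))%E ->
  (forall n, c <= #|S|%:R * \sum_w F n w) ->
  c * ln #|S|%:R <= ks_entropy T mu xi.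
Proof.
move=> S0 F0 Fle cF; apply: ks_entropy_ge => n.
have lnk : 0 <= ln #|S|%:R :> R by rewrite ln_ge0// ler1n.
apply: le_trans (ler_wpM2r lnk (cF n)) _.
rewrite entropy_gainE; apply: entropy_marginal_ge => // [lw|l w lS].
  exact: word_prob_ge0.
rewrite /word_prob/= refinement_cons -[leLHS]/(fine (F n w)%:E).
apply: fine_le; rewrite ?Fle//; apply: fin_num_measure.
apply: measurableI; first by case: xi_part.
rewrite -[X in measurable X]setTI; apply: mT => //.
exact: measurable_refinement.
Qed.

End itinerary_entropy.

(** * Reduction of the mean dimension to alphabets of size [2 ^ m] *)

Section mean_dimension.
Context {d : measure_display} {Omega : measurableType d} {R : realType}.

(** For [0 < m] and [2 ^ m <= k < 2 ^ m.+1], [ln k] is at most [m.+1 * ln 2], hence at most twice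
    [ln (2 ^ m)]: rounding [k] down to a power of two costs a factor 2. *)
Lemma mdim_KS_gt0 (T : Omega -> Omega) (mu : probability Omega R) (c : R) :
  0 < c ->
  (forall m k, (0 < m)%N -> (2 ^ m <= k)%N -> exists2 xi : 'I_k -> set Omega,
    partitions xi & c * ln (2 ^ m)%:R <= ks_entropy T mu xi) ->
  (0 < mdim_KS T mu)%E.
Proof.
move=> c0 h; rewrite /mdim_KS limn_einf_lim.
set u := (X in einfs X).
have u_ge k : (2 <= k)%N -> ((c / 2)%:E <= u k)%E.
  move=> k2; pose m := trunc_log 2 k.
  have m0 : (0 < m)%N by rewrite trunc_log_gt0.
  have mk : (2 ^ m <= k)%N by apply: trunc_logP => //; lia.
  have km : (k < 2 ^ m.+1)%N by exact: trunc_log_ltn.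
  have [xi xip hxi] := h m k m0 mk.
  apply: (@le_trans _ _ (ks_entropy T mu xi / ln k%:R)%:E); last first.
    by apply: ereal_sup_ubound; exists xi.
  have ln2 : 0 < ln 2 :> R by rewrite ln_gt0// ltr1n.
  have lnk : 0 < ln k%:R :> R by rewrite ln_gt0// ltr1n.
  have lnkm : ln k%:R <= m.+1%:R * ln 2 :> R.
    rewrite mulr_natl -(lnXn m.+1 (ltr0Sn R 1)) -natrX ler_ln ?posrE ?ltr0n ?expn_gt0//.
      by rewrite ler_nat ltnW.
    by lia.
  rewrite lee_fin ler_pdivlMr//; apply: le_trans hxi.
  rewrite natrX lnXn ?ltr0n// -mulrA ler_pM2l// -[ln 2 *+ m]mulr_natl.
  suff : ln k%:R <= 2 * (m%:R * ln 2) :> R by lra.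
  by apply: (le_trans lnkm); rewrite mulrA -natrM ler_pM2r// ler_nat; lia.
have : (einfs u 2%N <= limn (einfs u))%E.
  rewrite (cvg_lim _ (@cvg_einfs_sup _ u))//.
  by apply: ereal_sup_ubound; exists 2%N.
apply: lt_le_trans; apply: (@lt_le_trans _ _ (c / 2)%:E).
  by rewrite lte_fin divr_gt0.
by apply: le_ereal_inf_tmp => _ [k /= k2 <-]; exact: u_ge.
Qed.

End mean_dimension.

(** * The zipper map: fixed point and functional equations *)

Section clamp.
Context {R : realType}.
Implicit Types x : R.

(** The projection of the line onto [0,1], written with absolute values so that its continuity is
    immediate. *)
Definition clamp01 x : R := (1 + `|x| - `|x - 1|) / 2.

Lemma clamp01_id x : 0 <= x <= 1 -> clamp01 x = x.
Proof.
move=> /andP[x0 x1]; rewrite /clamp01 ger0_norm// ler0_norm ?subr_le0//.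
by field.
Qed.

Lemma clamp01_le0 x : x <= 0 -> clamp01 x = 0.
Proof.
move=> x0; rewrite /clamp01 ler0_norm// ler0_norm; last lra.
by field.
Qed.

Lemma clamp01_ge1 x : 1 <= x -> clamp01 x = 1.
Proof.
move=> x1; rewrite /clamp01 ger0_norm; last lra.
by rewrite ger0_norm; [field | lra].
Qed.

Lemma clamp01_bounded x : 0 <= clamp01 x <= 1.
Proof.
have [/clamp01_le0 ->|x0] := leP x 0; first by rewrite lexx ler01.
have [/clamp01_ge1 ->|x1] := leP 1 x; first by rewrite ler01 lexx.
by rewrite clamp01_id !ltW.
Qed.

Lemma continuous_clamp01 : continuous clamp01.
Proof.
move=> x; rewrite /clamp01; apply: cvgMl; apply: cvgB.
  by apply: cvgD; [exact: cvg_cst | apply: cvg_norm; exact: cvg_id].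
by apply: cvg_norm; apply: cvgB; [exact: cvg_id | exact: cvg_cst].
Qed.

Lemma continuous_to_I01 (X : topologicalType) (f : X -> I01 R) :
  continuous (fun z => val (f z)) -> continuous f.
Proof. exact: continuous_comp_initial. Qed.

Lemma continuous_val_I01 : continuous (fun z : I01 R => val z).
Proof. exact: initial_continuous. Qed.

Lemma continuous_toI01_clamp : continuous (fun x : R => toI01 (clamp01 x)).
Proof.
apply: continuous_to_I01; rewrite (_ : (fun z => _) = clamp01).
  exact: continuous_clamp01.
by apply/funext => z; rewrite val_toI01// clamp01_bounded.
Qed.

Lemma toI01_val (z : I01 R) : toI01 (val z) = z.
Proof. by apply: val_inj; rewrite val_toI01// val_I01. Qed.

Lemma toI01_0 : toI01 0 = I01_0 :> I01 R.
Proof. by apply: val_inj; rewrite val_toI01// lexx ler01. Qed.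

Lemma toI01_1 : toI01 1 = I01_1 :> I01 R.
Proof. by apply: val_inj; rewrite val_toI01// lexx ler01. Qed.

End clamp.

Section zipper_fixed_point.
Context {R : realType}.
Variables x1 y1 x2 y2 : R.
Hypothesis hb : [/\ 0 < x1, x1 < x2, x2 < 1, 0 < y2 & y2 < y1 < 1].

(* A form of the zipper operator which is continuous at a glance: the arguments
   of the inactive branches are clamped to a fixed end point of [f]. *)
Definition zipper_ext (f : R -> R) (x : R) : R :=
  y1 * f (clamp01 (x / x1)) - (y1 - y2) * f (clamp01 ((x - x1) / (x2 - x1))) +
  (1 - y2) * f (clamp01 ((x - x2) / (1 - x2))).

Lemma zipper_ext_left f x : f 0 = 0 -> x <= x1 ->
  zipper_ext f x = y1 * f (clamp01 (x / x1)).
Proof.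
have [b1 b2 b3 b4 /andP[b5 b6]] := hb.
move=> f0 xx; rewrite /zipper_ext (@clamp01_le0 _ ((x - x1) / _)); last first.
  by rewrite pmulr_lle0 ?invr_gt0; lra.
rewrite (@clamp01_le0 _ ((x - x2) / _)); last first.
  by rewrite pmulr_lle0 ?invr_gt0; lra.
by rewrite f0 !mulr0 subr0 addr0.
Qed.

Lemma zipper_ext_mid f x : f 0 = 0 -> f 1 = 1 -> x1 <= x <= x2 ->
  zipper_ext f x = y1 - (y1 - y2) * f (clamp01 ((x - x1) / (x2 - x1))).
Proof.
have [b1 b2 b3 b4 /andP[b5 b6]] := hb.
move=> f0 f1 /andP[xx1 xx2]; rewrite /zipper_ext clamp01_ge1; last first.
  by rewrite ler_pdivlMr// mul1r.
rewrite (@clamp01_le0 _ ((x - x2) / _)); last first.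
  by rewrite pmulr_lle0 ?invr_gt0; lra.
by rewrite f0 f1 mulr0 mulr1 addr0.
Qed.

Lemma zipper_ext_right f x : f 1 = 1 -> x2 <= x ->
  zipper_ext f x = y2 + (1 - y2) * f (clamp01 ((x - x2) / (1 - x2))).
Proof.
have [b1 b2 b3 b4 /andP[b5 b6]] := hb.
move=> f1 xx2; rewrite /zipper_ext clamp01_ge1; last first.
  by rewrite ler_pdivlMr// mul1r; lra.
rewrite (@clamp01_ge1 _ ((x - x1) / _)); last first.
  by rewrite ler_pdivlMr; lra.
by rewrite f1; lra.
Qed.

Let approx n : R -> R := iter n zipper_ext clamp01.

Lemma zipper_ext_approx n :
  [/\ continuous (approx n), approx n 0 = 0 & approx n 1 = 1].
Proof.
have [b1 b2 b3 b4 /andP[b5 b6]] := hb.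
elim: n => [|n [cn n0 n1]]; rewrite /approx/= -?/(approx n).
  split; first exact: continuous_clamp01.
    by rewrite clamp01_le0.
  by rewrite clamp01_ge1.
split.
- move=> x; rewrite /zipper_ext.
  have c (a b : R) : (fun z => approx n (clamp01 ((z - a) / b))) @ x -->
      approx n (clamp01 ((x - a) / b)).
    apply: (@continuous_comp _ _ _ (fun z => clamp01 ((z - a) / b)) (approx n));
      last exact: cn.
    apply: (@continuous_comp _ _ _ (fun z => (z - a) / b) clamp01);
      last exact: continuous_clamp01.
    by apply: cvgMl; apply: cvgB; [exact: cvg_id | exact: cvg_cst].
  apply: cvgD; last by apply: cvgMr; exact: c.
  apply: cvgB; last by apply: cvgMr; exact: c.
  by apply: cvgMr; have := c 0 x1; under eq_fun do rewrite subr0; rewrite subr0.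
- rewrite zipper_ext_left ?(ltW b1)// mul0r clamp01_le0//.
  by rewrite n0 mulr0.
- rewrite zipper_ext_right ?(ltW b3)// divff ?clamp01_ge1//; last by rewrite subr_eq0 gt_eqF.
  by rewrite n1; lra.
Qed.

(** The contraction ratio of [zipper_ext]; the slope [y1 - y2] of the middle branch is smaller than
    [y1]. *)
Let q : R := Num.max y1 (1 - y2).

Let q0 : 0 < q.
Proof.
have [b1 b2 b3 b4 /andP[b5 b6]] := hb.
by rewrite lt_max (lt_trans b4 b5).
Qed.
Let q1 : q < 1.
Proof.
have [b1 b2 b3 b4 /andP[b5 b6]] := hb.
by rewrite gt_max b6/= ltrBlDr ltrDl b4.
Qed.

Lemma zipper_ext_contract (f g : R -> R) (e : R) :
  f 0 = 0 -> f 1 = 1 -> g 0 = 0 -> g 1 = 1 -> 0 <= e ->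
  (forall x, `|f (clamp01 x) - g (clamp01 x)| <= e) ->
  forall x, `|zipper_ext f x - zipper_ext g x| <= q * e.
Proof.
have [b1 b2 b3 b4 /andP[b5 b6]] := hb.
move=> f0 f1 g0 g1 e0 fg x.
have q_ge (a b c : R) : `|a| <= q -> `|b - c| <= e -> `|a * b - a * c| <= q * e.
  by move=> aq bc; rewrite -mulrBr normrM ler_pM.
have qy : y1 <= q /\ 1 - y2 <= q by rewrite /q !le_max !lexx orbT.
have [xx1|x1x] := leP x x1.
  by rewrite !zipper_ext_left//; apply: q_ge => //; rewrite ger0_norm; lra.
have [xx2|x2x] := leP x x2.
  rewrite !zipper_ext_mid// ?(ltW x1x)//.
  rewrite [X in `|X|](_ : _ = (y2 - y1) * f (clamp01 ((x - x1) / (x2 - x1))) -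
    (y2 - y1) * g (clamp01 ((x - x1) / (x2 - x1)))); last by ring.
  by apply: q_ge => //; rewrite ler0_norm; lra.
rewrite !zipper_ext_right ?(ltW x2x)//.
rewrite [X in `|X|](_ : _ = (1 - y2) * f (clamp01 ((x - x2) / (1 - x2))) -
  (1 - y2) * g (clamp01 ((x - x2) / (1 - x2)))); last by ring.
by apply: q_ge => //; rewrite ger0_norm; lra.
Qed.

Lemma approx_dist n x : `|approx n.+1 x - approx n x| <= q ^+ n * 2.
Proof.
have [b1 b2 b3 b4 /andP[b5 b6]] := hb.
elim: n x => [|n IH] x; last first.
  have [_ n0 n1] := zipper_ext_approx n; have [_ m0 m1] := zipper_ext_approx n.+1.
  rewrite exprS -mulrA; apply: zipper_ext_contract => //; first by rewrite mulr_ge0// exprn_ge0// ltW.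
  by move=> z; exact: IH.
(* Four terms in [0,1] with alternating signs, whence the constant 2. *)
rewrite expr0 mul1r /approx/= /zipper_ext.
have c (z : R) := @clamp01_bounded R z.
have cc (u a : R) : 0 <= u <= 1 -> 0 <= a <= 1 -> 0 <= u * a <= 1.
  by move=> /andP[? ?] /andP[? ?]; rewrite mulr_ge0//= mulr_ile1.
have u1 : 0 <= y1 <= 1 by apply/andP; split; lra.
have u2 : 0 <= y1 - y2 <= 1 by apply/andP; split; lra.
have u3 : 0 <= 1 - y2 <= 1 by apply/andP; split; lra.
have /andP[] := cc _ _ u1 (c (clamp01 (x / x1))).
have /andP[] := cc _ _ u2 (c (clamp01 ((x - x1) / (x2 - x1)))).
have /andP[] := cc _ _ u3 (c (clamp01 ((x - x2) / (1 - x2)))).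
by have /andP[] := c x; rewrite ler_norml; lra.
Qed.

Lemma approx_dist_tail n m x :
  `|approx (n + m) x - approx n x| <= q ^+ n * (2 / (1 - q)).
Proof.
have [b1 b2 b3 b4 /andP[b5 b6]] := hb.
have q1' : 0 < 1 - q by rewrite subr_gt0.
suff : `|approx (n + m) x - approx n x| <= q ^+ n * (2 / (1 - q)) * (1 - q ^+ m).
  move=> /le_trans; apply; apply: ler_piMr.
    by rewrite mulr_ge0 ?exprn_ge0 ?divr_ge0// ltW.
  by rewrite gerBl exprn_ge0// ltW.
elim: m => [|m IH]; first by rewrite addn0 subrr normr0 expr0 subrr mulr0.
rewrite addnS (_ : _ - _ = (approx (n + m).+1 x - approx (n + m) x) +
  (approx (n + m) x - approx n x)); last by ring.
apply: le_trans (ler_normD _ _) _; apply: le_trans (lerD (approx_dist _ _) IH) _.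
rewrite exprD exprS le_eqVlt; apply/orP; left; apply/eqP; field.
by rewrite gt_eqF.
Qed.

Lemma approx_cvg x : cvgn (approx ^~ x).
Proof.
have [b1 b2 b3 b4 /andP[b5 b6]] := hb.
have -> : approx ^~ x =
    (fun n => approx 0 x + series (fun n => approx n.+1 x - approx n x) n).
  by apply/funext => n; rewrite seriesEnat /= telescope_sumr// addrC subrK.
apply: is_cvgD; first exact: is_cvg_cst.
apply: normed_cvg; apply: (@series_le_cvg _ _ (geometric 2 q)).
- by move=> n; exact: normr_ge0.
- by move=> n; rewrite /geometric/= mulr_ge0// exprn_ge0// ltW.
- by move=> n; rewrite /geometric/= mulrC; exact: approx_dist.
- by apply: is_cvg_geometric_series; rewrite ger0_norm// ltW.
Qed.

Let fixpt x : R := limn (approx ^~ x).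

Lemma fixpt_dist n x : `|approx n x - fixpt x| <= q ^+ n * (2 / (1 - q)).
Proof.
have [b1 b2 b3 b4 /andP[b5 b6]] := hb.
have h : (fun m => `|approx n x - approx (n + m) x|) @ \oo --> `|approx n x - fixpt x|.
  apply: cvg_norm; apply: cvgB; first exact: cvg_cst.
  exact: (cvg_comp _ _ (cvg_addnl n) (@approx_cvg x)).
rewrite -(cvg_lim _ h)//; apply: limr_le; first by apply/cvg_ex; eexists; exact: h.
by apply: nearW => m; rewrite distrC; exact: approx_dist_tail.
Qed.

Lemma continuous_fixpt : continuous fixpt.
Proof.
have [b1 b2 b3 b4 /andP[b5 b6]] := hb.
move=> x; apply/cvgrPdist_lt => e e0.
have q1' : 0 < 1 - q by rewrite subr_gt0.
have : (fun n => q ^+ n * (2 / (1 - q))) @ \oo --> 0 * (2 / (1 - q)).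
  by apply: cvgMl; apply: cvg_expr; rewrite ger0_norm// ltW.
rewrite mul0r => /cvgrPdist_lt/(_ (e / 3)) []; first by rewrite divr_gt0.
move=> n _ /(_ n (leqnn _)); rewrite /= sub0r normrN ger0_norm; last first.
  by rewrite mulr_ge0 ?exprn_ge0 ?divr_ge0// ltW.
move=> qn; have [/(_ x)/cvgrPdist_lt/(_ (e / 3)) cn _ _] := zipper_ext_approx n.
have : \forall z \near x, `|approx n x - approx n z| < e / 3.
  by apply: cn; rewrite divr_gt0.
apply: filterS => z hz.
have h1 := fixpt_dist n x; have h2 := fixpt_dist n z.
rewrite (_ : _ - _ = (fixpt x - approx n x) + (approx n x - approx n z) +
  (approx n z - fixpt z)); last by ring.
apply: le_lt_trans (ler_normD _ _) _; rewrite distrC in h1.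
have := ler_normD (fixpt x - approx n x) (approx n x - approx n z); lra.
Qed.

Lemma fixpt_end : fixpt 0 = 0 /\ fixpt 1 = 1.
Proof.
have [b1 b2 b3 b4 /andP[b5 b6]] := hb.
split; apply: cvg_lim => //.
  rewrite (_ : approx ^~ 0 = cst 0); first exact: cvg_cst.
  by apply/funext => n; have [] := zipper_ext_approx n.
rewrite (_ : approx ^~ 1 = cst 1); first exact: cvg_cst.
by apply/funext => n; have [] := zipper_ext_approx n.
Qed.

Lemma zipper_ext_bounded f x : f 0 = 0 -> f 1 = 1 ->
  (forall z, 0 <= f (clamp01 z) <= 1) -> 0 <= zipper_ext f x <= 1.
Proof.
have [b1 b2 b3 b4 /andP[b5 b6]] := hb.
move=> f0 f1 fb.
have cc (u a : R) : 0 <= u <= 1 -> 0 <= a <= 1 -> 0 <= u * a <= u.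
  by move=> /andP[? ?] /andP[? ?]; rewrite mulr_ge0//= ler_piMr.
have [xx1|x1x] := leP x x1.
  rewrite zipper_ext_left//.
  have u1 : 0 <= y1 <= 1 by apply/andP; split; lra.
  by have /andP[? ?] := cc _ _ u1 (fb (x / x1)); apply/andP; split; lra.
have [xx2|x2x] := leP x x2.
  rewrite zipper_ext_mid// ?(ltW x1x)//.
  have u2 : 0 <= y1 - y2 <= 1 by apply/andP; split; lra.
  by have /andP[? ?] := cc _ _ u2 (fb ((x - x1) / (x2 - x1)));
    apply/andP; split; lra.
rewrite zipper_ext_right ?(ltW x2x)//.
have u3 : 0 <= 1 - y2 <= 1 by apply/andP; split; lra.
by have /andP[? ?] := cc _ _ u3 (fb ((x - x2) / (1 - x2)));
  apply/andP; split; lra.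
Qed.

Lemma fixpt_bounded x : 0 <= x <= 1 -> 0 <= fixpt x <= 1.
Proof.
move=> x01.
have ap n z : 0 <= approx n (clamp01 z) <= 1.
  elim: n z => [|n IH] z; first exact: clamp01_bounded.
  by have [_ n0 n1] := zipper_ext_approx n; exact: zipper_ext_bounded.
rewrite -(clamp01_id x01); apply/andP; split.
  by apply: limr_ge; [exact: approx_cvg | apply: nearW => n; case/andP: (ap n x)].
by apply: limr_le; [exact: approx_cvg | apply: nearW => n; case/andP: (ap n x)].
Qed.

Lemma zipper_ext_fixpt x : zipper_ext fixpt x = fixpt x.
Proof.
have [b1 b2 b3 b4 /andP[b5 b6]] := hb.
suff h : (fun n => approx n.+1 x) @ \oo --> zipper_ext fixpt x.
  have h2 : (fun n => approx n.+1 x) @ \oo --> fixpt x.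
    exact: (cvg_comp _ _ (cvg_addnl 1) (@approx_cvg x)).
  exact: (cvg_unique _ h h2).
have c z : (fun n => approx n z) @ \oo --> fixpt z by exact: approx_cvg.
rewrite /approx/= /zipper_ext; apply: cvgD; last by apply: cvgMr; exact: c.
by apply: cvgB; apply: cvgMr; exact: c.
Qed.

Lemma zipper_fixed_point_exists : exists t : R -> R,
  [/\ continuous t, t 0 = 0, t 1 = 1,
     forall x, 0 <= x <= 1 -> 0 <= t x <= 1 & forall x, zipper_ext t x = t x].
Proof.
have [f0 f1] := fixpt_end.
exists fixpt; split => //; [exact: continuous_fixpt|exact: fixpt_bounded|].
exact: zipper_ext_fixpt.
Qed.

End zipper_fixed_point.

Section zipper_map.
Context {R : realType}.
Variables x1 y1 x2 y2 : R.
Let p := ((x1, y1), (x2, y2)).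
Hypothesis hp : zipper_param p.

Lemma zipper_param_ineq :
  [/\ 0 < x1, x1 < x2, x2 < 1, 0 < y2 & y2 < y1 < 1].
Proof.
by move: hp => [/andP[? ?] /andP[? ->] /andP[? ?] /andP[? ?] [? ->]].
Qed.

(** The default of [xget] is ruled out by exhibiting a fixed point: the restriction to [0,1] of the
    limit of the iterates of [zipper_ext]. *)
Lemma zipper_mapP : C00 (zipper_map p) /\ zipper_op p (zipper_map p) = zipper_map p.
Proof.
have hb := zipper_param_ineq; have [b1 b2 b3 b4 /andP[b5 b6]] := hb.
have [t [ct t0 t1 tb te]] := zipper_fixed_point_exists hb.
apply: (@xgetPex _ _ [set f | C00 f /\ zipper_op p f = f]).
have valt (s : R) : 0 <= s <= 1 ->
    val (toI01 (t (val (toI01 s)))) = t s.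
  by move=> s01; rewrite !val_toI01// tb.
exists (fun x => toI01 (t (val x))); split.
  split.
  - apply: continuous_to_I01; rewrite (_ : (fun z => _) = t \o val).
      by move=> z; apply: continuous_comp; [exact: continuous_val_I01|exact: ct].
    by apply/funext => z /=; rewrite val_toI01// tb// val_I01.
  - by rewrite [val _]/(0 : R) t0 toI01_0.
  - by rewrite [val _]/(1 : R) t1 toI01_1.
suff key s : 0 <= s <= 1 ->
    zipper_value p (fun x => toI01 (t (val x))) s = zipper_ext x1 y1 x2 y2 t s.
  apply/funext => x; apply: val_inj.
  have [-> _] := zipper_opE (fun x => toI01 (t (val x))) x hp.
  by rewrite key ?val_I01// te val_toI01// tb// val_I01.
move=> /andP[s0 s1]; rewrite /zipper_value/=; case: ifPn => [sx1|].
  rewrite zipper_ext_left//.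
  have s01 : 0 <= s / x1 <= 1.
    by apply/andP; split; [apply: divr_ge0; lra | rewrite ler_pdivrMr; lra].
  by rewrite valt// clamp01_id.
rewrite -ltNge => x1s; case: ifPn => [sx2|].
  rewrite zipper_ext_mid ?(ltW x1s)//.
  have s01 : 0 <= (s - x1) / (x2 - x1) <= 1.
    by apply/andP; split; [apply: divr_ge0; lra | rewrite ler_pdivrMr; lra].
  by rewrite valt// clamp01_id.
rewrite -ltNge => x2s; rewrite zipper_ext_right ?(ltW x2s)//.
have s01 : 0 <= (s - x2) / (1 - x2) <= 1.
  by apply/andP; split; [apply: divr_ge0; lra | rewrite ler_pdivrMr; lra].
by rewrite valt// clamp01_id.
Qed.

Lemma continuous_zipper_map : continuous (zipper_map p).
Proof. by case: zipper_mapP => -[]. Qed.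

Definition zipper_fun (x : R) : R := val (zipper_map p (toI01 (clamp01 x))).

Lemma zipper_funE (x : I01 R) : zipper_fun (val x) = val (zipper_map p x).
Proof. by rewrite /zipper_fun clamp01_id ?val_I01// toI01_val. Qed.

Lemma continuous_zipper_fun : continuous zipper_fun.
Proof.
move=> x; apply: (@continuous_comp _ _ _ (zipper_map p \o (toI01 \o clamp01)) val);
  last exact: continuous_val_I01.
apply: continuous_comp; last exact: continuous_zipper_map.
exact: continuous_toI01_clamp.
Qed.

Lemma zipper_fun_bounded x : 0 <= zipper_fun x <= 1.
Proof. exact: val_I01. Qed.

Lemma zipper_fun_value x : 0 <= x <= 1 ->
  zipper_fun x = zipper_value p (zipper_map p) x.
Proof.
move=> x01; rewrite /zipper_fun clamp01_id// -[in LHS](zipper_mapP.2).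
by have [-> _] := zipper_opE (zipper_map p) (toI01 x) hp; rewrite val_toI01.
Qed.

Lemma zipper_fun0 : zipper_fun 0 = 0.
Proof.
rewrite /zipper_fun clamp01_le0// toI01_0.
by have [[_ -> _] _] := zipper_mapP.
Qed.

Lemma zipper_fun1 : zipper_fun 1 = 1.
Proof.
rewrite /zipper_fun clamp01_ge1// toI01_1.
by have [[_ _ ->] _] := zipper_mapP.
Qed.

Lemma zipper_fun_left x : 0 <= x <= 1 -> zipper_fun (x1 * x) = y1 * zipper_fun x.
Proof.
have [b1 b2 b3 b4 /andP[b5 b6]] := zipper_param_ineq.
move=> /andP[x0 xl1]; rewrite zipper_fun_value; last first.
  by rewrite mulr_ge0 ?(ltW b1)//= mulr_ile1//; lra.
have -> : zipper_value p (zipper_map p) (x1 * x) =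
    y1 * val (zipper_map p (toI01 x)).
  rewrite /zipper_value/= ler_piMr ?(ltW b1)//.
  by rewrite (_ : x1 * x / x1 = x)//; field; rewrite gt_eqF.
by rewrite /zipper_fun clamp01_id// x0.
Qed.

Lemma zipper_fun_mid x : 0 <= x <= 1 ->
  zipper_fun (x1 + (x2 - x1) * x) = y1 - (y1 - y2) * zipper_fun x.
Proof.
have [b1 b2 b3 b4 /andP[b5 b6]] := zipper_param_ineq.
(* At [x = 0] the point is [x1], where [zipper_value] takes the left branch; the two formulas agree
   there. *)
move=> /andP[]; rewrite le_eqVlt => /predU1P[<- _|x0 xl1].
  rewrite mulr0 addr0 zipper_fun0 mulr0 subr0 -[in LHS](mulr1 x1).
  by rewrite zipper_fun_left ?ler01 ?lexx// zipper_fun1 mulr1.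
have d0 : 0 < x2 - x1 by lra.
have dx0 := mulr_gt0 d0 x0.
have dx1 : (x2 - x1) * x <= x2 - x1 by rewrite ler_piMr// ltW.
rewrite zipper_fun_value; last by apply/andP; split; lra.
rewrite /zipper_value/= leNgt ltrDl dx0/=.
have -> : x1 + (x2 - x1) * x <= x2 by lra.
have -> : (x1 + (x2 - x1) * x - x1) / (x2 - x1) = x.
  by field; rewrite gt_eqF.
by rewrite /zipper_fun clamp01_id// (ltW x0).
Qed.

Lemma zipper_fun_right x : 0 <= x <= 1 ->
  zipper_fun (x2 + (1 - x2) * x) = y2 + (1 - y2) * zipper_fun x.
Proof.
have [b1 b2 b3 b4 /andP[b5 b6]] := zipper_param_ineq.
move=> /andP[]; rewrite le_eqVlt => /predU1P[<- _|x0 xl1].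
  rewrite mulr0 addr0; have := @zipper_fun_mid 1; rewrite !mulr1 subrKC zipper_fun1 => ->.
    by rewrite zipper_fun0; lra.
  by rewrite ler01 lexx.
have d0 : 0 < 1 - x2 by lra.
have dx0 := mulr_gt0 d0 x0.
have dx1 : (1 - x2) * x <= 1 - x2 by rewrite ler_piMr// ltW.
rewrite zipper_fun_value; last by apply/andP; split; lra.
rewrite /zipper_value/= leNgt (_ : x1 < _) /=; last by lra.
rewrite leNgt ltrDl dx0/=.
have -> : (x2 + (1 - x2) * x - x2) / (1 - x2) = x.
  by field; rewrite gt_eqF.
by rewrite /zipper_fun clamp01_id// (ltW x0).
Qed.

End zipper_map.

(** * Chains of intervals and first passage points *)

Section chains.
Context {R : realType}.
Variable t : R -> R.
Hypothesis ct : continuous t.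
Implicit Types (A B C K : R * R) (us vs : seq (R * R)) (x y : R).

Definition itv_sub A B := (B.1 <= A.1) && (A.2 <= B.2).
Definition itv_in x A := A.1 <= x <= A.2.
Definition rising K := (K.1 < K.2) && (t K.1 < t K.2).
Definition rise K : R * R := (t K.1, t K.2).

Definition first_passage K y : R := inf [set x | itv_in x K /\ y <= t x].

(* Weak left-to-right maxima: the set of strict ones would not be closed. *)
Definition record K x : Prop :=
  itv_in x K /\ forall x', K.1 <= x' <= x -> t x' <= t x.

Lemma near_lt x (e : R) : 0 < e ->
  exists2 d : R, 0 < d & forall z, `|x - z| < d -> `|t x - t z| < e.
Proof.
move=> e0; have /cvgrPdist_lt/(_ e e0)[d /= d0 h] := @ct x.
by exists d.
Qed.

Lemma first_passageP K y : K.1 <= K.2 -> itv_in y (rise K) ->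
  [/\ itv_in (first_passage K y) K, t (first_passage K y) = y &
      forall x, K.1 <= x < first_passage K y -> t x < y].
Proof.
move=> K12 /andP[/= y1 y2].
set S := [set x | itv_in x K /\ y <= t x].
have S2 : S K.2 by split => //; rewrite /itv_in K12 lexx.
have lS : lbound S K.1 by move=> x [/andP[]].
have hS : has_inf S by split; [exists K.2 | exists K.1].
rewrite /first_passage -/S; set x := inf S.
have xlb z : S z -> x <= z by apply: ge_inf; exists K.1.
have Kx : K.1 <= x by apply: lb_le_inf => //; exists K.2.
have xK : x <= K.2 by exact: xlb.
have below z : K.1 <= z < x -> t z < y.
  move=> /andP[Kz zx]; rewrite ltNge; apply/negP => yz.
  have : S z by split => //; rewrite /itv_in Kz (le_trans (ltW zx)).
  by move/xlb; rewrite leNgt zx.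
split => //; first by apply/andP; split.
apply/eqP; rewrite eq_le; apply/andP; split; rewrite leNgt; apply/negP => h.
  have e0 : 0 < t x - y by rewrite subr_gt0.
  have [d d0 hd] := near_lt x e0.
  have Kx' : K.1 < x.
    by rewrite lt_neqAle Kx andbT; apply/eqP => Kxe; move: h y1; rewrite Kxe; lra.
  pose z := Num.max K.1 (x - d / 2).
  have zx : z < x by rewrite gt_max Kx' ltrBlDr ltrDl divr_gt0.
  have Kz : K.1 <= z by rewrite le_max lexx.
  have xz : x - d / 2 <= z by rewrite le_max lexx orbT.
  have tz : t z < y by apply: below; rewrite Kz.
  have : `|x - z| < d by rewrite ger0_norm; lra.
  by move/hd; rewrite ger0_norm; lra.
have e0 : 0 < y - t x by rewrite subr_gt0.
have [d d0 hd] := near_lt x e0.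
have [z Sz zx] := inf_adherent d0 hS.
have xz := xlb _ Sz; case: Sz => _ tz.
have : `|x - z| < d by rewrite ler0_norm; rewrite -/x in zx; lra.
by move/hd; rewrite ler0_norm; lra.
Qed.

(** The sets of points where [y <= t x] shrink as [y] grows, so their infima increase. *)
Lemma first_passage_mono K y y' : K.1 <= K.2 -> t K.1 <= y -> y <= y' ->
  y' <= t K.2 -> first_passage K y <= first_passage K y'.
Proof.
move=> K12 ty yy' yt.
have y'K : itv_in y' (rise K) by rewrite /itv_in /= yt (le_trans ty).
have [h1 h2 _] := first_passageP K12 y'K.
apply: ge_inf; first by exists K.1 => z [/andP[]].
by split => //; rewrite h2.
Qed.

Lemma first_passage_record K y : K.1 <= K.2 -> itv_in y (rise K) ->
  record K (first_passage K y).
Proof.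
move=> K12 yK; have [h1 h2 h3] := first_passageP K12 yK; split => // x' /andP[Kx'].
rewrite le_eqVlt => /predU1P[->//|x'x].
by rewrite h2 ltW// h3// Kx'.
Qed.

(** Coded points are only limits of first passage points. The weak inequalities of [record] survive
    the limit, because a point [x' < x] is eventually to the left of [u n]. *)
Lemma record_closed K (u : R^nat) x : u @ \oo --> x ->
  (forall n, record K (u n)) -> record K x.
Proof.
move=> ux ru.
have xK : itv_in x K.
  apply/andP; split.
    rewrite -(cvg_lim _ ux)//; apply: limr_ge; first by apply/cvg_ex; exists x.
    by apply: nearW => n; case: (ru n) => /andP[].
  rewrite -(cvg_lim _ ux)//; apply: limr_le; first by apply/cvg_ex; exists x.
  by apply: nearW => n; case: (ru n) => /andP[].
split => // x' /andP[Kx']; rewrite le_eqVlt => /predU1P[->//|x'x].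
have tux : (t \o u) @ \oo --> t x by apply: continuous_cvg => //; exact: ct.
rewrite -(cvg_lim _ tux)//; apply: limr_ge; first by apply/cvg_ex; exists (t x).
have : \forall n \near \oo, x' < u n.
  by apply: cvgr_gt ux _ _.
apply: filterS => n x'u; case: (ru n) => _; apply.
by rewrite Kx' ltW.
Qed.

(** The segment [rise K] between the end values may be smaller than the image of [K], but on it
    first passage is a monotone right inverse of [t]; hence points of [B] can be pulled back along
    [us] into [A]. *)
Fixpoint chain A us B : bool :=
  if us is K :: us' then [&& rising K, itv_sub K A & chain (rise K) us' B]
  else itv_sub B A.

Definition pullback us x : R := foldr first_passage x us.

Lemma itv_sub_refl A : itv_sub A A.
Proof. by rewrite /itv_sub !lexx. Qed.

Lemma itv_sub_trans A B C : itv_sub A B -> itv_sub B C -> itv_sub A C.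
Proof.
by move=> /andP[? ?] /andP[? ?]; apply/andP; split;
  [exact: (le_trans (y := B.1)) | exact: (le_trans (y := B.2))].
Qed.

Lemma itv_in_sub x A B : itv_in x A -> itv_sub A B -> itv_in x B.
Proof.
by move=> /andP[? ?] /andP[? ?]; apply/andP; split;
  [exact: (le_trans (y := A.1)) | exact: (le_trans (y := A.2))].
Qed.

Lemma chain_subl A A' us B : itv_sub A A' -> chain A us B -> chain A' us B.
Proof.
move=> AA'; case: us => [|K us] /=; first by move/itv_sub_trans; apply.
by move=> /and3P[-> KA ->]; rewrite (itv_sub_trans KA).
Qed.

Lemma chain_subr A us B B' : itv_sub B' B -> chain A us B -> chain A us B'.
Proof.
move=> BB'; elim: us A => [|K us IH] A /=; first exact: itv_sub_trans.
by move=> /and3P[-> -> /IH].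
Qed.

Lemma chain_cat A us B vs C : chain A us B -> chain B vs C ->
  chain A (us ++ vs) C.
Proof.
elim: us A => [|K us IH] A /=; first exact: chain_subl.
by move=> /and3P[-> -> h1 h2]; exact: IH h1 h2.
Qed.

Lemma rising_le K : rising K -> K.1 <= K.2.
Proof. by move=> /andP[/ltW]. Qed.

Lemma pullback_in A us B x : chain A us B -> itv_in x B -> itv_in (pullback us x) A.
Proof.
elim: us A => [|K us IH] A /=; first by move=> BA xB; exact: itv_in_sub BA.
move=> /and3P[rK KA c] xB.
have [h _ _] := first_passageP (rising_le rK) (IH _ c xB).
exact: itv_in_sub h KA.
Qed.

Lemma pullback_mono A us B x x' : chain A us B -> itv_in x B -> itv_in x' B ->
  x <= x' -> pullback us x <= pullback us x'.
Proof.
move=> + xB xB' xx'; elim: us A => [|K us IH] A //= /and3P[rK KA c].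
have /andP[/= h1 _] := pullback_in c xB; have /andP[/= _ h2] := pullback_in c xB'.
by apply: first_passage_mono; [exact: rising_le | | exact: IH c |].
Qed.

Lemma pullback_cons A K us B x : chain A (K :: us) B -> itv_in x B ->
  t (pullback (K :: us) x) = pullback us x.
Proof.
move=> /= /and3P[rK KA c] xB.
by have [_ h _] := first_passageP (rising_le rK) (pullback_in c xB).
Qed.

Lemma pullback_record A K us B x : chain A (K :: us) B -> itv_in x B ->
  record K (pullback (K :: us) x).
Proof.
move=> /= /and3P[rK KA c] xB.
exact: first_passage_record (rising_le rK) (pullback_in c xB).
Qed.

Lemma iter_pullback A us B x j : chain A us B -> itv_in x B ->
  (j <= size us)%N -> iter j t (pullback us x) = pullback (drop j us) x.
Proof.
move=> + xB; elim: us A j => [|K us IH] A [|j]//.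
by move=> c jus; rewrite iterSr (pullback_cons c xB) (IH (rise K))//;
  case/and3P: c.
Qed.

End chains.

(** * Growth of heights for a hypersensitive zipper *)

Section powers.
Context {R : realType}.

Lemma expr_unbounded (l x : R) : 1 < l -> exists n, x <= l ^+ n.
Proof.
move=> l1; have h0 : 0 < l - 1 by rewrite subr_gt0.
exists (Num.truncn (x / (l - 1))).+1.
have : x / (l - 1) < (Num.truncn (x / (l - 1))).+1%:R by exact: truncnS_gt.
move: (Num.truncn _).+1 => n; rewrite ltr_pdivrMr// => /ltW xn.
apply: (le_trans xn); elim: n {xn} => [|n IH]; first by rewrite mul0r expr0.
rewrite -natr1 exprS mulrDl mul1r.
have p1 : 1 <= l ^+ n by rewrite exprn_ege1// ltW.
by have := ler_wpM2l (ltW h0) p1; lra.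
Qed.

Lemma expr_small (r x : R) : 0 < r -> r < 1 -> 0 < x -> exists n, r ^+ n <= x.
Proof.
move=> r0 r1 x0; have [|n h] := @expr_unbounded r^-1 x^-1; first by rewrite invf_gt1.
by exists n; rewrite -lef_pV2 ?posrE ?exprn_gt0// -exprVn.
Qed.

Lemma expr_le_inv (r : R) n m : 0 < r -> r < 1 -> r ^+ n <= r ^+ m -> (m <= n)%N.
Proof. by move=> r0 r1; rewrite ler_iXn2l. Qed.

End powers.

Definition unit_itv {R : realType} (A : R * R) := [&& 0 <= A.1, A.1 < A.2 & A.2 <= 1].
Definition len {R : realType} (A : R * R) := A.2 - A.1.

Section zipper_growth.
Context {R : realType}.
Variables (x1 y1 x2 y2 : R) (t : R -> R).
Hypothesis hb : [/\ 0 < x1, x1 < x2, x2 < 1, 0 < y2 & y2 < y1 < 1].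
Hypothesis hs : [/\ x1 < y1, x2 - x1 < y1 - y2 & 1 - x2 < 1 - y2].
Hypothesis tb : forall x, 0 <= t x <= 1.
Hypothesis t0 : t 0 = 0.
Hypothesis t1 : t 1 = 1.
Hypothesis t_left : forall x, 0 <= x <= 1 -> t (x1 * x) = y1 * t x.
Hypothesis t_mid : forall x, 0 <= x <= 1 ->
  t (x1 + (x2 - x1) * x) = y1 - (y1 - y2) * t x.
Hypothesis t_right : forall x, 0 <= x <= 1 ->
  t (x2 + (1 - x2) * x) = y2 + (1 - y2) * t x.

Let rho : R := Num.min x1 (Num.min (x2 - x1) (1 - x2)).
Let sig : R := Num.max x1 (Num.max (x2 - x1) (1 - x2)).
Let lam : R := Num.min (y1 / x1) (Num.min ((y1 - y2) / (x2 - x1)) ((1 - y2) / (1 - x2))).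

Lemma rho_gt0 : 0 < rho.
Proof.
have [b1 b2 b3 b4 /andP[b5 b6]] := hb.
by rewrite !lt_min b1 !subr_gt0 b2 b3.
Qed.

Lemma rho_lt1 : rho < 1.
Proof.
have [b1 b2 b3 b4 /andP[b5 b6]] := hb.
by rewrite !gt_min (lt_trans b2 b3).
Qed.

Lemma sig_lt1 : sig < 1.
Proof.
have [b1 b2 b3 b4 /andP[b5 b6]] := hb.
by rewrite !gt_max; apply/and3P; split; lra.
Qed.

Lemma sig_gt0 : 0 < sig.
Proof. by have [b1 _ _ _ _] := hb; rewrite !lt_max b1. Qed.

Lemma lam_gt1 : 1 < lam.
Proof.
have [b1 b2 b3 b4 /andP[b5 b6]] := hb; have [s1 s2 s3] := hs.
by rewrite !lt_min; apply/and3P; split; rewrite ltr_pdivlMr ?mul1r ?subr_gt0.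
Qed.

Definition branch (a w c e : R) : Prop :=
  [/\ rho <= w <= sig, 0 <= a, a + w <= 1, lam * w <= `|e| &
      forall x, 0 <= x <= 1 -> t (a + w * x) = c + e * t x].

Lemma branch_left : branch 0 x1 0 y1.
Proof.
have [b1 b2 b3 b4 /andP[b5 b6]] := hb.
split; rewrite ?add0r//.
- by rewrite ge_min lexx le_max lexx.
- lra.
- rewrite ger0_norm; last lra.
  by rewrite -ler_pdivlMr// ge_min lexx.
- by move=> x x01; rewrite !add0r t_left.
Qed.

Lemma branch_mid : branch x1 (x2 - x1) y1 (- (y1 - y2)).
Proof.
have [b1 b2 b3 b4 /andP[b5 b6]] := hb.
split; rewrite ?(ltW b1)//.
- by rewrite !ge_min !le_max !lexx !orbT.
- lra.
- rewrite normrN ger0_norm; last lra.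
  by rewrite -ler_pdivlMr ?subr_gt0// !ge_min lexx !orbT.
- by move=> x x01; rewrite t_mid// mulNr.
Qed.

Lemma branch_right : branch x2 (1 - x2) y2 (1 - y2).
Proof.
have [b1 b2 b3 b4 /andP[b5 b6]] := hb.
split.
- by rewrite !ge_min !le_max !lexx !orbT.
- lra.
- lra.
- rewrite ger0_norm; last lra.
  by rewrite -ler_pdivlMr ?subr_gt0// !ge_min lexx !orbT.
- by move=> x x01; rewrite t_right.
Qed.

Lemma branch_cover x : 0 <= x <= 1 ->
  exists a w c e, branch a w c e /\ a <= x <= a + w.
Proof.
move=> /andP[x0 xl1]; have [xx1|x1x] := leP x x1.
  by exists 0, x1, 0, y1; split; [exact: branch_left | rewrite x0 add0r].
have [xx2|x2x] := leP x x2.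
  exists x1, (x2 - x1), y1, (- (y1 - y2)); split; first exact: branch_mid.
  by rewrite ltW// subrKC.
exists x2, (1 - x2), y2, (1 - y2); split; first exact: branch_right.
by rewrite ltW// subrKC.
Qed.

(* The restriction of [t] to the cylinder [a, a + w], a word of length [k]
   deep, is an affine copy of [t]. *)
Definition selfsim k (a w c e : R) : Prop :=
  [/\ [/\ rho ^+ k <= w, w <= sig ^+ k & 0 < w],
      0 <= a, a + w <= 1, lam ^+ k * w <= `|e| &
      forall x, 0 <= x <= 1 -> t (a + w * x) = c + e * t x].

Lemma selfsim0 : selfsim 0 0 1 0 1.
Proof.
split; rewrite ?expr0 ?lexx ?add0r ?mul1r ?normr1//.
by move=> x _; rewrite !add0r !mul1r.
Qed.

Lemma selfsim_branch k a w c e a' w' c' e' :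
  selfsim k a w c e -> branch a' w' c' e' ->
  selfsim k.+1 (a + w * a') (w * w') (c + e * c') (e * e').
Proof.
move=> [[rw ws w0] a0 aw lwe tE] [/andP[rw' ws'] a0' aw' lwe' tE'].
have r0 := rho_gt0; have w'0 : 0 < w' by exact: lt_le_trans rw'.
have l0 := lt_trans ltr01 lam_gt1.
split.
- split; last by rewrite mulr_gt0.
    by rewrite exprSr ler_pM// ?exprn_ge0// ltW.
  by rewrite exprSr ler_pM// ltW.
- by rewrite addr_ge0// mulr_ge0// ltW.
- rewrite -addrA -mulrDr; apply: le_trans aw; rewrite lerD2l.
  by rewrite ler_piMr// ltW.
- rewrite normrM exprSr mulrACA; apply: ler_pM => //.
    by rewrite mulr_ge0 ?exprn_ge0// ltW.
  by rewrite mulr_ge0// ltW.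
move=> x /andP[x0 x1']; rewrite -addrA -mulrA -mulrDr tE; last first.
  rewrite addr_ge0 ?mulr_ge0 ?(ltW w'0)//=; apply: le_trans aw'.
  by rewrite lerD2l ler_piMr// ltW.
by rewrite tE' ?x0// mulrDr addrA mulrA.
Qed.

(** The descent follows the cylinders containing the midpoint of [A] until the length is at most
    [len A / 2]. Such a cylinder lies in [A], and its parent was longer than [len A / 2]. The second
    alternative says that depth [k] is still too early. *)
Lemma selfsim_descend (A : R * R) k : unit_itv A ->
  (exists j a w c e, [/\ selfsim j a w c e, A.1 <= a, a + w <= A.2 &
     rho * len A / 2 <= w]) \/
  (exists a w c e, [/\ selfsim k a w c e, a <= (A.1 + A.2) / 2 <= a + w &
     len A / 2 < w]).
Proof.
move=> /and3P[A0 A12 A1]; elim: k => [|k [|IH]]; [right|by left|].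
  exists 0, 1, 0, 1; rewrite /len; split; first exact: selfsim0.
    by rewrite add0r; apply/andP; split; lra.
  lra.
have [a [w [c [e [ss /andP[h1 h2] h3]]]]] := IH.
have w0 : 0 < w by case: ss => -[].
have s01 : 0 <= ((A.1 + A.2) / 2 - a) / w <= 1.
  by apply/andP; split; [apply: divr_ge0; lra | rewrite ler_pdivrMr; lra].
have [a' [w' [c' [e' [br /andP[g1 g2]]]]]] := branch_cover s01.
have ss' := selfsim_branch ss br.
have g1' : a + w * a' <= (A.1 + A.2) / 2.
  by move: g1; rewrite ler_pdivlMr//; lra.
have g2' : (A.1 + A.2) / 2 <= a + w * a' + w * w'.
  by move: g2; rewrite ler_pdivrMr//; lra.
have [wl|wl] := ltP (len A / 2) (w * w').
  by right; exists (a + w * a'), (w * w'), (c + e * c'), (e * e'); rewrite g1'.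
left; exists k.+1, (a + w * a'), (w * w'), (c + e * c'), (e * e').
rewrite /len in wl h3 *; split => //; [lra|lra|].
have r0 := rho_gt0; case: br => /andP[rw' _] _ _ _ _.
rewrite (_ : rho * _ / 2 = (A.2 - A.1) / 2 * rho); last by ring.
by apply: ler_pM; lra.
Qed.

(** The descent has ended at a depth with [sig ^+ k <= len A / 2]. If the copy found is reversed,
    its middle branch is increasing again, which costs the second factor [rho]. *)
Lemma selfsim_inside (A : R * R) : unit_itv A ->
  exists j a w c e, [/\ selfsim j a w c e, 0 < e, A.1 <= a, a + w <= A.2 &
     rho ^+ 2 / 2 * len A <= w].
Proof.
move=> uA; have [k hk] : exists k, sig ^+ k <= len A / 2.
  apply: expr_small; [exact: sig_gt0|exact: sig_lt1|].
  by case/and3P: uA => _ h _; rewrite divr_gt0// subr_gt0.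
have r0 := rho_gt0.
have [[j [a [w [c [e [ss aA wA wl]]]]]]|] := selfsim_descend k uA; last first.
  move=> [a [w [c [e [[[_ ws _] _ _ _ _] _ lw]]]]].
  by have := lt_le_trans lw (le_trans ws hk); rewrite ltxx.
have w0 : 0 < w by case: ss => -[].
have l0 := lt_trans ltr01 lam_gt1.
have eN0 : 0 < `|e|.
  by case: ss => _ _ _ + _; apply: lt_le_trans; rewrite mulr_gt0// exprn_gt0.
have A0 : 0 < len A by case/and3P: uA => _ h _; rewrite subr_gt0.
have [e0|e0|e0] := ltgtP e 0; last by move: eN0; rewrite e0 normr0 ltxx.
  have ss' := selfsim_branch ss branch_mid.
  exists j.+1, (a + w * x1), (w * (x2 - x1)), (c + e * y1), (e * - (y1 - y2)).
  have [b1 b2 b3 b4 /andP[b5 b6]] := hb.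
  have h1 := mulr_gt0 w0 b1.
  have h2 : w * x2 <= w by rewrite ler_piMr; lra.
  split => //; [by rewrite nmulr_rgt0//; lra|lra|lra|].
  rewrite (_ : _ * _ = (rho * len A / 2) * rho); last by rewrite expr2; field.
  apply: ler_pM => //; rewrite ?divr_ge0 ?mulr_ge0 ?(ltW r0) ?(ltW A0)//.
  by rewrite !ge_min lexx !orbT.
exists j, a, w, c, e; split => //; apply: le_trans wl.
rewrite (_ : _ * _ = (rho * len A / 2) * rho); last by rewrite expr2; field.
apply: ler_piMr; last exact: ltW rho_lt1.
by rewrite divr_ge0// mulr_ge0// ltW.
Qed.

(** An increasing cylinder of depth [j] in [A] rises by at least [lam ^+ j] times its width, and
    [rho ^+ j <= len A <= rho ^+ n] forces [n <= j]: the expansion improves without bound as [A]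
    shrinks. *)
Lemma zipper_growth n (A : R * R) : unit_itv A -> len A <= rho ^+ n ->
  exists K, [/\ rising t K, itv_sub K A &
    rho ^+ 2 / 2 * lam ^+ n * len A <= len (rise t K)].
Proof.
move=> uA An; have [j [a [w [c [e [ss e0 aA wA wl]]]]]] := selfsim_inside uA.
have r0 := rho_gt0; have r1 := rho_lt1; have l1 := lam_gt1.
have A0 : 0 < len A by case/and3P: uA => _ h _; rewrite subr_gt0.
have [[rw ws w0] _ _ le tE] := ss.
have ta : t a = c by have := tE 0; rewrite t0 !mulr0 !addr0; apply; rewrite lexx ler01.
have tw : t (a + w) = c + e by have := tE 1; rewrite t1 !mulr1; apply; rewrite lexx ler01.
have nj : (n <= j)%N.
  apply: (expr_le_inv r0 r1); apply: (le_trans rw); apply: le_trans An.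
  by rewrite /len; lra.
exists (a, a + w); split.
- by rewrite /rising/= ltrDl w0 ta tw ltrDl.
- by rewrite /itv_sub/= aA.
rewrite /len/= ta tw (addrC c) addrK -/(len A).
rewrite (ger0_norm (ltW e0)) in le; apply: le_trans le.
rewrite mulrAC mulrC; apply: ler_pM => //.
- by rewrite exprn_ge0// ltW// (lt_trans ltr01).
- by rewrite mulr_ge0// ?divr_ge0 ?exprn_ge0// ltW.
- by rewrite ler_weXn2l// ltW.
Qed.

(** Records lie in [K], so only [A] inside [K] needs work. There an increasing copy of [t] takes the
    value [c + e * y1] at its abscissa [x1], and a later interval where [t] stays strictly below
    this value has no record. *)
Lemma zipper_avoid_record (K A : R * R) : unit_itv A ->
  exists A', [/\ unit_itv A', itv_sub A' A & forall x, itv_in x A' -> ~ record t K x].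
Proof.
move=> uA; have /and3P[A0 A12 A1] := uA.
have [AK|KA] := ltP A.1 K.1.
  pose z := Num.min ((A.1 + K.1) / 2) A.2.
  have z1 : A.1 < z by rewrite lt_min A12 andbT; lra.
  have z2 : z <= A.2 by rewrite ge_min lexx orbT.
  have z3 : z < K.1 by rewrite gt_min (_ : _ < _)//; lra.
  exists (A.1, z); split => /=; first by apply/and3P; split => //=; lra.
    by rewrite /itv_sub/= lexx z2.
  by move=> x /andP[/= _ xz] [/andP[Kx _] _]; lra.
have [KA2|AK2] := ltP K.2 A.2.
  pose z := Num.max ((A.2 + K.2) / 2) A.1.
  have z1 : z < A.2 by rewrite gt_max A12 andbT; lra.
  have z2 : A.1 <= z by rewrite le_max lexx orbT.
  have z3 : K.2 < z by rewrite lt_max (_ : K.2 < (A.2 + K.2) / 2)//; lra.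
  exists (z, A.2); split => /=; first by apply/and3P; split => //=; lra.
    by rewrite /itv_sub/= lexx z2.
  by move=> x /andP[/= zx _] [/andP[_ xK] _]; lra.
have [j [a [w [c [e [ss e0 aA wA wl]]]]]] := selfsim_inside uA.
have [b1 b2 b3 b4 /andP[b5 b6]] := hb.
have [[rw ws w0] a0 aw le tE] := ss.
(* The middle branch starts at this height; its own middle branch stays below it by at least
   [e * (y1 - y2) * y2]. *)
have ss2 := selfsim_branch (selfsim_branch ss branch_mid) branch_mid.
have [[_ _ w0'] a0' aw' _ tE'] := ss2.
set a' := a + w * x1 + _ in a0' aw' tE'; set w' := w * _ * _ in w0' aw' tE'.
have d0 : 0 < x2 - x1 by lra.
have w1 : 0 < w * (x2 - x1) by rewrite mulr_gt0.
have aE : a + w * x1 < a'.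
  by rewrite /a' ltrDl mulr_gt0.
have awE : a' + w' <= a + w.
  rewrite /a' /w' -addrA -addrA lerD2l -!mulrA -!mulrDr ler_piMr ?(ltW w0)//.
  have : (x2 - x1) * (x1 + (x2 - x1)) <= x2 - x1 by rewrite ler_piMr; lra.
  by rewrite subrKC; lra.
exists (a', a' + w'); split.
- by apply/and3P; split => //=; rewrite ltrDl.
- rewrite /itv_sub/= (le_trans awE wA) andbT.
  by have := mulr_gt0 w0 b1; lra.
move=> x /andP[/= ax xa] [_ /(_ (a + w * x1))].
have h1 := mulr_gt0 w0 b1.
have -> : K.1 <= a + w * x1 <= x by apply/andP; split; lra.
move=> /(_ isT).
have s01 : 0 <= (x - a') / w' <= 1.
  by apply/andP; split; [apply: divr_ge0; lra | rewrite ler_pdivrMr; lra].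
have tx := tE' _ s01.
have tx1 : t (a + w * x1) = c + e * y1.
  rewrite tE; last by apply/andP; split; lra.
  by have := @t_left 1; rewrite !mulr1 t1 => ->//; rewrite ?mulr1// ler01 lexx.
rewrite mulrC divfK ?gt_eqF// subrKC in tx.
rewrite tx tx1.
have /andP[u0 u1] := tb ((x - a') / w').
rewrite leNgt => /negP; apply.
set u := t _ in u0 u1 *.
have d1 : 0 < y1 - y2 by lra.
have : 0 < e * (y1 - y2) * (y1 - (y1 - y2) * u).
  apply: mulr_gt0; first exact: mulr_gt0.
  have : (y1 - y2) * u <= y1 - y2 by rewrite ler_piMr// ltW.
  lra.
lra.
Qed.

End zipper_growth.

(** * Fans with many branches and short ways back *)

Section fan_and_lag.
Context {R : realType}.
Variables (t : R -> R) (rho lam c : R).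
Hypothesis ct : continuous t.
Hypothesis tb : forall x, 0 <= t x <= 1.
Hypotheses (r0 : 0 < rho) (r1 : rho < 1) (l1 : 1 < lam) (c0 : 0 < c).
Hypothesis growth : forall n (A : R * R), unit_itv A -> len A <= rho ^+ n ->
  exists K, [/\ rising t K, itv_sub K A & c * lam ^+ n * len A <= len (rise t K)].

Lemma unit_itv_rise K : rising t K -> unit_itv (rise t K).
Proof.
move=> /andP[_ h]; apply/and3P; split => //=.
  by case/andP: (tb K.1).
by case/andP: (tb K.2).
Qed.

Lemma len_le1 (A : R * R) : unit_itv A -> len A <= 1.
Proof. by move=> /and3P[? ? ?]; rewrite /len; lra. Qed.

Lemma len_gt0 (A : R * R) : unit_itv A -> 0 < len A.
Proof. by move=> /and3P[? ? ?]; rewrite subr_gt0. Qed.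

Lemma grow_step (M : R) : exists2 n, True & forall A, unit_itv A ->
  len A <= rho ^+ n -> exists K, [/\ chain t A [:: K] (rise t K),
    unit_itv (rise t K) & M * len A <= len (rise t K)].
Proof.
have [n hn] := expr_unbounded (M / c) l1; exists n => // A uA An.
have [K [rK KA h]] := growth uA An.
exists K; split; first by rewrite /= rK KA itv_sub_refl.
  exact: unit_itv_rise.
apply: le_trans h; rewrite ler_pM2r ?len_gt0//.
by move: hn; rewrite ler_pdivrMr// mulrC.
Qed.

Lemma grow_to : exists2 e : R, 0 < e & forall A, unit_itv A ->
  exists us B, [/\ chain t A us B, unit_itv B & e <= len B].
Proof.
have [n _ gs] := grow_step 2; exists (rho ^+ n); first by rewrite exprn_gt0.
move=> A uA; have [m hm] : exists m, rho ^+ n <= 2 ^+ m * len A.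
  have [|m hm] := @expr_unbounded R 2 (rho ^+ n / len A); first by rewrite ltr1n.
  by exists m; rewrite -ler_pdivrMr// len_gt0.
elim: m A uA hm => [|m IH] A uA hm.
  by exists [::], A; rewrite expr0 mul1r in hm; split => //; exact: itv_sub_refl.
have [An|An] := leP (len A) (rho ^+ n); last first.
  by exists [::], A; split => //; [exact: itv_sub_refl | exact: ltW].
have [K [cK uK hK]] := gs A uA An.
have [|us [B [cB uB hB]]] := IH _ uK.
  apply: (le_trans hm); rewrite exprSr -mulrA.
  by apply: ler_wpM2l => //; rewrite exprn_ge0.
by exists (K :: us), B; split => //; exact: (chain_cat cK cB).
Qed.

Definition cell (M i : nat) : R * R := (i%:R / M%:R, i.+1%:R / M%:R).

Lemma unit_itv_cell M i : (i < M)%N -> unit_itv (cell M i).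
Proof.
move=> iM; have M0 : 0 < M%:R :> R by rewrite ltr0n (leq_trans _ iM).
apply/and3P; split; rewrite /cell/=.
- by rewrite divr_ge0.
- by rewrite ltr_pM2r ?invr_gt0// ltr_nat.
- by rewrite ler_pdivrMr// mul1r ler_nat.
Qed.

(** Three mesh widths leave room for a cell whose right end is strictly to the left of [A.2]; this
    strictness ends up in [is_fan]. *)
Lemma cell_inside (M : nat) (A : R * R) : unit_itv A -> 3 <= M%:R * len A ->
  exists2 i : 'I_M, itv_sub (cell M i) A & (cell M i).2 < A.2.
Proof.
move=> /and3P[A0 A12 A1] h; rewrite /len in h.
have M0 : 0 < M%:R :> R.
  have : 0 < M%:R * (A.2 - A.1) by lra.
  by rewrite pmulr_lgt0// subr_gt0.
have AM0 : 0 <= A.1 * M%:R by rewrite mulr_ge0// ltW.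
pose i := (Num.truncn (A.1 * M%:R)).+1.
have /andP[] := truncn_itv AM0; rewrite -/i => i1 i2.
have iE : i%:R = (Num.truncn (A.1 * M%:R))%:R + 1 :> R by rewrite -natr1.
have iSE : i.+1%:R = i%:R + 1 :> R by rewrite -natr1.
have h2 : i.+1%:R < A.2 * M%:R by rewrite iSE iE; lra.
have iM : (i < M)%N.
  rewrite -(ltr_nat R); have : A.2 * M%:R <= M%:R by rewrite ler_piMl// ltW.
  by rewrite iSE in h2; lra.
exists (Ordinal iM); last by rewrite /cell/= ltr_pdivrMr.
by rewrite /itv_sub/= ler_pdivlMr// (ltW i2)/= ler_pdivrMr// ltW.
Qed.

Lemma len_cell M i : (0 < M)%N -> len (cell M i) = M%:R^-1.
Proof.
move=> M0; rewrite /len/= -mulrBl -natr1 addrAC subrr add0r mul1r//.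
Qed.

Definition reaches (A B : R * R) := exists us, chain t A us B.

Lemma reaches_trans A B C : reaches A B -> reaches B C -> reaches A C.
Proof. by move=> [us h1] [vs h2]; exists (us ++ vs); exact: chain_cat h1 h2. Qed.

(* A cell whose reachability class is minimal, hence terminal. *)
Lemma terminal_base : exists2 K : R * R, unit_itv K &
  forall A, unit_itv A -> reaches K A -> reaches A K.
Proof.
have [e e0 gt] := grow_to.
pose M := (Num.truncn (3 / e)).+1.
have Me : 3 <= M%:R * e.
  by rewrite -ler_pdivrMr// ltW// truncnS_gt.
have hit A : unit_itv A -> exists i : 'I_M, reaches A (cell M i).
  move=> uA; have [us [B [cB uB hB]]] := gt A uA.
  have [|i iB _] := @cell_inside M _ uB; last first.
    by exists i, us; exact: chain_subr iB cB.
  by apply: (le_trans Me); rewrite ler_pM2l// ltr0n.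
pose r (i : 'I_M) := [set j : 'I_M | `[< reaches (cell M i) (cell M j) >]]%SET.
have hr (i j : 'I_M) : reflect (reaches (cell M i) (cell M j)) (j \in r i).
  by apply: (iffP idP); rewrite inE => /asboolP.
pose i0 : 'I_M := ord0.
have [i _ imin] := @arg_minnP _ i0 xpredT (fun i => #|r i|) isT.
have [j /hr rij] : exists j, j \in r i.
  by have [j /hr] := hit _ (unit_itv_cell (ltn_ord i)); exists j.
have sub k l : l \in r k -> r l \subset r k.
  by move=> /hr lk; apply/fintype.subsetP => m /hr ml; apply/hr; exact: reaches_trans ml.
have rE k : k \in r i -> r k = r i.
  by move=> ki; apply/eqP; rewrite eqEcard sub//= imin.
exists (cell M j); first exact: unit_itv_cell.
move=> A uA jA; have [k Ak] := hit A uA.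
have jk : k \in r j by apply/hr; exact: reaches_trans jA Ak.
have : j \in r k.
  by rewrite rE; [apply/hr|rewrite -(rE j)//; apply/hr].
by move=> /hr; exact: reaches_trans.
Qed.

Lemma uniform_bound n (Q : 'I_n -> nat -> Prop) :
  (forall i m m', (m <= m')%N -> Q i m -> Q i m') ->
  (forall i, exists m, Q i m) -> exists m, forall i, Q i m.
Proof.
move=> Qm h; have [f fP] := choice h.
by exists (\max_i f i)%N => i; apply: Qm (fP i); exact: leq_bigmax.
Qed.

(** Below the length [e] one step multiplies the length by at least [rho ^- D], which lowers the
    exponent [n] by [D]; from [e] on, the interval contains one of finitely many grid cells, and the
    ways back from the reachable ones have bounded length. [D] is arbitrary because short intervals
    are stretched by any prescribed factor. *)
Lemma lag (K : R * R) :
  (forall A, unit_itv A -> reaches K A -> reaches A K) ->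
  forall D, (0 < D)%N -> exists C, forall n A, unit_itv A ->
    rho ^+ n <= len A -> reaches K A ->
    exists2 us, chain t A us K & (D * size us <= n + C)%N.
Proof.
move=> term D D0.
have [n0 _ gs] := grow_step (rho ^- D).
pose e := rho ^+ n0; have e0 : 0 < e by rewrite exprn_gt0.
pose M := (Num.truncn (3 / e)).+1.
have Me : 3 <= M%:R * e.
  by rewrite -ler_pdivrMr// ltW// truncnS_gt.
have [C0 hC0] : exists m, forall i : 'I_M, reaches K (cell M i) ->
    exists2 us, chain t (cell M i) us K & (size us <= m)%N.
  apply: (@uniform_bound M (fun i m => reaches K (cell M i) ->
    exists2 us, chain t (cell M i) us K & (size us <= m)%N)).
    move=> i m m' mm' h /h[us cus hus]; exists us => //.
    exact: leq_trans mm'.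
  move=> i; have [Ki|Ki] := pselect (reaches K (cell M i)); last by exists 0%N.
  have [us cus] := term _ (unit_itv_cell (ltn_ord i)) Ki.
  by exists (size us) => _; exists us.
have large A : unit_itv A -> e <= len A -> reaches K A ->
    exists2 us, chain t A us K & (size us <= C0)%N.
  move=> uA eA KA; have [|i iA _] := @cell_inside M _ uA.
    by apply: (le_trans Me); rewrite ler_pM2l// ltr0n.
  have [|us cus hus] := hC0 i.
    by apply: reaches_trans KA _; exists [::].
  by exists us => //; exact: chain_subl iA cus.
exists (D * C0.+1)%N; elim/ltn_ind => n IH A uA hA KA.
have [eA|Ae] := leP e (len A).
  have [us cus hus] := large A uA eA KA; exists us => //.
  by apply: (@leq_trans (D * C0.+1)%N); rewrite ?leq_addl// leq_mul2l leqW ?orbT.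
have [U [cU uU hU]] := gs A uA (ltW Ae).
have KU : reaches K (rise t U) by apply: reaches_trans KA _; exists [:: U].
have [Dn|nD] := leqP D n.
  have [||us cus hus] := IH (n - D)%N _ (rise t U) uU _ KU.
  - by rewrite ltn_subrL D0 (leq_trans D0).
  - apply: le_trans hU; rewrite mulrC ler_pdivlMr ?exprn_gt0// -exprD subnK//.
  exists (U :: us); first exact: (chain_cat cU cus).
  by rewrite /= mulnS -[X in (_ <= X + _)%N](subnKC Dn) -addnA leq_add2l.
(* For [n < D] a single step already gives length at least 1, hence at least [e]. *)
have [|us cus hus] := large _ uU _ KU.
  apply: le_trans hU; apply: (@le_trans _ _ 1); first by rewrite exprn_ile1// ltW.
  rewrite mulrC ler_pdivlMr ?exprn_gt0// mul1r; apply: le_trans hA.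
  by apply: ler_wiXn2l; rewrite ?(ltW r0) ?(ltW r1)// ltnW.
exists (U :: us); first exact: (chain_cat cU cus).
by rewrite /=; apply: (@leq_trans (D * C0.+1)%N); rewrite ?leq_addl// leq_mul2l ltnS hus orbT.
Qed.

(** The strict inequality keeps points of a branch that are sent into [A] off its right end, so that
    half-open branches tell the choices apart. *)
Definition is_fan N (Q : R * R) (v : nat -> R * R) (A : R * R) : Prop :=
  (forall a, (a < N)%N -> [/\ rising t (v a), itv_sub (v a) Q,
     itv_sub A (rise t (v a)) & A.2 < (rise t (v a)).2]) /\
  (forall a b, (a < N)%N -> (b < N)%N -> a != b ->
     (v a).2 <= (v b).1 \/ (v b).2 <= (v a).1).

Lemma pigeonhole (X M : nat) (g : 'I_X -> 'I_M) : (0 < M)%N ->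
  exists y, (X <= M * #|[set i | g i == y]%SET|)%N.
Proof.
move=> M0; pose F y := #|[set i | g i == y]%SET|.
have [y _ ymax] := @arg_maxnP _ (Ordinal M0) xpredT F isT.
have XE : X = (\sum_(z : 'I_M) F z)%N.
  rewrite -[LHS]card_ord -sum1_card (partition_big g xpredT)//=.
  apply: eq_bigr => z _.
  by rewrite /F -sum1dep_card; apply: eq_bigl.
exists y; apply: (@leq_trans (\sum_(z : 'I_M) F z)); first by rewrite -XE.
apply: (@leq_trans (\sum_(z : 'I_M) F y)).
  by apply: leq_sum => z _; exact: ymax.
by rewrite big_const_ord iter_addn_0 mulnC.
Qed.

Lemma subcell (Q : R * R) (X i : nat) : unit_itv Q -> (i < X)%N ->
  let C := (Q.1 + i%:R * (len Q / X%:R), Q.1 + i.+1%:R * (len Q / X%:R)) in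
  [/\ unit_itv C, itv_sub C Q & len C = len Q / X%:R].
Proof.
move=> uQ iX C; have /and3P[Q0 Q12 Q1] := uQ; have lQ := len_gt0 uQ.
have X0 : 0 < X%:R :> R by rewrite ltr0n (leq_trans _ iX).
have z0 : 0 < len Q / X%:R by rewrite divr_gt0.
have iz : 0 <= i%:R * (len Q / X%:R) by rewrite mulr_ge0// ltW.
have iSz : i.+1%:R * (len Q / X%:R) <= len Q.
  by rewrite mulrCA ler_piMr ?(ltW lQ)// ler_pdivrMr// mul1r ler_nat.
have iSE : i.+1%:R * (len Q / X%:R) = i%:R * (len Q / X%:R) + len Q / X%:R.
  by rewrite -natr1 mulrDl mul1r.
rewrite iSE in iSz; rewrite /C iSE.
have lE : len Q = Q.2 - Q.1 by [].
move: (len Q / X%:R) z0 iz iSz => z z0; move: (i%:R * z) => y iz iSz.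
split; last by rewrite /len/=; ring.
  by apply/and3P; split => /=; lra.
by apply/andP; split => /=; lra.
Qed.

(** Each of [X] pieces of [Q], of width [z], contains a branch rising by at least
    [s = c * lam ^+ n * z], hence covering a cell of a grid of mesh [1 / M >= s / 4]. Some cell is
    covered by at least [X / M] branches, and [X * s / 4 = c * len Q / 4 * lam ^+ n] since
    [X * z = len Q]: the width cancels. *)
Lemma fan (Q : R * R) : unit_itv Q -> exists2 cQ : R, 0 < cQ & exists e,
  forall n N, N%:R <= cQ * lam ^+ n -> exists A v,
    [/\ unit_itv A, rho ^+ (n + e) <= len A & is_fan N Q v A].
Proof.
move=> uQ; have lQ := len_gt0 uQ; have lQ1 := len_le1 uQ.
exists (c * len Q / 4); first by rewrite divr_gt0// mulr_gt0.
have [e he] : exists e, rho ^+ e <= c * len Q / 8.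
  by apply: expr_small => //; rewrite divr_gt0// mulr_gt0.
exists e => n N hN.
have rn0 : 0 < rho ^+ n by rewrite exprn_gt0.
have rn1 : rho ^+ n <= 1 by rewrite exprn_ile1// ltW.
have ln1 : 1 <= lam ^+ n by rewrite exprn_ege1// ltW.
pose X := (Num.truncn (len Q / rho ^+ n)).+1.
have X0 : 0 < X%:R :> R by rewrite ltr0n.
pose z := len Q / X%:R.
have z0 : 0 < z by rewrite divr_gt0.
have zr : z <= rho ^+ n.
  rewrite ler_pdivrMr// mulrC -ler_pdivrMr// ltW//; exact: truncnS_gt.
have rz : len Q * rho ^+ n / 2 <= z.
  have /andP[+ _] := truncn_itv (ltW (divr_gt0 lQ rn0)).
  rewrite ler_pdivlMr// => h.
  have X2 : X%:R * rho ^+ n <= 2 by rewrite /X -natr1 mulrDl mul1r; lra.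
  rewrite /z ler_pdivlMr// (_ : _ * X%:R = len Q * (X%:R * rho ^+ n / 2)); last by ring.
  by rewrite ler_piMr ?(ltW lQ)//; lra.
pose s := c * lam ^+ n * z.
have s0 : 0 < s by rewrite mulr_gt0// mulr_gt0// (lt_le_trans ltr01).
pose M := (Num.truncn (3 / s)).+1.
have M0 : 0 < M%:R :> R by rewrite ltr0n.
have Ms : 3 <= M%:R * s by rewrite -ler_pdivrMr// ltW// truncnS_gt.
pose C (i : nat) := (Q.1 + i%:R * z, Q.1 + i.+1%:R * z).
have CP (i : 'I_X) := subcell uQ (ltn_ord i).
have /choice[K KP] (i : 'I_X) : exists K, [/\ rising t K, itv_sub K (C i) &
    s <= len (rise t K)].
  have [uC CQ lC] := CP i.
  by have [|K [h1 h2]] := growth (n := n) uC; rewrite lC//; exists K.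
have s1 : s <= 1.
  have [rK _ h] := KP ord0; apply: (le_trans h); apply: len_le1.
  exact: unit_itv_rise.
have M4 : M%:R * s <= 4.
  have /andP[+ _] := truncn_itv (ltW (divr_gt0 (ltr0Sn R 2) s0)).
  by rewrite ler_pdivlMr// /M -natr1 mulrDl mul1r; lra.
have /choice[g gP] (i : 'I_X) : exists j : 'I_M,
    itv_sub (cell M j) (rise t (K i)) /\ (cell M j).2 < (rise t (K i)).2.
  have [rK _ h] := KP i; have [|j h1 h2] := @cell_inside M _ (unit_itv_rise rK).
    by apply: (le_trans Ms); rewrite ler_pM2l.
  by exists j.
have [y hy] := pigeonhole g (ltn0Sn _).
set S := [set i | g i == y]%SET in hy.
have hS : (N <= #|S|)%N.
  rewrite -(ler_nat R); apply: (le_trans hN).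
  have : X%:R <= M%:R * #|S|%:R :> R by rewrite -natrM ler_nat.
  rewrite (_ : c * len Q / 4 * lam ^+ n = s * X%:R / 4); last first.
    by rewrite /s /z; field; rewrite gt_eqF.
  move=> /(ler_wpM2l (ltW s0)) h.
  have : M%:R * s * #|S|%:R <= 4 * #|S|%:R by rewrite ler_wpM2r.
  by rewrite ler_pdivrMr//; lra.
pose v a := K (nth ord0 (enum S) a).
have vS a : (a < N)%N -> nth ord0 (enum S) a \in S.
  by move=> aN; rewrite -mem_enum mem_nth// -cardE (leq_trans aN).
exists (cell M y), v; split; first exact: unit_itv_cell.
  rewrite len_cell//; apply: (@le_trans _ _ (s / 4)); last first.
    by rewrite ler_pdivrMr// mulrC ler_pdivlMr// mulrC.
  rewrite exprD; apply: (@le_trans _ _ (rho ^+ n * (c * len Q / 8))).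
    by rewrite ler_pM2l.
  rewrite /s (_ : _ * (_ / 8) = c * (len Q * rho ^+ n / 2) / 4); last by field.
  rewrite ler_pM2r ?invr_gt0//; apply: (@le_trans _ _ (c * z)).
    by rewrite ler_pM2l.
  by rewrite ler_pM2r// ler_peMr// ltW.
split.
  move=> a aN; have := vS a aN; rewrite /v; set i := nth _ _ _ => iS.
  have [rK KC _] := KP i; have [uC CQ lC] := CP i.
  have [h1 h2] := gP i; move: iS; rewrite inE => /eqP gi; rewrite gi in h1 h2.
  by split => //; exact: itv_sub_trans CQ.
move=> a b aN bN ab; rewrite /v; set i := nth _ _ a; set j := nth _ _ b.
have ij : i != j.
  by rewrite nth_uniq// ?enum_uniq// -cardE (leq_trans _ hS).
have [_ /andP[iC1 iC2] _] := KP i; have [_ /andP[jC1 jC2] _] := KP j.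
have cmp (m1 m2 : nat) : (m1 < m2)%N -> (C m1).2 <= (C m2).1.
  by move=> m12; rewrite lerD2l ler_pM2r// ler_nat.
have : (i != j :> nat) by [].
rewrite neq_ltn => /orP[|] /cmp h; [left|right].
  exact: le_trans (le_trans h jC1).
exact: le_trans (le_trans h iC1).
Qed.

(* The branching number [k ^ B] and the length of the way back to [K] are chosen
   simultaneously: [log (k ^ B)] is linear in [n], while by [lag] the number of
   steps is at most [n / D + C] with [D] as large as we please. *)
Lemma wide_fan (K Q : R * R) (k L b E : nat) :
  (forall A, unit_itv A -> reaches K A -> reaches A K) ->
  unit_itv Q -> itv_sub Q K -> (0 < k)%N ->
  exists A v us, [/\ unit_itv A, chain t A us K &
    is_fan (k ^ ((b + E * (size us).+1) * L).+1) Q v A].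
Proof.
move=> term uQ QK k0; have [cQ cQ0 [e hfan]] := fan uQ.
(* With [lam ^+ ka >= 2 * k] there are [k ^ j] branches at depth [ka * j], the surplus [2 ^ j]
   absorbing [cQ]. The factor [2 * ka * E * L] in [D] then keeps [E * L * size us] below about
   [j / 2], and [j] is taken large enough for the other terms. *)
have [ka0 hka0] := expr_unbounded (2 * k%:R) l1; pose ka := ka0.+1.
have hka : (2 * k%:R) <= lam ^+ ka.
  by apply: (le_trans hka0); rewrite ler_weXn2l// ltW.
have [C hC] := lag term (ltn0Sn (2 * ka * E * L)).
have [j0 hj0] := @expr_unbounded R 2 cQ^-1 (ltr1n R 2).
pose j := (j0 + 2 * (b * L + E * L + 1 + e + C))%N.
have hN : (k ^ j)%:R <= cQ * lam ^+ (ka * j).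
  apply: (@le_trans _ _ (cQ * (2 * k%:R) ^+ j)); last first.
    by rewrite ler_pM2l// exprM lerXn2r// ?nnegrE ?mulr_ge0// exprn_ge0// ltW// (lt_trans ltr01).
  rewrite natrX exprMn mulrA ler_peMl ?exprn_ge0//.
  rewrite mulrC -ler_pdivrMr// div1r; apply: (le_trans hj0).
  by rewrite ler_weXn2l ?ler1n// /j leq_addr.
have [A [v [uA rA [fA1 fA2]]]] := hfan _ _ hN.
have N0 : (0 < k ^ j)%N by rewrite expn_gt0 k0.
have KA : reaches K A.
  have [r0' vQ AR _] := fA1 _ N0; exists [:: v 0%N].
  by rewrite /= r0' AR (itv_sub_trans vQ QK).
have [us cus hus] := hC _ _ uA rA KA.
exists A, v, us; split => //.
have hB : (k ^ ((b + E * (size us).+1) * L).+1 <= k ^ j)%N.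
  rewrite leq_pexp2l//; set r := size us in hus *.
  have h1 : (2 * ka * (E * L * r) <= ka * j + e + C)%N.
    by apply: leq_trans hus; rewrite mulSn !mulnA leq_addl.
  have ka1 : (0 < ka)%N by [].
  have h2 : (2 * (E * L * r) <= j + 2 * (e + C))%N.
    rewrite leqNgt; apply/negP => h; have := leq_mul (leqnn ka) h.
    move: h1 ka1; clearbody ka j r; clear; move: (E * L * r)%N => z; nia.
  have -> : ((b + E * r.+1) * L = b * L + E * L + E * L * r)%N.
    by rewrite mulnDl mulnS mulnDl (mulnAC E r L) addnA.
  by move: h2; rewrite /j; move: (E * L * r)%N => z; clear; lia.
by split => [a aN|a b' aN bN]; [apply: fA1; exact: leq_trans hB |
  apply: fA2; exact: leq_trans hB].
Qed.

End fan_and_lag.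

(** * The tower of levels *)

(** [ls m] lists the first [m] elements chosen; [P m f] only looks at the values of [f] below [m],
    so it can be decided from this list. *)
Lemma strong_choice (T : Type) (x0 : T) (P : nat -> (nat -> T) -> T -> Prop) :
  (forall m f, exists x, P m f x) ->
  (forall m f g x, (forall i, (i < m)%N -> f i = g i) -> P m f x -> P m g x) ->
  exists f, forall m, P m f (f m).
Proof.
move=> hP hext; pose nx m f := sval (cid (hP m f)).
have nxP m f : P m f (nx m f) by rewrite /nx; case: cid.
pose ls := fix ls m := if m is m'.+1 then rcons (ls m') (nx m' (nth x0 (ls m')))
  else [::].
have sls m : size (ls m) = m by elim: m => //= m IH; rewrite size_rcons IH.
pose f m := nx m (nth x0 (ls m)).
have fE m i : (i < m)%N -> nth x0 (ls m) i = f i.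
  elim: m => // m IH; rewrite ltnS leq_eqVlt => /predU1P[->|im] /=.
    by rewrite nth_rcons sls ltnn eqxx.
  by rewrite nth_rcons sls im IH.
by exists f => m; apply: hext (nxP m _) => i im; exact: fE.
Qed.

(* [lv_ret] is the chain of intervals followed for returning from [lv_fan] to the
   base interval, so that a block of this level lasts [lv_dur] steps. *)
Record level (R : realType) := Level {
  lv_marker : R * R;
  lv_fan : nat -> R * R;
  lv_target : R * R;
  lv_ret : seq (R * R) }.

Definition lv_dur (R : realType) (l : level R) := (size (lv_ret l)).+1.

Section tower.
Context {R : realType}.
Variables (t : R -> R) (K : R * R).
Implicit Types (f : nat -> level R) (l : level R).

(** For [m > 0], the inverse of the probability of a level at least [m]. The factor 2 makes these
    probabilities at least halve from one level to the next; the other term bounds by [1 / 2 ^ m.+2]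
    the contribution of level [m] to the mean duration of a block. *)
Fixpoint lv_period f m : nat :=
  (2 * (if m is m'.+1 then lv_period f m' else 1) + 2 ^ m.+2 * lv_dur (f m))%N.

(** A common bound for the durations below level [m]: the rest of such a block and fewer than
    [lv_period f m] further ones last less than [lv_digits f m] steps. *)
Definition dur_below f m : nat := (\sum_(i < m) lv_dur (f i))%N.

(* Level [m] carries [lv_digits f m] letters of an alphabet of size [2 ^ m]. *)
Definition lv_digits f m : nat := (lv_period f m * dur_below f m).+1.

Definition lv_card f m : nat := ((2 ^ m) ^ lv_digits f m)%N.

Definition lv_itv f m (J : R * R) : Prop :=
  List.In J (lv_ret (f m)) \/ exists2 a, (a < lv_card f m)%N & J = lv_fan (f m) a.

Definition is_tower f : Prop := forall m,
  [/\ unit_itv (lv_target (f m)),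
      chain t (lv_target (f m)) (lv_ret (f m)) K,
      itv_sub (lv_marker (f m)) K,
      is_fan t (lv_card f m) (lv_marker (f m)) (lv_fan (f m)) (lv_target (f m)) &
      forall i J x, (i < m)%N -> lv_itv f i J -> itv_in x (lv_marker (f m)) ->
        ~ record t J x].

Lemma avoid_records (Ks : seq (R * R)) A :
  (forall J A, unit_itv A -> exists A', [/\ unit_itv A', itv_sub A' A &
     forall x, itv_in x A' -> ~ record t J x]) ->
  unit_itv A ->
  exists A', [/\ unit_itv A', itv_sub A' A &
     forall J x, List.In J Ks -> itv_in x A' -> ~ record t J x].
Proof.
move=> h; elim: Ks A => [|J Ks IH] A uA.
  by exists A; split => //; exact: itv_sub_refl.
have [A' [uA' AA' hA']] := IH A uA.
have [A'' [uA'' AA'' hA'']] := h J A' uA'.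
exists A''; split => //; first exact: itv_sub_trans AA'' AA'.
move=> J' x /= [<-|J'K] xA''; first exact: hA''.
by apply: hA' => //; exact: itv_in_sub xA'' AA''.
Qed.

Lemma eq_lv_period f g m : (forall i, (i <= m)%N -> f i = g i) ->
  lv_period f m = lv_period g m.
Proof.
elim: m => [|m IH] fg; rewrite /= fg// IH// => i im.
by apply: fg; exact: leqW.
Qed.

Lemma eq_dur_below f g m : (forall i, (i < m)%N -> f i = g i) ->
  dur_below f m = dur_below g m.
Proof. by move=> fg; apply: eq_bigr => i _; rewrite fg. Qed.

Lemma eq_lv_card f g m : (forall i, (i <= m)%N -> f i = g i) ->
  lv_card f m = lv_card g m.
Proof.
move=> fg; rewrite /lv_card /lv_digits (eq_lv_period fg) (@eq_dur_below f g m)//.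
by move=> i im; apply: fg; exact: ltnW.
Qed.

(** The marker is chosen first, off the records of the finitely many intervals of lower levels, then
    the fan together with its way back. With [b = 2 * prev], [E = 2 ^ m.+2] and [L = dur_below f m],
    the exponent in the last hypothesis is exactly [lv_digits f m]. *)
Lemma tower_exists :
  (forall J A, unit_itv A -> exists A', [/\ unit_itv A', itv_sub A' A &
     forall x, itv_in x A' -> ~ record t J x]) ->
  unit_itv K ->
  (forall (Q : R * R) (k L b E : nat), unit_itv Q -> itv_sub Q K -> (0 < k)%N ->
    exists A v us, [/\ unit_itv A, chain t A us K &
      is_fan t (k ^ ((b + E * (size us).+1) * L).+1) Q v A]) ->
  exists f, is_tower f.
Proof.
move=> havoid uK hfan.
pose prev m f : nat := if m is m'.+1 then lv_period f m' else 1%N.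
pose P m f l :=
  [/\ unit_itv (lv_target l),
      chain t (lv_target l) (lv_ret l) K,
      itv_sub (lv_marker l) K,
      is_fan t ((2 ^ m) ^ ((2 * prev m f + 2 ^ m.+2 * lv_dur l) * dur_below f m).+1)
        (lv_marker l) (lv_fan l) (lv_target l) &
      forall i J x, (i < m)%N -> lv_itv f i J -> itv_in x (lv_marker l) ->
        ~ record t J x].
have [||f fP] := @strong_choice _ (Level (0, 0) (fun=> (0, 0)) (0, 0) [::]) P.
- move=> m f.
  pose Js i := lv_ret (f i) ++ [seq lv_fan (f i) a | a <- iota 0 (lv_card f i)].
  pose Ks := flatten [seq Js i | i <- iota 0 m].
  have [Q [uQ QK hQ]] := avoid_records Ks havoid uK.
  have [|A [v [us [uA cus fA]]]] :=
    hfan Q (2 ^ m)%N (dur_below f m) (2 * prev m f)%N (2 ^ m.+2)%N uQ QK.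
    by rewrite expn_gt0.
  exists (Level Q v A us); split => // i J x im hJ.
  apply: hQ; rewrite /Ks; clear -im hJ; elim: m im => // m IH.
  rewrite ltnS leq_eqVlt -[m.+1]addn1 iotaD map_cat flatten_cat add0n => h.
  apply/List.in_or_app; case/predU1P: h => [<-|/IH]; last by left.
  right; rewrite /= cats0 /Js; apply/List.in_or_app.
  case: hJ => [|[a ai ->]]; [by left | right].
  rewrite -[X in lv_fan _ X]add0n; move: (lv_card f i) 0%N a ai.
  elim=> // b IHb s [|a]; first by left; rewrite addn0.
  by rewrite ltnS addnS -addSn => /(IHb s.+1); right.
- move=> m f g l fg [h1 h2 h3 h4 h5]; split => //.
    suff <- : prev m f = prev m g by rewrite -(eq_dur_below fg).
    case: m fg {h4 h5} => //= m fg; apply: eq_lv_period => i im; exact: fg.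
  move=> i J x im hJ; apply: (h5 i) => //.
  have e : lv_card f i = lv_card g i.
    by apply: eq_lv_card => j ji; apply: fg; exact: leq_ltn_trans im.
  by move: hJ; rewrite /lv_itv e fg.
exists f => m; have [h1 h2 h3 h4 h5] := fP m; split => //.
by rewrite /lv_card /lv_digits; case: (m) h4.
Qed.

Lemma lv_period_ge f m : (2 ^ m.+2 * lv_dur (f m) <= lv_period f m)%N.
Proof. by case: m => [|m]; rewrite leq_addl. Qed.

Lemma lv_period_double f m : (2 * lv_period f m <= lv_period f m.+1)%N.
Proof. by rewrite leq_addr. Qed.

Lemma lv_period_gt0 f m : (0 < lv_period f m)%N.
Proof.
by apply: leq_trans (lv_period_ge f m); rewrite muln_gt0 expn_gt0.
Qed.

Lemma dur_below_ge f m i : (i < m)%N -> (lv_dur (f i) <= dur_below f m)%N.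
Proof.
by move=> im; rewrite /dur_below (bigD1 (Ordinal im))//= leq_addr.
Qed.

End tower.

(** * A Bernoulli system carried by Lebesgue measure *)

Section affine_lebesgue.
Context {R : realType}.
Local Notation leb := (@lebesgue_measure R).

Lemma measurable_affine (a b : R) :
  measurable_fun setT ((fun x => a * x + b) : measurableTypeR R -> measurableTypeR R).
Proof.
apply: measurable_funD; last exact: measurable_cst.
by apply: measurable_funM; [exact: measurable_cst | exact: measurable_id].
Qed.

Lemma lebesgue_affine (a b : R) (A : set (measurableTypeR R)) :
  0 < a -> measurable A ->
  (a%:E * leb ((fun x : measurableTypeR R => (a * x + b)%R : measurableTypeR R) @^-1` A) = leb A)%E.
Proof.
move=> a0 mA; pose r := NngNum (ltW a0).
have mf := measurable_affine a b.
apply/esym.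
apply: (lebesgue_measure_unique (mu := mscale r (pushforward leb
  (fun x : measurableTypeR R => a * x + b : measurableTypeR R)))) => // _ [[u v]] _ <-.
apply: (@etrans _ _ (a%:E * leb (`]((u - b) / a)%R, ((v - b) / a)%R]%classic : set R))%E); last first.
  congr (_ * leb _)%E; apply/seteqP.
  split => x /=; rewrite !in_itv/= => /andP[h1 h2]; apply/andP; split.
  - by move: h1; rewrite ltr_pdivrMr//; lra.
  - by move: h2; rewrite ler_pdivlMr//; lra.
  - by rewrite ltr_pdivrMr//; lra.
  - by rewrite ler_pdivlMr//; lra.
rewrite !lebesgue_measure_itv/= !lte_fin ltr_pM2r ?invr_gt0// ltrD2r.
case: ifPn => _; last by rewrite mule0.
rewrite -!EFinD -EFinM; congr EFin; field.
by rewrite gt_eqF.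
Qed.

End affine_lebesgue.

Lemma mnormalizeE {d} {T : measurableType d} {R : realType}
    (mu : {measure set T -> \bar R}) (P : probability T R) (x : R) A :
  mu setT = x%:E -> 0 < x -> mnormalize mu P A = (mu A * x^-1%:E)%E.
Proof. by move=> h x0; rewrite /mnormalize h eqe gt_eqF. Qed.

(** A one-sided Bernoulli shift, given by its first letter [(lev, sym)] and its shift map [E]: [sym]
    is uniform given [lev], and [E u] is independent of both, with law [P] again. *)
Definition bernoulli_system {d} {Y : measurableType d} {R : realType}
    (P : probability Y R) (lev sym : Y -> nat) (E : Y -> Y)
    (p : nat -> R) (N : nat -> nat) : Prop :=
  [/\ forall u, (sym u < N (lev u))%N,
      forall m a A, measurable A ->
        measurable [set u | [/\ lev u = m, sym u = a & A (E u)]] &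
      forall m a A, measurable A -> (a < N m)%N ->
        P [set u | [/\ lev u = m, sym u = a & A (E u)]] =
        ((p m / (N m)%:R)%:E * P A)%E].

Section bernoulli_exists.
Context {R : realType}.
Variables (s : nat -> R) (N : nat -> nat).
Hypothesis s0 : s 0%N = 1.
Hypothesis s_gt0 : forall m, 0 < s m.
Hypothesis s_decr : forall m, s m.+1 < s m.
Hypothesis s_cvg0 : forall e : R, 0 < e -> exists m, s m < e.
Hypothesis N_gt0 : forall m, (0 < N m)%N.
Local Notation leb := (@lebesgue_measure R).
Local Notation I := (`[0, 1[%classic : set (measurableTypeR R)).

Let p m := s m - s m.+1.

Let p_gt0 m : 0 < p m. Proof. by rewrite subr_gt0. Qed.

Let k_gt0 m : 0 < (N m)%:R / p m.
Proof. by rewrite divr_gt0// ltr0n. Qed.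

(* The affine map of the [a]-th of the [N m] cells of level [m] onto [0, 1[. *)
Let psi (ma : nat * nat) (u : measurableTypeR R) : measurableTypeR R :=
  (N ma.1)%:R / p ma.1 * u + (- ((1 - s ma.1) * (N ma.1)%:R / p ma.1) - ma.2%:R).

Let in_cell (ma : nat * nat) u := (ma.2 < N ma.1)%N /\ I (psi ma u).

(** Outside [0,1[, a null set for the law used below, the cell is [(0, 0)] by default; whence the
    additional term in [fiberE]. *)
Let w u := xget (0, 0)%N [set ma | in_cell ma u].

Lemma cell_bounds ma u : in_cell ma u ->
  1 - s ma.1 <= u < 1 - s ma.1.+1 /\
  ma.2%:R <= (N ma.1)%:R * (u - (1 - s ma.1)) / p ma.1 < ma.2.+1%:R.
Proof.
case: ma => m a [/= aN]; rewrite /psi/= in_itv/= => /andP[h1 h2].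
have pm := p_gt0 m; have Nm : 0 < (N m)%:R :> R by rewrite ltr0n.
set v := (N m)%:R * (u - (1 - s m)) / p m.
have vE : (N m)%:R / p m * u + (- ((1 - s m) * (N m)%:R / p m) - a%:R) = v - a%:R.
  by rewrite /v; field; rewrite gt_eqF.
rewrite vE in h1 h2.
have v1 : a%:R <= v by lra.
have v2 : v < a.+1%:R by rewrite -natr1; lra.
split; last by rewrite v1.
have a0 : 0 <= a%:R :> R by [].
have aN' : a.+1%:R <= (N m)%:R :> R by rewrite ler_nat.
have v0 : 0 <= v by lra.
have vN : v < (N m)%:R by lra.
move: v0 vN; rewrite /v => v0 vN.
apply/andP; split.
  by move: v0; rewrite pmulr_lge0 ?invr_gt0// pmulr_rge0// subr_ge0.
move: vN; rewrite ltr_pdivrMr// ltr_pM2l// /p; lra.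
Qed.

Let s_mono m n : (m <= n)%N -> s n <= s m.
Proof.
move=> /subnK <-; elim: (n - m)%N => // k IH.
by rewrite addSn; apply: le_trans IH; exact: ltW.
Qed.

Lemma cell_unique ma ma' u : in_cell ma u -> in_cell ma' u -> ma = ma'.
Proof.
move=> /cell_bounds[/andP[h1 h2] /andP[h3 h4]] /cell_bounds[/andP[g1 g2] /andP[g3 g4]].
case: ma ma' h1 h2 h3 h4 g1 g2 g3 g4 => [m a] [m' a'] /= h1 h2 h3 h4 g1 g2 g3 g4.
have mm' : m = m'.
  apply/eqP; rewrite eqn_leq; apply/andP; split; rewrite leqNgt; apply/negP => /s_mono; lra.
rewrite -{m'}mm' in g1 g2 g3 g4 *; congr pair.
apply/eqP; rewrite eqn_leq; apply/andP; split; rewrite -ltnS -(ltr_nat R).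
  exact: le_lt_trans h3 g4.
exact: le_lt_trans g3 h4.
Qed.

Lemma cell_exists u : I u -> exists ma, in_cell ma u.
Proof.
rewrite /= in_itv/= => /andP[u0 u1].
have [|m hm] := s_cvg0 (_ : 0 < 1 - u); first by rewrite subr_gt0.
have ex : exists m, u < 1 - s m.
  by exists m; lra.
case: (ex_minnP ex) => -[|n]; first by rewrite s0; lra.
move=> un nmin.
have nu : 1 - s n <= u.
  by rewrite leNgt; apply/negP => /nmin; rewrite ltnn.
have pn := p_gt0 n; have Nn : 0 < (N n)%:R :> R by rewrite ltr0n.
set v := (N n)%:R * (u - (1 - s n)) / p n.
have v0 : 0 <= v by rewrite divr_ge0 ?mulr_ge0 ?subr_ge0// ltW.
have vN : v < (N n)%:R.
  rewrite ltr_pdivrMr// ltr_pM2l// /p; lra.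
have /andP[t1 t2] := truncn_itv v0.
exists (n, Num.truncn v); split => /=; first by rewrite truncn_lt_nat.
rewrite in_itv/= /psi/=.
have -> : (N n)%:R / p n * u + (- ((1 - s n) * (N n)%:R / p n) - (Num.truncn v)%:R)
   = v - (Num.truncn v)%:R.
  by rewrite /v; field; rewrite gt_eqF.
by rewrite -natr1 in t2; apply/andP; split; lra.
Qed.

Lemma in_cell_unit ma u : in_cell ma u -> I u.
Proof.
move=> /cell_bounds[/andP[h1 h2] _]; rewrite /= in_itv/=.
have := s_mono (leq0n ma.1); have := s_gt0 ma.1.+1; rewrite s0 => ? ?.
by apply/andP; split; lra.
Qed.

Lemma w_cell u : I u -> in_cell (w u) u.
Proof.
by move=> /cell_exists h; apply: (@xgetPex _ _ [set ma | in_cell ma u]).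
Qed.

Lemma w_out u : ~ I u -> w u = (0, 0)%N.
Proof.
move=> nI; rewrite /w; case: xgetP => // -[m a] _ /= h.
by case: nI; exact: in_cell_unit h.
Qed.

Let E u := psi (w u) u.

Lemma fiberE m a A : (a < N m)%N ->
  [set u | [/\ (w u).1 = m, (w u).2 = a & A (E u)]] =
  psi (m, a) @^-1` (A `&` I) `|`
    (if (m, a) == (0, 0)%N then ~` I `&` psi (0, 0)%N @^-1` A else set0).
Proof.
move=> aN; apply/seteqP; split => u /=.
  move=> [wm wa AE]; have [Iu|nIu] := pselect (I u).
    left; have [_ h] := w_cell Iu; move: AE h; rewrite /E.
    by rewrite [w u]surjective_pairing wm wa.
  right; move: wm wa AE; rewrite /E (w_out nIu) /= => <- <-.
  by rewrite eqxx.
move=> [[AE h]|].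
  have c : in_cell (m, a) u by [].
  have := cell_unique (w_cell (in_cell_unit c)) c.
  by rewrite /E => ->.
case: ifPn => // /eqP[-> ->] [nIu AE].
by rewrite /E w_out.
Qed.

Lemma measurable_psi ma : measurable_fun setT (psi ma).
Proof. exact: measurable_affine. Qed.

Lemma measurable_psi_pre ma A : measurable A -> measurable (psi ma @^-1` A).
Proof.
by move=> mA; rewrite -[X in measurable X]setTI; exact: measurable_psi.
Qed.

(** [E] is an expanding map of [0,1[ with full affine branches: the interval of length [p m] from
    [1 - s m] is cut into [N m] equal cells, each of which is sent onto [0,1[ with slope
    [N m / p m]. *)
Lemma bernoulli_exists : exists (P : probability (measurableTypeR R) R) lev sym E,
  bernoulli_system P lev sym E p N.
Proof.
have mI : measurable I by exact: measurable_itv.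
pose P : probability (measurableTypeR R) R := mnormalize (mrestr leb mI) (\d_ (0 : measurableTypeR R)).
have lI : leb I = 1%:E by rewrite lebesgue_measure_itv/= lte_fin ltr01 oppr0 adde0.
have PE A : measurable A -> P A = leb (A `&` I).
  move=> mA; have h : mrestr leb mI setT = 1%:E by rewrite /mrestr setTI lI.
  by rewrite [LHS](mnormalizeE _ _ h (ltr01)) invr1 mule1.
exists P, (fun u => (w u).1), (fun u => (w u).2), E; split.
- move=> u; have [Iu|nIu] := pselect (I u); first by case: (w_cell Iu).
  by rewrite (w_out nIu).
- move=> m a A mA; have [aN|Na] := ltnP a (N m); last first.
    rewrite (_ : mkset _ = set0) //; apply/seteqP; split => // u /= [um ua _].
    have [Iu|nIu] := pselect (I u).
      by have [] := w_cell Iu; rewrite um ua ltnNge Na.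
    by move: Na; rewrite -um -ua (w_out nIu)/= leqNgt N_gt0.
  rewrite fiberE//; apply: measurableU.
    by apply: measurable_psi_pre; exact: measurableI.
  case: ifPn => // _; apply: measurableI; first exact: measurableC.
  exact: measurable_psi_pre.
move=> m a A mA aN.
have mS : measurable (psi (m, a) @^-1` (A `&` I)).
  by apply: measurable_psi_pre; exact: measurableI.
have FI : [set u | [/\ (w u).1 = m, (w u).2 = a & A (E u)]] `&` I =
    psi (m, a) @^-1` (A `&` I).
  rewrite fiberE//; apply/seteqP; split => u.
    by case=> -[//|]; case: ifPn => // _ [].
  move=> h; split; first by left.
  by apply: (@in_cell_unit (m, a)); split => //; case: h.
have mF : measurable [set u | [/\ (w u).1 = m, (w u).2 = a & A (E u)]].
  rewrite fiberE//; apply: measurableU => //.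
  case: ifPn => // _; apply: measurableI; first exact: measurableC.
  exact: measurable_psi_pre.
rewrite [LHS](PE _ mF) FI [in RHS]PE//.
rewrite -(lebesgue_affine (- ((1 - s m) * (N m)%:R / p m) - a%:R) (k_gt0 m)
  (measurableI _ _ mA mI)).
rewrite muleA -EFinM (_ : _ * _ = 1) ?mul1e//.
by rewrite mulf_div [X in _ / X]mulrC divff// mulf_neq0 ?gt_eqF ?ltr0n.
Qed.

End bernoulli_exists.

(** * Coding sequences of choices by points *)

Section coding.
Context {R : realType} {Y : Type}.
Variables (t : R -> R) (K : R * R) (f : nat -> level R).
Hypothesis ct : continuous t.
Hypothesis K12 : K.1 <= K.2.
Hypothesis tw : is_tower t K f.
Variables (lev sym : Y -> nat) (E : Y -> Y).
Hypothesis symN : forall u, (sym u < lv_card f (lev u))%N.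

Definition block m a := lv_fan (f m) a :: lv_ret (f m).

Lemma chain_block m a : (a < lv_card f m)%N -> chain t K (block m a) K.
Proof.
move=> aN; have [uA cA QK [fan1 _] _] := tw m; have [rv vQ Av _] := fan1 a aN.
by rewrite /= rv (itv_sub_trans vQ QK) (chain_subl Av cA).
Qed.

Fixpoint approx_code n (u : Y) : R :=
  if n is n'.+1 then pullback t (block (lev u) (sym u)) (approx_code n' (E u))
  else K.1.

Lemma approx_code_in n u : itv_in (approx_code n u) K.
Proof.
elim: n u => [|n IH] u; first by rewrite /itv_in lexx.
exact: (pullback_in ct (chain_block (symN u)) (IH _)).
Qed.

(** Starting from the left end of [K] makes the first step an increase; monotone pullbacks propagate
    it. *)
Lemma approx_code_nondecr u : nondecreasing_seq (approx_code ^~ u).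
Proof.
apply/nondecreasing_seqP => n; elim: n u => [|n IH] u.
  by have /andP[] := approx_code_in 1 u.
exact: (pullback_mono ct (chain_block (symN u)) (approx_code_in _ _)
  (approx_code_in _ _) (IH _)).
Qed.

Definition code u : R := limn (approx_code ^~ u).

Lemma approx_code_cvg u : approx_code ^~ u @ \oo --> code u.
Proof.
apply: nondecreasing_is_cvgn; first exact: approx_code_nondecr.
by exists K.2 => _ [n _ <-]; have /andP[] := approx_code_in n u.
Qed.

Lemma code_in u : itv_in (code u) K.
Proof.
have c := @approx_code_cvg u.
apply/andP; split.
  by apply: limr_ge; [apply/cvg_ex; exists (code u) | apply: nearW => n;
    have /andP[] := approx_code_in n u].
by apply: limr_le; [apply/cvg_ex; exists (code u) | apply: nearW => n;
  have /andP[] := approx_code_in n u].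
Qed.

Lemma continuous_iter j : continuous (iter j t).
Proof.
elim: j => [|j IH] x; first exact: cvg_id.
by apply: (@continuous_comp _ _ _ (iter j t) t); [exact: IH | exact: ct].
Qed.

(** Pullbacks are monotone but need not be continuous, so the limit is taken on the other side,
    through the continuous [iter j t]. *)
Lemma iter_code_cvg u j : (j <= lv_dur (f (lev u)))%N ->
  (fun n => pullback t (drop j (block (lev u) (sym u))) (approx_code n (E u)))
    @ \oo --> iter j t (code u).
Proof.
move=> jl; have c := cvg_comp _ _ (cvg_addnl 1) (@approx_code_cvg u).
have : (fun n => iter j t (approx_code n.+1 u)) @ \oo --> iter j t (code u).
  exact: (continuous_cvg _ (@continuous_iter j _) c).
by under eq_fun do
  rewrite (iter_pullback ct (chain_block (symN u)) (approx_code_in _ _) jl).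
Qed.

Lemma iter_code_dur u : iter (lv_dur (f (lev u))) t (code u) = code (E u).
Proof.
apply: (cvg_unique _ (iter_code_cvg (leqnn _))) => //.
rewrite drop_oversize//; exact: approx_code_cvg.
Qed.

Lemma step_code_cvg u :
  (fun n => pullback t (lv_ret (f (lev u))) (approx_code n (E u)))
    @ \oo --> t (code u).
Proof. by have := @iter_code_cvg u 1%N isT; rewrite /= drop0. Qed.

Lemma chain_drop A us B j : chain t A us B -> exists A', chain t A' (drop j us) B.
Proof.
elim: us A j => [|J us IH] A [|j]; [by exists A|by exists A|by exists A|].
by move=> /and3P[_ _ /IH]; exact.
Qed.

Lemma iter_code_record u j : (j < lv_dur (f (lev u)))%N ->
  record t (nth K (block (lev u) (sym u)) j) (iter j t (code u)).
Proof.
move=> jl; apply: (record_closed ct (iter_code_cvg (ltnW jl))) => n.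
have [A' cA'] := chain_drop j (chain_block (symN u)).
move: cA'; rewrite (drop_nth K)// => cA'.
exact: (pullback_record ct cA' (approx_code_in _ _)).
Qed.

Lemma nth_block_itv u j : (j < lv_dur (f (lev u)))%N ->
  lv_itv f (lev u) (nth K (block (lev u) (sym u)) j).
Proof.
case: j => [|j] /= jl; first by right; exists (sym u).
left; rewrite /lv_dur ltnS in jl.
elim: (lv_ret _) j jl => // J us IH [|j] /=; first by left.
by rewrite ltnS => /IH; right.
Qed.

Lemma iter_code_avoid u j m : (lev u < m)%N -> (j < lv_dur (f (lev u)))%N ->
  ~ itv_in (iter j t (code u)) (lv_marker (f m)).
Proof.
move=> um jl hin; have [_ _ _ _ avoid] := tw m.
exact: (avoid _ _ _ um (nth_block_itv jl) hin (iter_code_record jl)).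
Qed.

(** At the right end of the branch, [t] would exceed the right end of [lv_target], where
    [t (code u)] lies. *)
Lemma code_fan u :
  (lv_fan (f (lev u)) (sym u)).1 <= code u < (lv_fan (f (lev u)) (sym u)).2.
Proof.
have [uA cA QK [fan1 _] _] := tw (lev u).
have [rv vQ Av Alt] := fan1 _ (symN u).
have [/andP[/= h1 h2] _] := @iter_code_record u 0%N isT.
rewrite h1 lt_neqAle h2 andbT; apply/eqP => cE.
have : t (code u) <= (lv_target (f (lev u))).2.
  have c := step_code_cvg; rewrite -(cvg_lim _ (c u))//.
  apply: limr_le; first by apply/cvg_ex; exists (t (code u)); exact: c.
  by apply: nearW => n; have /andP[] := pullback_in ct cA (approx_code_in n (E u)).
by rewrite cE; move: Alt => /=; rewrite ltNge => /negP.
Qed.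

End coding.

(** * The stationary measure of the suspension *)

Section stationary_measure.
Context {d dX : measure_display} {Y : measurableType d} {X : measurableType dX}.
Context {R : realType}.
Variables (P : probability Y R) (lev sym : Y -> nat) (E : Y -> Y).
Variables (p : nat -> R) (N : nat -> nat).
Hypothesis bs : bernoulli_system P lev sym E p N.
Hypothesis N_gt0 : forall m, (0 < N m)%N.
Hypothesis p_gt0 : forall m, 0 < p m.

Lemma measurable_lev_E m A : measurable A ->
  measurable [set u | lev u = m /\ A (E u)].
Proof.
have [symN mS _] := bs; move=> mA.
rewrite (_ : mkset _ = \bigcup_(a in `I_(N m))
    [set u | [/\ lev u = m, sym u = a & A (E u)]]).
  by apply: fin_bigcup_measurable => // a _; exact: mS.
apply/seteqP; split => u /= [].
  by move=> um AE; exists (sym u) => //=; rewrite -um.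
by move=> a _ /= [].
Qed.

Lemma prob_lev_E m A : measurable A ->
  P [set u | lev u = m /\ A (E u)] = ((p m)%:E * P A)%E.
Proof.
have [symN mS pS] := bs; move=> mA.
rewrite (_ : mkset _ = \bigcup_(a in `I_(N m))
    [set u | [/\ lev u = m, sym u = a & A (E u)]]); last first.
  apply/seteqP; split => u /= [].
    by move=> um AE; exists (sym u) => //=; rewrite -um.
  by move=> a _ /= [].
rewrite measure_fin_bigcup//=; last 2 first.
- by move=> a b _ _ [u /= [[_ <- _] [_ <- _]]].
- by move=> a _; exact: mS.
rewrite -fsbig_ord; under eq_bigr do rewrite pS//.
have fP : P A \is a fin_num by exact: fin_num_measure.
rewrite -(fineK fP); under eq_bigr do rewrite -EFinM.
rewrite sumEFin sumr_const card_ord -EFinM; congr EFin.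
by rewrite -[LHS]mulr_natl mulrA (mulrCA _ (p m)) mulfV ?mulr1// pnatr_eq0 -lt0n.
Qed.

Lemma measurable_lev m : measurable [set u | lev u = m].
Proof.
have := @measurable_lev_E m setT measurableT.
by rewrite (_ : mkset _ = [set u | lev u = m])//; apply/seteqP; split => u /= [].
Qed.

Lemma prob_lev m : P [set u | lev u = m] = (p m)%:E.
Proof.
have := @prob_lev_E m setT measurableT; rewrite probability_setT mule1 => <-.
by congr (P _); apply/seteqP; split => u /= [].
Qed.

Lemma prob_lev_series C : measurable C ->
  (\sum_(0 <= i <oo) P ([set u | lev u = i] `&` C))%E = P C.
Proof.
move=> mC; have mlC i : measurable ([set u | lev u = i] `&` C).
  by apply: measurableI => //; exact: measurable_lev.
rewrite -(measure_semi_bigcup P mlC).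
- congr (P _); apply/seteqP; split => [u [i _ []]//|u Cu].
  by exists (lev u).
- by move=> i j _ _ [u [[/= <- _] [/= <- _]]].
- exact: bigcup_measurable.
Qed.

Variables (T : X -> X) (h : Y -> X) (dur : nat -> nat) (L : R) (x0 : X).
Hypothesis mT : measurable_fun setT T.
Hypothesis mh : measurable_fun setT h.
Hypothesis hdur : forall u, iter (dur (lev u)) T (h u) = h (E u).
Hypothesis L_gt0 : 0 < L.
Hypothesis L_series : (\sum_(0 <= i <oo) (p i * (dur i)%:R)%:E)%E = L%:E.

Let visit i j A : set Y := [set u | lev u = i] `&` (iter j T \o h) @^-1` A.

Lemma visit_measure i j : exists m : {measure set X -> \bar R},
  forall A, m A = P (visit i j A).
Proof.
have mfh : measurable_fun setT (iter j T \o h).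
  by apply: measurableT_comp => //; exact: measurable_iter.
unshelve eexists.
  exact: (pushforward (mrestr P (measurable_lev i)) (iter j T \o h)).
by move=> A; rewrite /= /pushforward /mrestr /visit setIC.
Qed.

Lemma tower_measure : exists m : {measure set X -> \bar R},
  forall A, m A = (\sum_(0 <= i <oo) \sum_(j < dur i) P (visit i j A))%E.
Proof.
have /choice[m_ m_E] i : exists m : nat -> {measure set X -> \bar R},
    forall j A, m j A = P (visit i j A).
  by have /choice[m mE] := visit_measure i; exists m.
exists (mseries (fun i => msum (m_ i) (dur i)) 0) => A.
rewrite /= /mseries; apply: eq_eseriesr => i _.
by rewrite /msum; apply: eq_bigr => j _; rewrite m_E.
Qed.

(** Applying [T] moves every floor [j] up by one: the bottom floors are exchanged for the tops
    [j = dur i], which are given by [h (E u)]. As [E] preserves [P], both have the mass of the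
    preimage of [A] under [h], which is finite and cancels. *)
Lemma stationary_measure_exists : exists mu : probability X R,
  invariant_measure T mu /\
  forall A M, measurable A ->
    (L^-1%:E * \sum_(i < M) \sum_(j < dur i) P (visit i j A) <= mu A)%E.
Proof.
have [m mE] := tower_measure.
have mT1 : m setT = L%:E.
  rewrite mE -L_series; apply: eq_eseriesr => i _.
  under eq_bigr do rewrite /visit preimage_setT setIT prob_lev.
  by rewrite sumEFin sumr_const card_ord mulr_natr.
have ge0 i A : (0 <= \sum_(j < dur i) P (visit i j A))%E by exact: sume_ge0.
pose mu : probability X R := mnormalize m (\d_ x0).
have muE A : mu A = (m A * L^-1%:E)%E by exact: mnormalizeE.
exists mu; split => [A mA|A M mA].
  rewrite !muE; congr (_ * _)%E; rewrite !mE.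
  have mhA : measurable (h @^-1` A).
    by rewrite -[X in measurable X]setTI; exact: mh.
  have step i : (P (visit i 0%N A) + \sum_(j < dur i) P (visit i j (T @^-1` A)) =
      (p i)%:E * P (h @^-1` A) + \sum_(j < dur i) P (visit i j A))%E.
    rewrite -prob_lev_E// (_ : [set u | _] = visit i (dur i) A); last first.
      by apply/seteqP; split => u [/= ui hA]; split => //=; move: hA; rewrite -ui hdur.
    by rewrite [RHS]addeC -(big_ord_recr _ (fun j => P (visit i j A)))/= big_ord_recl/=.
  have := eq_eseriesr (fun i _ => step i) (P := xpredT) (N := 0%N).
  rewrite !nneseriesD//; last by move=> i _ _; rewrite mule_ge0// lee_fin ltW.
  rewrite (prob_lev_series mhA).
  have -> : (\sum_(0 <= i <oo) (p i)%:E * P (h @^-1` A) = P (h @^-1` A))%E.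
    have fP : P (h @^-1` A) \is a fin_num by exact: fin_num_measure.
    rewrite -[X in _ = X]fineK//; under eq_eseriesr do rewrite -(fineK fP) muleC.
    rewrite nneseriesZl; last by move=> i _; rewrite lee_fin ltW.
    rewrite (_ : limn _ = 1%:E) ?mule1//.
    rewrite -(probability_setT P) -(prob_lev_series measurableT); apply: eq_eseriesr => i _.
    by rewrite setIT prob_lev.
  have fP : P (h @^-1` A) \is a fin_num by exact: fin_num_measure.
  by move=> /(congr1 (fun x => x - P (h @^-1` A))%E); rewrite !(addeC (P _)) !addeK.
rewrite muE muleC lee_pmul2r// ?lte_fin ?invr_gt0// mE.
rewrite -(big_mkord xpredT (fun i => \sum_(j < dur i) P (visit i j A))%E).
by apply: nneseries_lim_ge => i _ _; exact: ge0.
Qed.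

End stationary_measure.

(** * Digits of a choice, and the wait for a block of level [m] *)

Definition digit (q d a : nat) : nat := ((a %/ q ^ d) %% q)%N.

Lemma digit_lt q d a : (0 < q)%N -> (digit q d a < q)%N.
Proof. by move=> q0; rewrite ltn_mod. Qed.

Lemma digit_modn q B d a : (d < B)%N -> digit q d (a %% q ^ B) = digit q d a.
Proof.
move=> dB; have -> : (q ^ B = q ^ (B - d) * q ^ d)%N.
  by rewrite -expnD subnK// ltnW.
by rewrite /digit -modn_divl modn_dvdm// dvdn_exp// subn_gt0.
Qed.

(** Adding [c * q ^ d] modulo [q ^ B], with [c] congruent to [l' - l] modulo [q], is injective and
    turns digit [d] from [l] into [l']. Carries only reach higher digits, so the lower ones, all
    that [Q] sees, are kept. *)
Lemma digit_card_sym (q B d l l' : nat) (Q : pred nat) :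
  (d < B)%N -> (l < q)%N -> (l' < q)%N ->
  #|[set a : 'I_(q ^ B) | (digit q d a == l) && Q (a %% q ^ d)%N]%SET| =
  #|[set a : 'I_(q ^ B) | (digit q d a == l') && Q (a %% q ^ d)%N]%SET|.
Proof.
wlog suff le : l l' / (d < B)%N -> (l < q)%N -> (l' < q)%N ->
  (#|[set a : 'I_(q ^ B) | (digit q d a == l) && Q (a %% q ^ d)%N]%SET| <=
   #|[set a : 'I_(q ^ B) | (digit q d a == l') && Q (a %% q ^ d)%N]%SET|)%N.
  by move=> dB lq lq'; apply/eqP; rewrite eqn_leq !le.
move=> dB lq lq'; have q0 : (0 < q)%N by exact: leq_ltn_trans lq.
have N0 : (0 < q ^ B)%N by rewrite expn_gt0 q0.
pose c := (l' + (q - l))%N.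
pose g (a : 'I_(q ^ B)) : 'I_(q ^ B) := Ordinal (ltn_pmod (a + c * q ^ d) N0).
have gI : injective g.
  move=> a b /(congr1 val)/= /eqP; rewrite eqn_modDr => /eqP.
  by rewrite !modn_small// => /val_inj.
rewrite -(card_imset _ gI); apply/subset_leq_card/fintype.subsetP => _ /imsetP[a + ->].
rewrite !inE => /andP[/eqP al Qa]; apply/andP; split.
  rewrite /= digit_modn// /digit addnC divnMDl ?expn_gt0 ?q0// addnC.
  rewrite -modnDml -/(digit q d a) al /c.
  by rewrite addnCA subnKC ?(ltnW lq)// modnDr modn_small.
by rewrite /= modn_dvdm ?dvdn_exp2l ?(ltnW dB)// addnC modnMDl.
Qed.

Section first_event.
Context {d : measure_display} {Y : measurableType d} {R : realType}.
Variables (P : probability Y R) (lev sym : Y -> nat) (E : Y -> Y).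
Variables (p : nat -> R) (N : nat -> nat).
Hypothesis bs : bernoulli_system P lev sym E p N.
Hypothesis N_gt0 : forall m, (0 < N m)%N.
Hypothesis p_gt0 : forall m, 0 < p m.
Variables (dur : nat -> nat) (m : nat).

(* Within fewer than [b] blocks of level below [m], of total duration [e], there
   comes a block of level [m], and the state at its start lies in [S]. *)
Fixpoint event b e (S : set Y) : set Y :=
  if b is b'.+1 then
    [set v | [/\ lev v = m, e = 0%N & S v]] `|`
    [set v | [/\ (lev v < m)%N, (dur (lev v) <= e)%N &
                 event b' (e - dur (lev v))%N S (E v)]]
  else set0.

Fixpoint event_prob b e : R :=
  if b is b'.+1 then
    (e == 0%N)%:R + \sum_(i < m | (dur i <= e)%N) p i * event_prob b' (e - dur i)%N
  else 0.

Lemma event_unique b e e' S S' v : event b e S v -> event b e' S' v -> e = e'.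
Proof.
elim: b e e' v => // b IH e e' v /= [[vm -> _]|[vm le h]] [[vm' -> _]|[vm' le' h']]//.
- by rewrite vm ltnn in vm'.
- by rewrite vm' ltnn in vm.
by rewrite -(subnK le) -(subnK le') (IH _ _ _ h h').
Qed.

Let later b e S i : set Y :=
  if (dur i <= e)%N then event b (e - dur i)%N S else set0.

Lemma event_now e S : S `<=` [set u | lev u = m] ->
  [set v | [/\ lev v = m, e = 0%N & S v]] = if e == 0%N then S else set0.
Proof.
move=> Sm; case: eqVneq => [->|/eqP e0]; apply/seteqP; split => v //=.
- by case.
- by move=> Sv; split => //; exact: Sm.
- by move=> [_ /e0].
Qed.

Lemma event_later b e S :
  [set v | [/\ (lev v < m)%N, (dur (lev v) <= e)%N &
               event b (e - dur (lev v))%N S (E v)]] =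
  \bigcup_(i in `I_m) [set v | lev v = i /\ later b e S i (E v)].
Proof.
apply/seteqP; split => v /=.
  by move=> [vm le h]; exists (lev v) => //; split => //; rewrite /later le.
by move=> [i /= im [vi]]; rewrite /later -vi; case: ifP => // le h; rewrite vi im -vi.
Qed.

Lemma measurable_event b e S : measurable S -> S `<=` [set u | lev u = m] ->
  measurable (event b e S).
Proof.
move=> mS Sm; elim: b e => [|b IH] e /=; first exact: measurable0.
apply: measurableU; first by rewrite event_now//; case: ifP.
rewrite event_later; apply: fin_bigcup_measurable; first exact: finite_II.
by move=> i _; apply: (measurable_lev_E bs); rewrite /later; case: ifP.
Qed.

Lemma prob_event b e S : measurable S -> S `<=` [set u | lev u = m] ->
  P (event b e S) = ((event_prob b e)%:E * P S)%E.
Proof.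
move=> mS Sm; elim: b e => [|b IH] e /=; first by rewrite measure0 mul0e.
have fS : P S \is a fin_num by exact: fin_num_measure.
have ml i : measurable (later b e S i).
  by rewrite /later; case: ifP => // _; exact: measurable_event.
have mlE i : measurable [set v | lev v = i /\ later b e S i (E v)].
  exact: (measurable_lev_E bs).
rewrite event_later event_now// measureU; first last.
- apply/seteqP; split => // v /= [+ [i /= im [vi _]]].
  by case: ifP => // _ /Sm /= vm; move: im; rewrite -vi vm ltnn.
- by apply: fin_bigcup_measurable => //; exact: finite_II.
- by case: ifP.
rewrite measure_fin_bigcup; [|exact: finite_II| |by []]; last first.
  by move=> i j _ _ [v /= [[<- _] [<- _]]].
rewrite -fsbig_ord (eq_bigr (fun i : 'I_m => (p i)%:E * P (later b e S i))%E);
  last by move=> i _; exact: (prob_lev_E bs N_gt0).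
rewrite EFinD ge0_muleDl ?lee_fin//; last first.
  apply: sumr_ge0 => i _; rewrite mulr_ge0// ?(ltW (p_gt0 _))//.
  elim: b (e - dur i)%N {IH ml mlE} => // b IH e' /=; rewrite addr_ge0//.
  by apply: sumr_ge0 => k _; rewrite mulr_ge0// ltW.
congr (_ + _)%E.
  by case: eqP => _; rewrite ?mul1e// mul0e measure0.
rewrite -(fineK fS) -EFinM mulr_suml -sumEFin [RHS]big_mkcond/=.
apply: eq_bigr => i _; rewrite /later; case: ifP => _.
  by rewrite IH -(fineK fS)/= -!EFinM mulrA.
by rewrite measure0 mule0.
Qed.

Lemma event_prob_ge0 b e : 0 <= event_prob b e.
Proof.
elim: b e => // b IH e /=; rewrite addr_ge0//.
by apply: sumr_ge0 => k _; rewrite mulr_ge0// ltW.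
Qed.

(** Summing over the delays forgets the durations and leaves the probabilities of [k] consecutive
    blocks of level below [m], for [k < b]. All these delays are below [D], as at most [b - 1]
    blocks of duration at most [L] precede. *)
Lemma sum_event_prob (L : nat) b D : (forall i, (i < m)%N -> (dur i <= L)%N) ->
  (b * L < D + L)%N ->
  \sum_(k < b) (\sum_(i < m) p i) ^+ k <= \sum_(e < D) event_prob b e.
Proof.
move=> durL; set r := \sum_(i < m) p i.
elim: b D => [|b IH] D bD; first by rewrite big_ord0; apply: sumr_ge0.
have bLD : (b * L < D)%N by move: bD; rewrite mulSn addnC ltn_add2r.
rewrite big_ord_recl expr0 /= big_split/=; apply: lerD.
  by rewrite (bigD1 (Ordinal (leq_ltn_trans (leq0n _) bLD)))//= lerDl sumr_ge0.
under eq_bigr do rewrite /bump/= add1n exprS.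
rewrite -mulr_sumr /r mulr_suml; under [leRHS]eq_bigr do rewrite big_mkcond/=.
rewrite exchange_big/=; apply: ler_sum => i _.
have iL := durL i (ltn_ord i).
apply: (@le_trans _ _ (p i * \sum_(e < D - dur i) event_prob b e)).
  rewrite ler_pM2l//; apply: IH.
  by move: bLD iL; clear; move: (b * L)%N (dur i) => x y; lia.
rewrite mulr_sumr -(big_mkord xpredT (fun e => p i * event_prob b e)).
rewrite -(big_mkord xpredT (fun e => if (dur i <= e)%N then
  p i * event_prob b (e - dur i)%N else 0)).
have [Di|iD] := leqP D (dur i).
  move: Di; rewrite -subn_eq0 => /eqP ->; rewrite big_geq//.
  by apply: sumr_ge0 => e _; case: ifP => // _; rewrite mulr_ge0 ?event_prob_ge0// ltW.
rewrite [leRHS](big_cat_nat _ (n := dur i))//=; last exact: ltnW.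
rewrite -[leLHS]add0r; apply: lerD.
  by apply: sumr_ge0 => e _; case: ifP => // _; rewrite mulr_ge0 ?event_prob_ge0// ltW.
rewrite -{2}[dur i]add0n big_addn.
by apply: ler_sum => e _; rewrite leq_addl addnK.
Qed.

End first_event.

(** * The look-ahead partition *)

Section unit_interval_measurability.
Context {R : realType}.

Lemma measurable_fun_I01 {d} {Y : measurableType d} (g : Y -> I01 R) :
  (forall U : set (I01 R), open U -> measurable (g @^-1` U)) ->
  measurable_fun setT g.
Proof.
move=> h; apply: (@measurability _ _ _ _ _ _ (@open (I01 R))) => //.
by move=> _ [U oU <-]; rewrite setTI; exact: h.
Qed.

Lemma measurable_open_I01 (U : set (I01 R)) : open U -> measurable U.
Proof. exact: sub_gen_smallest. Qed.

Lemma continuous_measurable_I01 (g : I01 R -> I01 R) :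
  continuous g -> measurable_fun setT g.
Proof.
move=> /continuousP cg; apply: measurable_fun_I01 => U oU.
by apply: measurable_open_I01; exact: cg.
Qed.

Lemma measurable_lt_I01 (g : I01 R -> R) (c : R) : continuous g ->
  measurable [set x | g x < c].
Proof.
move=> /continuousP cg; apply: measurable_open_I01.
by apply: (cg [set y | y < c]); exact: open_lt.
Qed.

Lemma measurable_gt_I01 (g : I01 R -> R) (c : R) : continuous g ->
  measurable [set x | c < g x].
Proof.
move=> /continuousP cg; apply: measurable_open_I01.
by apply: (cg [set y | c < y]); exact: open_gt.
Qed.

Lemma measurable_toI01 {d} {Y : measurableType d} (g : Y -> R) :
  measurable_fun setT g -> (forall u, 0 <= g u <= 1) ->
  measurable_fun setT (fun u => toI01 (g u)).
Proof.
move=> mg g01; apply: measurable_fun_I01 => _ [V oV <-].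
rewrite (_ : _ @^-1` _ = g @^-1` V).
  by rewrite -[X in measurable X]setTI; apply: mg => //; exact: open_measurable.
apply/seteqP; split => u /=; rewrite -[set_val _]/(val (toI01 (g u))) val_toI01//.
Qed.

End unit_interval_measurability.

Section tower_partition.
Context {d : measure_display} {Y : measurableType d} {R : realType}.
Variables (T : I01 R -> I01 R) (t : R -> R) (K : R * R) (f : nat -> level R).
Variables (P : probability Y R) (lev sym : Y -> nat) (E : Y -> Y) (p : nat -> R).
Hypothesis ct : continuous t.
Hypothesis valT : forall x, val (T x) = t (val x).
Hypothesis cT : continuous T.
Hypothesis tb : forall x, 0 <= t x <= 1.
Hypothesis uK : unit_itv K.
Hypothesis tw : is_tower t K f.
Hypothesis bs : bernoulli_system P lev sym E p (lv_card f).
Hypothesis p_gt0 : forall m, 0 < p m.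

Let dur i := lv_dur (f i).

Let N_gt0 m : (0 < lv_card f m)%N.
Proof. by rewrite /lv_card expn_gt0 expn_gt0. Qed.

Let symN u : (sym u < lv_card f (lev u))%N.
Proof. by case: bs. Qed.

Let K12 : K.1 <= K.2.
Proof. by case/and3P: uK => _ /ltW. Qed.

Let mT : measurable_fun setT T.
Proof. exact: continuous_measurable_I01. Qed.

Let acode := approx_code t K f lev sym E.
Let rcode := code t K f lev sym E.

Lemma itv_in_unit x : itv_in x K -> 0 <= x <= 1.
Proof.
by move=> /andP[h1 h2]; case/and3P: uK => ? ? ?; apply/andP; split; lra.
Qed.

Definition codeI u : I01 R := toI01 (rcode u).

Lemma val_codeI u : val (codeI u) = rcode u.
Proof. by rewrite val_toI01// itv_in_unit// code_in. Qed.

Lemma val_iter j x : val (iter j T x) = iter j t (val x).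
Proof. by elim: j => //= j <-; rewrite valT. Qed.

(* [acode n] takes countably many values, each on a measurable set. *)
Lemma measurable_approx_code n (A : set R) : measurable (acode n @^-1` A).
Proof.
elim: n A => [|n IH] A.
  have [KA|nKA] := pselect (A K.1).
    by rewrite (_ : _ @^-1` _ = setT)//; apply/seteqP; split.
  by rewrite (_ : _ @^-1` _ = set0)//; apply/seteqP; split.
rewrite (_ : _ @^-1` _ = \bigcup_m \bigcup_a [set u | [/\ lev u = m, sym u = a &
    (acode n @^-1` (pullback t (block f m a) @^-1` A)) (E u)]]).
  apply: bigcup_measurable => m _; apply: bigcup_measurable => a _.
  by have [_ mS _] := bs; apply: mS; exact: IH.
apply/seteqP; split => u /=.
  by move=> h; exists (lev u) => //; exists (sym u).
by move=> [m _ [a _ [/= <- <-]]].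
Qed.

Lemma measurable_acode_fun n (g : R -> R) : measurable_fun setT (g \o acode n).
Proof.
by move=> _ A _; rewrite setTI comp_preimage; exact: measurable_approx_code.
Qed.

Lemma measurable_codeI : measurable_fun setT codeI.
Proof.
apply: measurable_toI01 => [|u]; last by rewrite itv_in_unit// code_in.
apply: (@measurable_fun_cvg _ _ _ _ (fun n => acode n)) => [n|u _].
  exact: (measurable_acode_fun n id).
by apply: approx_code_cvg.
Qed.

Lemma iter_codeI_dur u : iter (dur (lev u)) T (codeI u) = codeI (E u).
Proof.
by apply: val_inj; rewrite val_iter !val_codeI; apply: iter_code_dur.
Qed.

(** The symbol chosen does not occur here: by [step_codeI], one step after the choice the orbit
    depends only on the level and on [E u]. This makes the digits independent of what follows. *)
Definition ret_code m v : R := limn (fun n => pullback t (lv_ret (f m)) (acode n v)).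

Lemma ret_code_chain m v : itv_in (ret_code m v) (lv_target (f m)) /\
  (fun n => pullback t (lv_ret (f m)) (acode n v)) @ \oo --> ret_code m v.
Proof.
have [_ cA _ _ _] := tw m.
have ain n : itv_in (acode n v) K by apply: approx_code_in.
have pin n : itv_in (pullback t (lv_ret (f m)) (acode n v)) (lv_target (f m)).
  exact: (pullback_in ct cA).
have c : cvgn (fun n => pullback t (lv_ret (f m)) (acode n v)).
  apply: nondecreasing_is_cvgn.
    apply/nondecreasing_seqP => n; apply: (pullback_mono ct cA) => //.
    by apply: approx_code_nondecr.
  by exists (lv_target (f m)).2 => _ [n _ <-]; have /andP[] := pin n.
split => //; apply/andP; split.
  by apply: limr_ge => //; apply: nearW => n; have /andP[] := pin n.
by apply: limr_le => //; apply: nearW => n; have /andP[] := pin n.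
Qed.

Definition retI m v : I01 R := toI01 (ret_code m v).

Lemma measurable_retI m : measurable_fun setT (retI m).
Proof.
apply: measurable_toI01 => [|u].
  apply: (@measurable_fun_cvg _ _ _ _
    (fun n v => pullback t (lv_ret (f m)) (acode n v))) => [n|u _].
    exact: measurable_acode_fun.
  by have [] := ret_code_chain m u.
have [/andP[h1 h2] _] := ret_code_chain m u.
have [/and3P[? ? ?] _ _ _ _] := tw m.
by apply/andP; split; lra.
Qed.

Lemma step_codeI u : T (codeI u) = retI (lev u) (E u).
Proof.
apply: val_inj; rewrite valT val_codeI val_toI01; last first.
  have [/andP[h1 h2] _] := ret_code_chain (lev u) (E u).
  have [/and3P[? ? ?] _ _ _ _] := tw (lev u).
  by apply/andP; split; lra.
apply: (cvg_unique _ (@step_code_cvg _ _ _ _ _ ct K12 tw lev sym E symN u)) => //.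
by have [] := ret_code_chain (lev u) (E u).
Qed.

Section one_level.
Variables (m kk : nat).
Let q := (2 ^ m)%N.
Hypothesis q_le : (q <= kk)%N.
Let B := lv_digits f m.
Let N := lv_card f m.
Let Q := lv_marker (f m).
Let fan := lv_fan (f m).

Let q_gt0 : (0 < q)%N. Proof. by rewrite expn_gt0. Qed.

(* The letter is read in advance: it is the digit of the future choice [a] whose
   index is the time [e] left until the first visit to [Q]. *)
Definition letter_set (l : nat) : set (I01 R) :=
  \bigcup_(e in `I_B) \bigcup_(a in [set a | (a < N)%N /\ digit q e a = l])
    ([set x | (fan a).1 <= iter e t (val x) < (fan a).2] `&`
     \bigcap_(e' in `I_e) [set x | ~ itv_in (iter e' t (val x)) Q]).

(** The branches lie in [Q], so [e] is the time of the first visit to [Q]; then the disjoint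
    half-open branches determine [a]. *)
Lemma letter_set_unique l l' x : letter_set l x -> letter_set l' x -> l = l'.
Proof.
have [_ _ _ [fan1 fan2] _] := tw m.
move=> [e /= eB [a /= [aN <-] [/andP[/= h1 h2] h3]]].
move=> [e' /= eB' [a' /= [aN' <-] [/andP[/= h1' h2'] h3']]].
have inQ b y : (b < N)%N -> (fan b).1 <= y < (fan b).2 -> itv_in y Q.
  move=> bN /andP[g1 g2]; have [_ bQ _ _] := fan1 b bN.
  by apply: itv_in_sub bQ; rewrite /itv_in g1 ltW.
have ee' : e = e'.
  apply/eqP; rewrite eqn_leq; apply/andP; split; rewrite leqNgt; apply/negP => h.
    by apply: (h3 _ h); apply: (inQ a') => //; rewrite h1'.
  by apply: (h3' _ h); apply: (inQ a) => //; rewrite h1.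
rewrite -{e'}ee' in eB' h1' h2' h3' *.
have [->//|aa'] := eqVneq a a'.
by case: (fan2 a a' aN aN' aa') => h; exfalso; move: h1 h2 h1' h2' h; rewrite /fan; lra.
Qed.

Lemma continuous_iter_val e : continuous (fun x : I01 R => iter e t (val x)).
Proof.
move=> x; apply: (@continuous_comp _ _ _ (fun z : I01 R => val z) (iter e t)).
  exact: continuous_val_I01.
exact: (continuous_iter ct).
Qed.

Lemma measurable_letter_set l : measurable (letter_set l).
Proof.
apply: bigcup_measurable => e _; apply: bigcup_measurable => a _.
have cI := @continuous_iter_val.
apply: measurableI.
  rewrite (_ : mkset _ = ~` [set x | iter e t (val x) < (fan a).1] `&`
      [set x | iter e t (val x) < (fan a).2]).
    by apply: measurableI; [apply: measurableC|]; exact: measurable_lt_I01.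
  apply/seteqP; split => x /=; first by move=> /andP[h1 h2]; split => //; rewrite ltNge h1.
  by move=> [/negP h1 h2]; rewrite leNgt h1.
apply: bigcap_measurableType => e' _; apply: measurableC.
rewrite [X in measurable X](_ : _ = ~` [set x | iter e' t (val x) < Q.1] `&`
    ~` [set x | Q.2 < iter e' t (val x)]); last first.
  rewrite /itv_in; apply/seteqP; split => x /=.
    by move=> /andP[h1 h2]; split; apply/negP; rewrite -leNgt.
  by move=> [/negP h1 /negP h2]; rewrite !leNgt h1.
apply: measurableI; apply: measurableC; first exact: measurable_lt_I01.
exact: measurable_gt_I01.
Qed.

(** The letter [0] also takes the points at which no letter is read, and the letters from [q] on
    stay empty, so that any [kk >= q] is served. *)
Definition look_ahead (l : 'I_kk) : set (I01 R) :=
  if l == 0%N :> nat then ~` \bigcup_(l' in [set l' | (0 < l' < q)%N]) letter_set l'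
  else if (l < q)%N then letter_set l else set0.

Lemma letter_set_sub (l : 'I_kk) : (l < q)%N -> letter_set l `<=` look_ahead l.
Proof.
rewrite /look_ahead => lq; case: eqVneq => [l0|_]; last by rewrite lq.
move=> x lx [l' /= /andP[l'0 _]] l'x.
by move: l'0; rewrite -(letter_set_unique lx l'x) l0.
Qed.

Lemma look_ahead_partition : partitions look_ahead.
Proof.
split.
- move=> l; rewrite /look_ahead; case: ifP => _.
    by apply: measurableC; apply: bigcup_measurable => l' _; exact: measurable_letter_set.
  by case: ifP => // _; exact: measurable_letter_set.
- apply/trivIsetP => l l' _ _; rewrite -(inj_eq val_inj)/= => ll'.
  apply/seteqP; split => // x []; rewrite /look_ahead.
  case: eqVneq => [l0|l0]; case: eqVneq => [l'0|l'0].
  + by rewrite l0 l'0 eqxx in ll'.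
  + move=> h; case: ifP => // l'q l'x; apply: h; exists (l' : nat) => //=.
    by rewrite lt0n l'0.
  + case: ifP => // lq lx; case; exists (l : nat) => //=.
    by rewrite lt0n l0.
  + case: ifP => // lq lx; case: ifP => // l'q l'x.
    by move: ll'; rewrite (letter_set_unique lx l'x) eqxx.
- apply/seteqP; split => // x _.
  have [[l /= /andP[l0 lq] lx]|h] :=
      pselect ((\bigcup_(l' in [set l' | (0 < l' < q)%N]) letter_set l') x).
    have lk : (l < kk)%N by exact: leq_trans q_le.
    by exists (Ordinal lk) => //; rewrite /look_ahead/= -(negbK (l == 0%N)) -lt0n l0 lq.
  have k0 : (0 < kk)%N by exact: leq_trans q_le.
  by exists (Ordinal k0).
Qed.

Lemma letter_hit (y : I01 R) v r : lev v = m -> iter r T y = codeI v -> (r < B)%N ->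
  (forall e, (e < r)%N -> ~ itv_in (iter e t (val y)) Q) ->
  letter_set (digit q r (sym v)) y.
Proof.
move=> vm yv rB avoid; exists r => //; exists (sym v).
  by split => //; rewrite /N -vm; exact: symN.
split => //=; rewrite -val_iter yv val_codeI /fan -vm.
exact: (code_fan ct K12 tw E symN).
Qed.

(** By [iter_code_avoid], the blocks of level below [m] never meet the marker; so [Q] is not visited
    before the block of level [m] starts. *)
Lemma event_codeI b e S u : event lev E dur m b e S u ->
  exists v, [/\ lev v = m, S v, iter e T (codeI u) = codeI v &
    forall e', (e' < e)%N -> ~ itv_in (iter e' t (rcode u)) Q].
Proof.
elim: b e u => //= b IH e u [[um -> Su]|[um le /IH[v [vm Sv uv avoid]]]].
  by exists u.
exists v; split => //.
  by rewrite -(subnK le) iterD iter_codeI_dur.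
move=> e' e'e; have [h|h] := ltnP e' (dur (lev u)).
  exact: (iter_code_avoid ct K12 tw symN um h).
rewrite -(subnK h) iterD -val_codeI -val_iter iter_codeI_dur val_codeI.
by apply: avoid; rewrite ltn_sub2r// (leq_ltn_trans h).
Qed.

Section words.
Variable n : nat.
Implicit Types w : {ffun 'I_n -> 'I_kk}.

(* The itinerary [w], from time [1] on, of a point that comes to [codeI v] at
   time [e]: the letters up to time [e] are the lower digits of [sym v]. *)
Definition word_set e w : set Y :=
  \bigcap_(s : 'I_n) [set v | if (s < e)%N
    then w s = digit q (e - s.+1) (sym v) :> nat
    else look_ahead (w s) (iter (s - e).+1 T (codeI v))].

Definition letter_word_set l e w : set Y :=
  [set v | lev v = m /\ digit q e (sym v) = l] `&` word_set e w.

(** At height [j] of a block of level [i], the time left before the block of level [m] is [r]: the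
    rest of the current block, then the delay [e]. Until then the letters shown are the digits [r],
    [r - 1], ..., [0] of one and the same choice. *)
Lemma letter_word_sound i j b e S (l : 'I_kk) w u : (l < q)%N ->
  lev u = i -> (i < m)%N -> (j < dur i)%N -> (e + (dur i - j) < B)%N ->
  S = letter_word_set l (e + (dur i - j)) w ->
  event lev E dur m b e S (E u) ->
  (look_ahead l `&` T @^-1` refinement T look_ahead w) (iter j T (codeI u)).
Proof.
move=> lq ui im ji rB -> /event_codeI[v [vm [[_ vl] vw] uv avoid]].
set r := (e + (dur i - j))%N in rB vl vw.
set x := iter j T (codeI u).
have ji' : (dur i = dur i - j + j)%N by rewrite subnK// ltnW.
have hit s : (s <= r)%N -> iter (r - s) T (iter s T x) = codeI v.
  move=> sr; rewrite -iterD subnK// /x -iterD /r -addnA -ji' iterD -uv.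
  by congr iter; rewrite -ui iter_codeI_dur.
have avoidx s : (s < r)%N -> ~ itv_in (iter s t (val x)) Q.
  move=> sr; rewrite /x val_iter -iterD val_codeI.
  have [h|h] := ltnP (s + j)%N (dur i).
    by apply: (iter_code_avoid ct K12 tw symN); rewrite ui.
  rewrite -(subnK h) iterD -val_codeI -val_iter -{2}ui iter_codeI_dur val_codeI.
  apply: avoid; rewrite ltn_subLR//; move: sr; rewrite /r.
  by move: ji h; clear; move: (dur i) => z; lia.
have letter s : (s <= r)%N -> letter_set (digit q (r - s) (sym v)) (iter s T x).
  move=> sr; apply: letter_hit => //; first exact: hit.
    exact: leq_ltn_trans (leq_subr _ _) rB.
  move=> e' e'rs; rewrite val_iter -iterD; apply: avoidx.
  by move: e'rs; clear; lia.
split.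
  apply: letter_set_sub => //; rewrite -vl.
  by have := letter 0%N (leq0n _); rewrite subn0.
move=> s _; rewrite /preimage/= -iterSr.
have := vw s I; rewrite /=; case: ifP => sr.
  move=> ws; apply: letter_set_sub; rewrite ws ?digit_lt//.
  exact: letter.
move/negbT: sr; rewrite -leqNgt => rs; rewrite -(hit r (leqnn _)) subnn/=.
by rewrite -iterD subnK.
Qed.

End words.
End one_level.
End tower_partition.

(** * Probabilities of words: uniformity of the current letter *)

Section symbol_sets.
Context {d : measure_display} {Y : measurableType d} {R : realType}.
Variables (P : probability Y R) (lev sym : Y -> nat) (E : Y -> Y).
Variables (p : nat -> R) (N : nat -> nat).
Hypothesis bs : bernoulli_system P lev sym E p N.

Lemma lev_sym_E_bigcup m (G : pred nat) A :
  [set u | [/\ lev u = m, G (sym u) & A (E u)]] =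
  \bigcup_(a in [set` enum [set a : 'I_(N m) | G a]%SET])
    [set u | [/\ lev u = m, sym u = val a & A (E u)]].
Proof.
have [symN _ _] := bs; apply/seteqP; split => u /=.
  move=> [um Gu AE]; have uN : (sym u < N m)%N by rewrite -um.
  by exists (Ordinal uN) => //=; rewrite mem_enum inE.
by move=> [a /=]; rewrite mem_enum inE => Ga [um -> AE].
Qed.

Lemma measurable_lev_sym_E m (G : pred nat) A : measurable A ->
  measurable [set u | [/\ lev u = m, G (sym u) & A (E u)]].
Proof.
have [_ mS _] := bs; move=> mA; rewrite lev_sym_E_bigcup.
by apply: fin_bigcup_measurable => // a _; exact: mS.
Qed.

Lemma prob_lev_sym_E m (G : pred nat) A : measurable A ->
  P [set u | [/\ lev u = m, G (sym u) & A (E u)]] =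
  ((p m / (N m)%:R *+ #|[set a : 'I_(N m) | G a]%SET|)%:E * P A)%E.
Proof.
have [_ mS pS] := bs; move=> mA; rewrite lev_sym_E_bigcup.
rewrite measure_fin_bigcup//=; last 2 first.
- by move=> a b _ _ [u /= [[_ + _] [_ + _]]] => -> /val_inj.
- by move=> a _; exact: mS.
rewrite -fsbig_seq ?enum_uniq// -[in RHS](fineK (fin_num_measure P A mA)).
under eq_bigr do rewrite pS// -(fineK (fin_num_measure P A mA)) -EFinM.
by rewrite sumEFin big_enum/= sumr_const -EFinM mulrnAl.
Qed.

End symbol_sets.

Section word_probabilities.
Context {d : measure_display} {Y : measurableType d} {R : realType}.
Variables (T : I01 R -> I01 R) (t : R -> R) (K : R * R) (f : nat -> level R).
Variables (P : probability Y R) (lev sym : Y -> nat) (E : Y -> Y) (p : nat -> R).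
Hypothesis ct : continuous t.
Hypothesis valT : forall x, val (T x) = t (val x).
Hypothesis cT : continuous T.
Hypothesis uK : unit_itv K.
Hypothesis tw : is_tower t K f.
Hypothesis bs : bernoulli_system P lev sym E p (lv_card f).
Variables (m kk n : nat).
Let q := (2 ^ m)%N.
Hypothesis q_le : (q <= kk)%N.
Let B := lv_digits f m.
Let la := look_ahead t f m (kk := kk).
Implicit Types w : {ffun 'I_n -> 'I_kk}.

Local Notation lws := (letter_word_set T t K f lev sym E m).

Let mT : measurable_fun setT T.
Proof. exact: continuous_measurable_I01. Qed.

Let q_gt0 : (0 < q)%N. Proof. by rewrite expn_gt0. Qed.

Let prefix e w (a : nat) : bool :=
  [forall s : 'I_n, (s < e)%N ==> (val (w s) == digit q (e - s.+1) a)].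

Let tail e w : set Y := \bigcap_(s : 'I_n)
  [set v | (e <= s)%N -> la (w s) (iter (s - e) T (retI t K f lev sym E m v))].

Lemma letter_word_setE l e w : lws l e w =
  [set u | [/\ lev u = m, (digit q e (sym u) == l) && prefix e w (sym u) & tail e w (E u)]].
Proof.
apply/seteqP; split => u.
  move=> [[um ul] uw]; split => //.
    rewrite -/q in ul; rewrite ul eqxx; apply/forallP => s; apply/implyP => se.
    by have := uw s I; rewrite /= se => ->.
  move=> s _ /= es; have := uw s I; rewrite /= ltnNge es/= -iterS iterSr.
  by rewrite (step_codeI ct valT uK tw bs) um.
move=> /= [um /andP[/eqP ul /forallP uw] ut]; split => // s _ /=.
case: ltnP => [se|es]; first by have /implyP/(_ se)/eqP := uw s.
by have := ut s I es; rewrite -[T (iter _ T _)]iterS iterSr (step_codeI ct valT uK tw bs) um.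
Qed.

Lemma measurable_tail e w : measurable (tail e w).
Proof.
apply: fin_bigcap_measurable => // s _ /=; case: (leqP e s) => [es|se]; last first.
  by rewrite (_ : mkset _ = setT)//; apply/seteqP; split.
rewrite (_ : mkset _ = (iter (s - e) T \o retI t K f lev sym E m) @^-1` la (w s)).
  rewrite -[X in measurable X]setTI; apply: measurableT_comp => //.
  - exact: measurable_iter.
  - exact: (measurable_retI ct uK tw bs).
  - by have [] := look_ahead_partition ct tw q_le.
by apply/seteqP; split => v /=; [exact|].
Qed.

Lemma measurable_letter_word l e w : measurable (lws l e w).
Proof.
rewrite letter_word_setE.
apply: (measurable_lev_sym_E bs m (fun a => (digit q e a == l) && prefix e w a)).
exact: measurable_tail.
Qed.

Lemma prefix_modn e w a : prefix e w (a %% q ^ e) = prefix e w a.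
Proof.
apply: eq_forallb => s; case: ltnP => //= se; rewrite digit_modn//.
by rewrite subnSK// leq_subr.
Qed.

(** By [letter_word_setE], the word constrains only the digits below [e] of the symbol and the
    independent state [E u]; digit [e] is still uniform. *)
Lemma prob_letter_word_sym l l' e w : (l < q)%N -> (l' < q)%N -> (e < B)%N ->
  P (lws l e w) = P (lws l' e w).
Proof.
move=> lq l'q eB; rewrite !letter_word_setE.
have h l0 := prob_lev_sym_E bs m (fun a => (digit q e a == l0) && prefix e w a)
  (measurable_tail e w).
rewrite !h; congr (_%:E * _)%E; congr (_ *+ _).
have cardE l0 : #|[set a : 'I_(lv_card f m) | (digit q e a == l0) && prefix e w a]%SET| =
    #|[set a : 'I_(q ^ B) | (digit q e a == l0) && prefix e w (a %% q ^ e)%N]%SET|.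
  by apply: eq_card => a; rewrite !inE prefix_modn.
by rewrite !cardE; exact: digit_card_sym.
Qed.

(** Over all letters below [q] and all words, the sets [lws l e w] partition the event [lev u = m],
    of probability [p m]; by symmetry every letter may be replaced by [0]. *)
Lemma prob_letter_word_total e : (e < B)%N ->
  q%:R * (\sum_(w : {ffun 'I_n -> 'I_kk}) fine (P (lws 0 e w))) = p m.
Proof.
move=> eB; have N_gt0 i : (0 < lv_card f i)%N by rewrite /lv_card expn_gt0 expn_gt0.
have fP l w : P (lws l e w) \is a fin_num.
  by apply: fin_num_measure; exact: measurable_letter_word.
apply: EFin_inj; rewrite -(prob_lev bs N_gt0).
have -> : [set u | lev u = m] =
    \bigcup_(lw in [set` index_enum ('I_q * {ffun 'I_n -> 'I_kk})%type]) lws lw.1 e lw.2.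
  apply/seteqP; split => [u /= um|u [lw _ [[]]]//].
  have [_ _ /seteqP[_ cov]] := look_ahead_partition ct tw q_le.
  pose c s := projT1 (cid2 (cov (iter (s - e).+1 T (codeI t K f lev sym E u)) I)).
  have dk s : (digit q (e - s.+1) (sym u) < kk)%N.
    by apply: leq_trans q_le; exact: digit_lt.
  exists (Ordinal (digit_lt e (sym u) q_gt0),
    [ffun s : 'I_n => if (s < e)%N then Ordinal (dk s) else c s]) => /=.
    by rewrite mem_index_enum.
  split => //= s _ /=; rewrite ffunE; case: ltnP => // es.
  by rewrite /c; case: cid2.
rewrite measure_fin_bigcup//=; last 2 first.
- move=> [l w] [l' w'] _ _ [u [[[_ /= ul] uw] [[_ /= ul'] uw']]].
  congr pair; first by apply: val_inj; rewrite /= -ul -ul'.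
  apply/ffunP => s; have := uw s I; have := uw' s I => /=.
  case: ltnP => [_ ws' ws|_ ws' ws]; first by apply: val_inj; rewrite /= ws ws'.
  have [_ /trivIsetP tr _] := look_ahead_partition ct tw q_le.
  have [//|ww'] := eqVneq (w s) (w' s).
  by have /seteqP[/(_ _ (conj ws ws'))] := tr (w s) (w' s) I I ww'.
- by move=> lw _; exact: measurable_letter_word.
rewrite -fsbig_seq ?index_enum_uniq//=.
under [RHS]eq_bigr do rewrite -(fineK (fP _ _)).
rewrite sumEFin; congr EFin.
rewrite -(pair_bigA _ (fun (l : 'I_q) w => fine (P (lws l e w))))/=.
rewrite mulr_natl -[X in _ *+ X](card_ord q) -sumr_const.
apply: eq_bigr => l _; apply: eq_bigr => w _.
by rewrite (prob_letter_word_sym w (ltn_ord l) q_gt0 eB).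
Qed.

End word_probabilities.

(** * Entropy of the look-ahead partition *)

Section entropy_of_look_ahead.
Context {d : measure_display} {Y : measurableType d} {R : realType}.
Variables (T : I01 R -> I01 R) (t : R -> R) (K : R * R) (f : nat -> level R).
Variables (P : probability Y R) (lev sym : Y -> nat) (E : Y -> Y) (p : nat -> R).
Hypothesis ct : continuous t.
Hypothesis valT : forall x, val (T x) = t (val x).
Hypothesis cT : continuous T.
Hypothesis uK : unit_itv K.
Hypothesis tw : is_tower t K f.
Hypothesis bs : bernoulli_system P lev sym E p (lv_card f).
Hypothesis p_gt0 : forall i, 0 < p i.
Let dur i := lv_dur (f i).
Variables (mu : probability (I01 R) R) (L : R).
Hypothesis L_gt0 : 0 < L.
Hypothesis muT : invariant_measure T mu.
Hypothesis mu_ge : forall A M, measurable A ->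
  (L^-1%:E * \sum_(i < M) \sum_(j < dur i)
     P ([set u | lev u = i] `&` (iter j T \o codeI t K f lev sym E) @^-1` A) <= mu A)%E.
Variables (m kk : nat).
Let q := (2 ^ m)%N.
Hypothesis q_le : (q <= kk)%N.
Let b := lv_period f m.
Let D := (b * dur_below f m - dur_below f m).+1.
Let la := look_ahead t f m (kk := kk).

Local Notation lws := (letter_word_set T t K f lev sym E m).

Let N_gt0 i : (0 < lv_card f i)%N.
Proof. by rewrite /lv_card expn_gt0 expn_gt0. Qed.

Let mT : measurable_fun setT T.
Proof. exact: continuous_measurable_I01. Qed.

Let delay_lt i j e : (i < m)%N -> (e < D)%N -> (e + (dur i - j) < lv_digits f m)%N.
Proof.
move=> im eD; have := dur_below_ge f im; have := leq_pmull (dur_below f m) (lv_period_gt0 f m).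
move: eD; rewrite /D /b /lv_digits /dur.
move: (lv_period f m * dur_below f m)%N (dur_below f m) (lv_dur (f i)) => x y z.
clear; lia.
Qed.

(** Different delays give disjoint events. The bound is expressed with the letter [0], by symmetry,
    because [ks_entropy_minorized] asks for one minorant for all letters. *)
Lemma prob_look_ahead_ge i n (l : 'I_kk) (w : {ffun 'I_n -> 'I_kk}) (j : 'I_(dur i)) :
  (i < m)%N -> (l < q)%N ->
  ((\sum_(e < D) p i * (event_prob p dur m b e *
      fine (P (lws 0%N (e + (dur i - j))%N w))))%:E <=
   P ([set u | lev u = i] `&` (iter j T \o codeI t K f lev sym E) @^-1`
      (la l `&` T @^-1` refinement T la w)))%E.
Proof.
move=> im lq.
pose S (e : nat) := lws l (e + (dur i - j))%N w.
have mS e : measurable (S e) by exact: (measurable_letter_word ct valT cT uK tw bs q_le).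
have Sm e : S e `<=` [set u | lev u = m] by move=> u [[]].
pose V (e : nat) := [set u | lev u = i /\ event lev E dur m b e (S e) (E u)].
have mV e : measurable (V e).
  by apply: (measurable_lev_E bs); apply: (measurable_event bs).
have PV (e : 'I_D) : P (V e) = (p i * (event_prob p dur m b e *
    fine (P (lws 0%N (e + (dur i - j))%N w))))%:E.
  rewrite (prob_lev_E bs N_gt0) ?(prob_event bs N_gt0 p_gt0)//; last exact: (measurable_event bs).
  have q_gt0 : (0 < 2 ^ m)%N by rewrite expn_gt0.
  rewrite (prob_letter_word_sym ct valT cT uK tw bs q_le w q_gt0 lq (delay_lt j im (ltn_ord e))).
  by rewrite !EFinM fineK//; apply: fin_num_measure; exact: (mS e).
rewrite -sumEFin; under eq_bigr do rewrite -PV.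
have mla k : measurable (la k) by have [] := look_ahead_partition ct tw q_le.
have mA : measurable (la l `&` T @^-1` refinement T la w).
  apply: measurableI => //; rewrite -[X in measurable X]setTI.
  by apply: mT => //; apply: measurable_refinement => //; exact: (look_ahead_partition ct tw q_le).
rewrite (fsbig_ord _ _ (fun e => P (V e))) -measure_fin_bigcup//; last first.
  move=> e e' _ _ [u [[_ h] [_ h']]]; exact: event_unique h h'.
apply: le_measure; rewrite ?inE.
- by apply: fin_bigcup_measurable.
- apply: measurableI; first exact: (measurable_lev bs).
  rewrite -[X in measurable X]setTI; apply: measurableT_comp => //.
    exact: measurable_iter.
  exact: (measurable_codeI ct uK tw bs).
move=> u [e /= eD [ui ev]]; split => //=.
exact: (letter_word_sound ct valT uK tw bs lq ui im (ltn_ord j) (delay_lt j im eD) (erefl _) ev).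
Qed.

(** The bound on [c] is the probability, in the suspension, of being in a block of level below [m]
    that is followed by fewer than [b] blocks of such levels and then by one of level [m]. There the
    letter is uniform given the future. *)
Lemma ks_entropy_look_ahead c :
  c <= L^-1 * (\sum_(i < m) p i * (dur i)%:R) *
       (\sum_(k < b) (\sum_(i < m) p i) ^+ k) * p m ->
  c * ln q%:R <= ks_entropy T mu la.
Proof.
move=> hc; have lap := look_ahead_partition ct tw q_le.
have q_gt0 : (0 < q)%N by rewrite expn_gt0.
pose F n (w : {ffun 'I_n -> 'I_kk}) : R :=
  L^-1 * \sum_(i < m) \sum_(j < dur i) \sum_(e < D) p i * (event_prob p dur m b e *
      fine (P (lws 0%N (e + (dur i - j))%N w))).
pose S := [set widen_ord q_le l | l : 'I_q]%SET.
have cardS : #|S| = q.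
  rewrite card_imset ?card_ord// => l l' /(congr1 val)/= /val_inj//.
rewrite -cardS; apply: (ks_entropy_minorized mT muT lap (F := F)).
- by rewrite cardS.
- move=> n w; rewrite mulr_ge0 ?invr_ge0 ?(ltW L_gt0)//.
  do 3![apply: sumr_ge0 => ? _]; rewrite mulr_ge0 ?(ltW (p_gt0 _))//.
  by rewrite mulr_ge0 ?event_prob_ge0 ?fine_ge0.
- move=> n _ w /imsetP[l _ ->]; rewrite EFinM.
  apply: le_trans (mu_ge m _); last first.
    apply: measurableI; first by case: lap.
    rewrite -[X in measurable X]setTI.
    by apply: mT => //; exact: measurable_refinement.
  rewrite lee_wpmul2l ?lee_fin ?invr_ge0 ?(ltW L_gt0)//.
  rewrite -sumEFin; apply: lee_sum => i _; rewrite -sumEFin; apply: lee_sum => j _.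
  by apply: prob_look_ahead_ge => //=.
move=> n; apply: (le_trans hc); rewrite cardS.
have sumE (i : 'I_m) (j : 'I_(dur i)) :
    q%:R * (\sum_(w : {ffun 'I_n -> 'I_kk}) \sum_(e < D) p i * (event_prob p dur m b e *
      fine (P (lws 0%N (e + (dur i - j))%N w)))) =
    p i * (\sum_(e < D) event_prob p dur m b e) * p m.
  rewrite exchange_big/= mulr_sumr -mulrA (mulr_suml _ _ _ (p m)) mulr_sumr.
  apply: eq_bigr => e _; rewrite -mulr_sumr -mulr_sumr mulrCA; congr (_ * _).
  rewrite mulrCA; congr (_ * _).
  exact: (prob_letter_word_total ct valT cT uK tw bs _ q_le (delay_lt j (ltn_ord i) (ltn_ord e))).
have -> : q%:R * (\sum_w F n w) =
    L^-1 * (\sum_(i < m) p i * (dur i)%:R) * (\sum_(e < D) event_prob p dur m b e) * p m.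
  rewrite /F -mulr_sumr mulrCA -!mulrA; congr (_ * _).
  rewrite exchange_big/= mulr_sumr mulr_suml; apply: eq_bigr => i _.
  rewrite exchange_big/= mulr_sumr. rewrite (eq_bigr _ (fun j _ => sumE i j)).
  by rewrite sumr_const card_ord -mulr_natr; ring.
rewrite ler_pM2r// ler_wpM2l//.
  rewrite mulr_ge0 ?invr_ge0 ?(ltW L_gt0)//; apply: sumr_ge0 => i _.
  by rewrite mulr_ge0// ltW.
apply: (sum_event_prob p_gt0 (L := dur_below f m)); first exact: dur_below_ge.
by rewrite /D /b; move: (lv_period f m * dur_below f m)%N (dur_below f m) => x y; clear; lia.
Qed.

End entropy_of_look_ahead.

(** * Choice of the frequencies and conclusion *)

Section series_bounds.
Context {R : realType}.

(** The later terms add up to at most 1/2, hence to at most [a 0]. Applied to mean durations, this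
    gives blocks of level 0 at least half of the time. *)
Lemma head_dominated_series (a : nat -> R) : (forall i, 0 <= a i) ->
  1 / 2 <= a 0%N -> (forall i, a i.+1 <= (1 / 2) ^+ i.+2) ->
  exists L, [/\ (\sum_(0 <= i <oo) (a i)%:E)%E = L%:E, 0 < L & L <= 2 * a 0%N].
Proof.
move=> a_ge0 a0 ageo; pose u n := \sum_(0 <= i < n) a i.
have u_nd : nondecreasing_seq u.
  by apply/nondecreasing_seqP => n; rewrite /u big_nat_recr//= lerDl.
have uS n : u n.+1 <= a 0%N + 1 / 2 - (1 / 2) ^+ n.+1.
  elim: n => [|n IH]; first by rewrite /u big_nat1 expr1; lra.
  rewrite /u big_nat_recr//= -/(u n.+1).
  by have := ageo n; rewrite [X in _ <= X]exprS [X in _ - X]exprS; lra.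
have u_le n : u n <= 2 * a 0%N.
  apply: (le_trans (u_nd _ _ (leqnSn n))); apply: (le_trans (uS n)).
  have : 0 <= (1 / 2 : R) ^+ n.+1 by rewrite exprn_ge0.
  lra.
have cu : cvgn u by apply: nondecreasing_is_cvgn => //; exists (2 * a 0%N) => _ [n _ <-].
exists (limn u); split.
- rewrite -EFin_lim//; congr (limn _); apply/funext => n /=.
  by rewrite /u sumEFin.
- have := nondecreasing_cvgn_le u_nd cu 1%N; rewrite /u big_nat1; lra.
- by apply: limr_le => //; exact: nearW.
Qed.

Lemma sum_expr_ge (x : R) n : 0 <= x <= 1 ->
  n%:R - n%:R ^+ 2 * x / 2 <= \sum_(k < n) (1 - x) ^+ k.
Proof.
move=> x01; have bern k : 1 - k%:R * x <= (1 - x) ^+ k.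
  elim: k => [|k IH]; first by rewrite mul0r subr0.
  rewrite exprS; apply: (@le_trans _ _ ((1 - x) * (1 - k%:R * x))).
    have : 0 <= k%:R * (x ^+ 2) :> R by rewrite mulr_ge0 ?sqr_ge0.
    by rewrite -natr1; nra.
  by rewrite ler_wpM2l//; lra.
elim: n => [|n IH]; first by rewrite big_ord0; lra.
rewrite big_ord_recr/= -natr1; have := bern n; nra.
Qed.

End series_bounds.

Section tower_measure_dimension.
Context {R : realType}.
Variables (T : I01 R -> I01 R) (t : R -> R) (K : R * R) (f : nat -> level R).
Hypothesis ct : continuous t.
Hypothesis valT : forall x, val (T x) = t (val x).
Hypothesis cT : continuous T.
Hypothesis uK : unit_itv K.
Hypothesis tw : is_tower t K f.

Let per m : R := (lv_period f m)%:R.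
(** The probability of a level at least [m]. *)
Let s m : R := if m is 0%N then 1 else (per m)^-1.
Let p m : R := s m - s m.+1.
Let dur i := lv_dur (f i).

Let per_gt0 m : 0 < per m.
Proof. by rewrite ltr0n lv_period_gt0. Qed.

Let per_ge m : 2 ^+ m.+2 * (dur m)%:R <= per m.
Proof. by rewrite -natrX -natrM ler_nat lv_period_ge. Qed.

Let s_half m : 2 * s m.+1 <= s m.
Proof.
have dur1 : 1 <= (dur m.+1)%:R :> R by rewrite ler1n.
case: m dur1 => [|m] dur1 /=.
  rewrite -ler_pdivlMl// mulr1 lef_pV2 ?posrE//.
  by have := per_ge 1; rewrite (exprD _ 1 2); lra.
rewrite -ler_pdivlMl// -invfM lef_pV2 ?posrE ?mulr_gt0//.
by rewrite /per -natrM ler_nat lv_period_double.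
Qed.

Let s_gt0 m : 0 < s m.
Proof. by case: m => //= m; rewrite invr_gt0. Qed.

Let s_decr m : s m.+1 < s m.
Proof. by have := s_half m; have := s_gt0 m.+1; lra. Qed.

Let s_small e : 0 < e -> exists m, s m < e.
Proof.
move=> e0; have [n ne] := @expr_small _ (1 / 2) (e / 2) ltac:(lra) ltac:(lra) ltac:(lra).
exists n; suff : s n <= (1 / 2) ^+ n by lra.
elim: (n) => [//|k IH]; rewrite exprS; have := s_half k; lra.
Qed.

Let p_gt0 m : 0 < p m.
Proof. by rewrite subr_gt0. Qed.

Let sum_p m : \sum_(i < m) p i = 1 - s m.
Proof.
elim: m => [|m IH]; first by rewrite big_ord0 subrr.
by rewrite big_ord_recr/= IH /p addrA subrK.
Qed.

Let N_gt0 i : (0 < lv_card f i)%N.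
Proof. by rewrite /lv_card expn_gt0 expn_gt0. Qed.

Lemma tower_mdim_gt0 : exists mu : probability (I01 R) R,
  invariant_measure T mu /\ (0 < mdim_KS T mu)%E.
Proof.
have [P [lev [sym [E bs]]]] := bernoulli_exists erefl s_gt0 s_decr s_small N_gt0.
have [||| L [L_series L_gt0 L_le]] := @head_dominated_series R (fun i => p i * (dur i)%:R).
- by move=> i; rewrite mulr_ge0// ltW.
- have : 1 <= (dur 0)%:R :> R by rewrite ler1n.
  by have := s_half 0; rewrite /p /=; nra.
- move=> i; apply: (@le_trans _ _ (s i.+1 * (dur i.+1)%:R)).
    by rewrite ler_wpM2r// /p; have := s_gt0 i.+2; lra.
  rewrite /= mulrC ler_pdivrMr// div1r exprVn ler_pdivlMl ?exprn_gt0//.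
  apply: le_trans (per_ge _); rewrite ler_wpM2r// [leRHS]exprS.
  by have : 0 < (2 : R) ^+ i.+2; [rewrite exprn_gt0 | lra].
have mT : measurable_fun setT T by exact: continuous_measurable_I01.
have mh := measurable_codeI ct uK tw bs.
have hd u : iter (dur (lev u)) T (codeI t K f lev sym E u) = codeI t K f lev sym E (E u).
  exact: (iter_codeI_dur ct valT uK tw bs).
have [mu [muT mu_ge]] :=
  stationary_measure_exists bs N_gt0 p_gt0 I01_0 mT mh hd L_gt0 L_series.
exists mu; split => //; apply: (@mdim_KS_gt0 _ _ _ _ _ (1 / 8)); first lra.
move=> m k m0 mk; exists (look_ahead t f m (kk := k)).
  exact: (look_ahead_partition ct tw mk).
apply: (ks_entropy_look_ahead ct valT cT uK tw bs p_gt0 L_gt0 muT mu_ge mk).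
have head : p 0%N * (dur 0)%:R <= \sum_(i < m) p i * (dur i)%:R.
  rewrite (bigD1 (Ordinal m0))//= lerDl; apply: sumr_ge0 => i _.
  by rewrite mulr_ge0// ltW.
have smE : s m = (per m)^-1 by case: (m) m0.
have per1 : 1 <= per m by rewrite /per ler1n lv_period_gt0.
have runs : per m / 2 <= \sum_(i < lv_period f m) (\sum_(i < m) p i) ^+ i.
  rewrite sum_p smE; apply: le_trans (sum_expr_ge _ _).
    by rewrite -/(per m) expr2 mulfK ?gt_eqF//; lra.
  by rewrite invr_ge0 ltW//= invf_le1.
have pm : (per m)^-1 / 2 <= p m by have := s_half m; rewrite /p -smE; lra.
(* Three factors 1/2: the share of time in blocks of level 0, the sum of the powers of
   [1 - 1 / per m] compared with [per m], and [p m] compared with [1 / per m]. *)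
have -> : 1 / 8 = 1 / 2 * (per m / 2) * ((per m)^-1 / 2).
  have := divff (lt0r_neq0 (per_gt0 m)); nra.
have L2 : 1 / 2 <= L^-1 * \sum_(i < m) p i * (dur i)%:R.
  by rewrite ler_pdivlMl//; lra.
apply: ler_pM => //; first by rewrite !mulr_ge0// ltW.
  by rewrite divr_ge0// invr_ge0 ltW.
by apply: ler_pM => //; rewrite divr_ge0// ltW.
Qed.

End tower_measure_dimension.

Theorem corollary5 (R : realType) (x1 y1 x2 y2 : R)
  (hp : zipper_param ((x1, y1), (x2, y2)))
  (hyp : 1 < Num.min (y1 / x1)
               (Num.min ((y1 - y2) / (x2 - x1)) ((1 - y2) / (1 - x2)))) :
  let T := zipper_map ((x1, y1), (x2, y2)) in
  exists mu : probability (I01 R) R,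
    invariant_measure T mu /\ (0 < mdim_KS T mu)%E.
Proof.
move=> T; have hb := zipper_param_ineq hp.
have [hx1 hx12 hx2 _ _] := hb.
have hs : [/\ x1 < y1, x2 - x1 < y1 - y2 & 1 - x2 < 1 - y2].
  move: hyp; rewrite !lt_min !ltr_pdivlMr ?mul1r ?subr_gt0//.
  by case/and3P.
set t := zipper_fun x1 y1 x2 y2.
have ct : continuous t by exact: continuous_zipper_fun.
have tb : forall x, 0 <= t x <= 1 by exact: zipper_fun_bounded.
have growth := @zipper_growth _ _ _ _ _ t hb hs (zipper_fun0 hp) (zipper_fun1 hp)
  (zipper_fun_left hp) (zipper_fun_mid hp) (zipper_fun_right hp).
set rho := Num.min x1 _ in growth.
set lam := Num.min (y1 / x1) _ in growth.
have rho0 : 0 < rho by exact: rho_gt0 hb.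
have rho1 : rho < 1 by exact: rho_lt1 hb.
have lam1 : 1 < lam by exact: lam_gt1 hb hs.
have c0 : 0 < rho ^+ 2 / 2 by rewrite divr_gt0// exprn_gt0.
have [K uK term] := terminal_base tb rho0 lam1 c0 growth.
have avoid := zipper_avoid_record hb hs tb (zipper_fun1 hp)
  (zipper_fun_left hp) (zipper_fun_mid hp) (zipper_fun_right hp).
have [f tw] := tower_exists avoid uK (fun Q k L b E =>
  wide_fan tb rho0 rho1 lam1 c0 growth L b E term).
apply: (tower_mdim_gt0 ct _ _ uK tw).
  by move=> x; rewrite /t zipper_funE.
exact: continuous_zipper_map.
Qed.
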